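(* Let $N$, $N'$ and $M$ be prestacks and let $G, G'$ be groups with commuting actions on $M$, such that $M$ is a $G\times G'$-torsor in the following sense: there is a map $M\to N$ which is a $G$-torsor and a map $M\to N'$ which is a $G'$-torsor, so that $N\simeq M/G$ has a residual $G'$-action and $N'\simeq M/G'$ has a residual $G$-action. Then there is an isomorphism of quotient stacks $$N/G'\simeq N'/G.$$
   Context: A $G$-torsor $M\to N$ is a map which is the pullback of $\mathrm{pt}\to BG$ along some map $N\to BG$. The stacky quotient of a stack $Y$ by a group $H$ acting on it is the colimit in stacks of the simplicial action groupoid $$Y/H:=\mathrm{colim}\big(\cdots\rightrightarrows H\times H\times Y\rightrightarrows H\times Y\rightrightarrows Y\big),$$ whose last two maps are the action and the projection. The groups of interest include profinite groups, whose topology is remembered in forming the quotient. *)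

(* Defs.v *)
From mathcomp Require Import ssreflect ssrfun ssrbool eqtype monoid.
From mathcomp Require Import boolp.

Set Implicit Arguments.
Unset Strict Implicit.
Unset Printing Implicit Defensive.

Local Obligation Tactic := idtac.

(* Stacks in groupoids over an arbitrary site.

   Presheaves of groupoids are represented by the categories fibred in
   groupoids that they correspond to: this is the (2,1)-category in which
   "isomorphism", "pullback" and "colimit" are meant, and no coherence
   isomorphisms for restriction maps are needed.  A prestack is subject to no
   descent condition whatsoever (some authors require morphisms to glue). *)

Record category := Category {
  obj :> Type;
  hom : obj -> obj -> Type;
  idc : forall U, hom U U;
  comp : forall U V W, hom V W -> hom U V -> hom U W;
  compA : forall U V W T (h : hom W T) (g : hom V W) (f : hom U V),
    comp h (comp g f) = comp (comp h g) f;
  comp1c : forall U V (f : hom U V), comp (idc V) f = f;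
  compc1 : forall U V (f : hom U V), comp f (idc U) = f
}.
Arguments idc {c} U.

Declare Scope cat_scope.
Delimit Scope cat_scope with cat.
Local Open Scope cat_scope.
Notation "g \; f" := (comp g f) (at level 60, right associativity) : cat_scope.

Record sieve (C : category) (U : C) := Sieve {
  arrows :> forall V, hom V U -> Prop;
  sieveP : forall V W (f : hom V U) (g : hom W V), arrows f -> arrows (f \; g)
}.

Definition max_sieve (C : category) (U : C) : sieve U :=
  @Sieve C U (fun _ _ => True) (fun _ _ _ _ _ => I).

Program Definition pullback_sieve (C : category) (U V : C) (f : hom V U)
    (S : sieve U) : sieve V :=
  @Sieve C V (fun W g => S W (f \; g)) _.
Next Obligation. by move=> C U V f S W T g h /= Sg; rewrite compA; apply: sieveP. Qed.

Record site := Site {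
  site_cat :> category;
  covering : forall U : site_cat, sieve U -> Prop;
  covering_max : forall U : site_cat, covering (max_sieve U);
  covering_pullback : forall (U V : site_cat) (f : hom V U) (S : sieve U),
    covering S -> covering (pullback_sieve f S);
  covering_local : forall (U : site_cat) (S T : sieve U), covering S ->
    (forall V (f : hom V U), S V f -> covering (pullback_sieve f T)) ->
    covering T
}.

(* [fob X U] is the class of objects over [U]; [fhom x y] contains the
   morphisms of the total category, lying over arbitrary arrows [fpr] of the
   base.  The morphisms over identities form the fibre groupoids. *)
Record prestack (C : category) := Prestack {
  fob :> C -> Type;
  fhom : forall U V, fob U -> fob V -> Type;
  fpr : forall U V (x : fob U) (y : fob V), fhom x y -> hom U V;
  fid : forall U (x : fob U), fhom x x;
  fcomp : forall U V W (x : fob U) (y : fob V) (z : fob W),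
    fhom y z -> fhom x y -> fhom x z;
  fpr_id : forall U (x : fob U), fpr (fid x) = idc U;
  fpr_comp : forall U V W (x : fob U) (y : fob V) (z : fob W)
    (b : fhom y z) (a : fhom x y), fpr (fcomp b a) = fpr b \; fpr a;
  fcompA : forall U V W T (x : fob U) (y : fob V) (z : fob W) (t : fob T)
    (c : fhom z t) (b : fhom y z) (a : fhom x y),
    fcomp c (fcomp b a) = fcomp (fcomp c b) a;
  fcomp1c : forall U V (x : fob U) (y : fob V) (a : fhom x y),
    fcomp (fid y) a = a;
  fcompc1 : forall U V (x : fob U) (y : fob V) (a : fhom x y),
    fcomp a (fid x) = a;
  flift : forall U V (f : hom U V) (y : fob V),
    exists (x : fob U) (a : fhom x y), fpr a = f;
  fcart : forall U V W (x : fob U) (y : fob V) (z : fob W)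
    (a : fhom x y) (b : fhom z y) (h : hom W U), fpr a \; h = fpr b ->
    exists! c : fhom z x, fpr c = h /\ fcomp a c = b
}.
Arguments fhom {C p U V} x y.
Arguments fid {C p U} x.

Notation "b \c a" := (fcomp b a) (at level 60, right associativity) : cat_scope.

Record functor (C : category) (X Y : prestack C) := Functor {
  fo :> forall U, X U -> Y U;
  fm : forall U V (x : X U) (y : X V), fhom x y -> fhom (fo x) (fo y);
  fm_pr : forall U V (x : X U) (y : X V) (a : fhom x y), fpr (fm a) = fpr a;
  fm_id : forall U (x : X U), fm (fid x) = fid (fo x);
  fm_comp : forall U V W (x : X U) (y : X V) (z : X W)
    (b : fhom y z) (a : fhom x y), fm (b \c a) = fm b \c fm a
}.
Arguments fo {C X Y} f {U} x.
Arguments fm {C X Y} f {U V x y} a.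

(* Invertibility is automatic: every morphism over an identity is invertible. *)
Record two_cell (C : category) (X Y : prestack C) (f g : functor X Y) :=
  TwoCell {
    tc :> forall U (x : X U), fhom (f U x) (g U x);
    tc_pr : forall U (x : X U), fpr (tc x) = idc U;
    tc_nat : forall U V (x : X U) (y : X V) (a : fhom x y),
      tc y \c fm f a = fm g a \c tc x
  }.
Arguments tc {C X Y f g} t {U} x.

Section Functors.
Variables (C : category) (X Y Z : prestack C).

Program Definition id_functor : functor X X :=
  @Functor C X X (fun _ x => x) (fun _ _ _ _ a => a) _ _ _.
Solve All Obligations with by [].

Program Definition comp_functor (g : functor Y Z) (f : functor X Y) :
    functor X Z :=
  @Functor C X Z (fun _ x => fo g (fo f x)) (fun _ _ _ _ a => fm g (fm f a))
    _ _ _.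
Next Obligation. by intros; rewrite /= !fm_pr. Qed.
Next Obligation. by intros; rewrite /= !fm_id. Qed.
Next Obligation. by intros; rewrite /= !fm_comp. Qed.

End Functors.

Definition is_equivalence (C : category) (X Y : prestack C) (f : functor X Y)
    : Prop :=
  exists g : functor Y X,
    inhabited (two_cell (comp_functor g f) (id_functor X)) /\
    inhabited (two_cell (comp_functor f g) (id_functor Y)).

Definition equivalent (C : category) (X Y : prestack C) : Prop :=
  exists f : functor X Y, is_equivalence f.

Program Definition pt (C : category) : prestack C :=
  @Prestack C (fun _ => unit) (fun U V _ _ => hom U V) (fun _ _ _ _ f => f)
    (fun U _ => idc U) (fun _ _ _ _ _ _ g f => g \; f) _ _ _ _ _ _ _.
Next Obligation. by []. Qed.
Next Obligation. by []. Qed.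
Next Obligation. by intros; exact: compA. Qed.
Next Obligation. by intros; exact: comp1c. Qed.
Next Obligation. by intros; exact: compc1. Qed.
Next Obligation. by move=> C U V f y; exists tt, f. Qed.
Next Obligation.
by move=> C U V W x y z a b h e; exists h; split=> // c [].
Qed.

Program Definition to_pt (C : category) (X : prestack C) : functor X (pt C) :=
  @Functor C X (pt C) (fun _ _ => tt) (fun _ _ _ _ a => fpr a) _ _ _.
Next Obligation. by []. Qed.
Next Obligation. by intros; exact: fpr_id. Qed.
Next Obligation. by intros; exact: fpr_comp. Qed.

Section FibreProduct.
Variables (C : category) (X Y Z : prestack C).
Variables (f : functor X Z) (g : functor Y Z).

Record fp_ob (U : C) := FpOb {
  fp1 : X U;
  fp2 : Y U;
  fp_iso : fhom (fo f fp1) (fo g fp2);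
  fp_iso_pr : fpr fp_iso = idc U
}.

Record fp_hom (U V : C) (s : fp_ob U) (t : fp_ob V) := FpHom {
  fph1 : fhom (fp1 s) (fp1 t);
  fph2 : fhom (fp2 s) (fp2 t);
  fph_pr : fpr fph1 = fpr fph2;
  fph_iso : fp_iso t \c fm f fph1 = fm g fph2 \c fp_iso s
}.

Lemma fp_hom_eq U V (s : fp_ob U) (t : fp_ob V) (a b : fp_hom s t) :
  fph1 a = fph1 b -> fph2 a = fph2 b -> a = b.
Proof.
case: a b => [a1 a2 pa ia] [b1 b2 pb ib] /= e1 e2.
by subst; congr FpHom; apply: Prop_irrelevance.
Qed.

Program Definition fp_id U (s : fp_ob U) : fp_hom s s :=
  @FpHom U U s s (fid _) (fid _) _ _.
Next Obligation. by intros; rewrite /= !fpr_id. Qed.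
Next Obligation. by intros; rewrite /= !fm_id fcompc1 fcomp1c. Qed.

Program Definition fp_comp U V W (s : fp_ob U) (t : fp_ob V) (u : fp_ob W)
    (b : fp_hom t u) (a : fp_hom s t) : fp_hom s u :=
  @FpHom U W s u (fph1 b \c fph1 a) (fph2 b \c fph2 a) _ _.
Next Obligation. by intros; rewrite /= !fpr_comp !fph_pr. Qed.
Next Obligation.
by intros; rewrite /= !fm_comp fcompA fph_iso -fcompA fph_iso fcompA.
Qed.

Program Definition fibre_product : prestack C :=
  @Prestack C fp_ob fp_hom (fun _ _ _ _ a => fpr (fph1 a)) fp_id fp_comp
    _ _ _ _ _ _ _.
Next Obligation. by intros; exact: fpr_id. Qed.
Next Obligation. by intros; exact: fpr_comp. Qed.
Next Obligation. by intros; apply: fp_hom_eq; apply: fcompA. Qed.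
Next Obligation. by intros; apply: fp_hom_eq; apply: fcomp1c. Qed.
Next Obligation. by intros; apply: fp_hom_eq; apply: fcompc1. Qed.
Next Obligation.
move=> U V h [y1 y2 i ip].
have [x1 [a1 e1]] := flift h y1; have [x2 [a2 e2]] := flift h y2.
have e : fpr (fm g a2) \; idc U = fpr (i \c fm f a1).
  by rewrite fpr_comp !fm_pr ip e1 e2 compc1 comp1c.
have [j [[jp je] _]] := fcart e.
exists (FpOb jp).
have e12 : fpr a1 = fpr a2 by rewrite e1 e2.
by exists (@FpHom _ _ (FpOb jp) (FpOb ip) a1 a2 e12 (esym je)).
Qed.
Next Obligation.
move=> U V W x y z a b h e.
have [c1 [[c1p c1e] u1]] := fcart e.
have e2 : fpr (fph2 a) \; h = fpr (fph2 b) by rewrite -!fph_pr.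
have [c2 [[c2p c2e] u2]] := fcart e2.
have p12 : fpr c1 = fpr c2 by rewrite c1p c2p.
have i12 : fp_iso x \c fm f c1 = fm g c2 \c fp_iso z.
  have e3 : fpr (fm g (fph2 a)) \; h = fpr (fp_iso y \c fm f (fph1 b)).
    by rewrite fpr_comp !fm_pr fp_iso_pr comp1c -fph_pr.
  have [d [_ ud]] := fcart e3.
  rewrite -(ud (fp_iso x \c fm f c1)); last first.
    split; first by rewrite fpr_comp fm_pr fp_iso_pr comp1c.
    by rewrite fcompA -fph_iso -fcompA -fm_comp c1e.
  apply: ud; split; first by rewrite fpr_comp fm_pr fp_iso_pr compc1.
  by rewrite fcompA -fm_comp c2e fph_iso.
exists (FpHom p12 i12); split; first by split=> //; apply: fp_hom_eq.
move=> c [cp ce]; apply: fp_hom_eq => /=.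
  by apply: u1; split=> //; rewrite -ce.
by apply: u2; split; [rewrite -fph_pr|rewrite -ce].
Qed.

Program Definition to_fibre_product (T : prestack C) (p : functor T X)
    (q : functor T Y) (theta : two_cell (comp_functor f p) (comp_functor g q)) :
    functor T fibre_product :=
  @Functor C T fibre_product
    (fun U x => @FpOb U (fo p x) (fo q x) (tc theta x) (tc_pr theta x))
    (fun U V x y a => @FpHom U V _ _ (fm p a) (fm q a) _ (tc_nat theta a))
    _ _ _.
Next Obligation. by intros; rewrite /= !fm_pr. Qed.
Next Obligation. by intros; exact: fm_pr. Qed.
Next Obligation. by intros; apply: fp_hom_eq; apply: fm_id. Qed.
Next Obligation. by intros; apply: fp_hom_eq; apply: fm_comp. Qed.

End FibreProduct.

Section SievePrestack.
Variables (C : category) (U : C).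

Lemma sieve_hom_eq (V W : C) (f : hom V U) (g : hom W U)
  (a b : {h : hom V W | g \; h = f}) : sval a = sval b -> a = b.
Proof.
by case: a b => [a pa] [b pb] /= e; subst; congr exist; apply: Prop_irrelevance.
Qed.

(* The sieve as a full subcategory of the slice C/U; for the maximal sieve this
   is the prestack represented by U. *)
Program Definition sieve_prestack (S : sieve U) : prestack C :=
  @Prestack C (fun V => {f : hom V U | S V f})
    (fun V W f g => {h : hom V W | sval g \; h = sval f})
    (fun _ _ _ _ h => sval h)
    (fun V f => exist _ (idc V) (compc1 _))
    (fun _ _ _ _ _ _ k h => exist _ (sval k \; sval h) _)
    _ _ _ _ _ _ _.
Next Obligation.
by move=> S V W T f g u [k ek] [h eh] /=; rewrite compA ek eh.
Qed.
Next Obligation. by []. Qed.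
Next Obligation. by []. Qed.
Next Obligation. by intros; apply: sieve_hom_eq; apply: compA. Qed.
Next Obligation. by intros; apply: sieve_hom_eq; apply: comp1c. Qed.
Next Obligation. by intros; apply: sieve_hom_eq; apply: compc1. Qed.
Next Obligation.
move=> S V W h [g Sg]; exists (exist _ _ (sieveP h Sg)).
by exists (exist (fun k => g \; k = g \; h) h erefl).
Qed.
Next Obligation.
move=> S V W T [f Sf] [g Sg] [u Su] [a ea] [b eb] h /= e.
have eh : f \; h = u by move: ea eb => /= <- <-; rewrite -compA e.
exists (exist (fun k => f \; k = u) h eh); split.
  by split=> //; apply: sieve_hom_eq.
by move=> c [ec _]; apply: sieve_hom_eq.
Qed.

Program Definition sieve_incl (S : sieve U) :
    functor (sieve_prestack S) (sieve_prestack (max_sieve U)) :=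
  @Functor C (sieve_prestack S) (sieve_prestack (max_sieve U))
    (fun V f => exist _ (sval f) I) (fun _ _ _ _ h => h) _ _ _.
Next Obligation. by []. Qed.
Next Obligation. by intros; exact: sieve_hom_eq. Qed.
Next Obligation. by intros; exact: sieve_hom_eq. Qed.

End SievePrestack.

(* For every covering sieve S of U, restriction Hom(U, X) -> Hom(S, X) is an
   equivalence of groupoids: essentially surjective, and fully faithful. *)
Definition is_stack (C : site) (X : prestack C) : Prop :=
  forall (U : C) (S : sieve U), covering S ->
    (forall s : functor (sieve_prestack S) X,
       exists k : functor (sieve_prestack (max_sieve U)) X,
         inhabited (two_cell (comp_functor k (sieve_incl S)) s)) /\
    (forall (k k' : functor (sieve_prestack (max_sieve U)) X)
       (eta : two_cell (comp_functor k (sieve_incl S))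
                       (comp_functor k' (sieve_incl S))),
       exists zeta : two_cell k k',
         (forall V x, @tc _ _ _ _ _ zeta V (fo (sieve_incl S) x) = tc eta x) /\
         forall zeta' : two_cell k k',
           (forall V x,
              @tc _ _ _ _ _ zeta' V (fo (sieve_incl S) x) = tc eta x) ->
           forall V x, @tc _ _ _ _ _ zeta' V x = tc zeta x).

(* Presheaves of groups.  A profinite group enters as its sheaf of continuous
   maps, so that its topology is remembered. *)
Record group_presheaf (C : category) := GroupPresheaf {
  gsec :> C -> groupType;
  gres : forall U V, hom U V -> gsec V -> gsec U;
  gres_id : forall U (g : gsec U), gres (idc U) g = g;
  gres_comp : forall U V W (f : hom V W) (f' : hom U V) (g : gsec W),
    gres (f \; f') g = gres f' (gres f g);
  gresM : forall U V (f : hom U V) (g h : gsec V),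
    gres f (g * h)%g = (gres f g * gres f h)%g
}.

(* A (coherently associative and unital) action functor G x X -> X.  A morphism
   of G x X from (g, x) to (h, y) is a morphism x -> y along which h restricts
   to g; [amap] is the effect of the action on those.  In particular
   [amap (fid x)] relates [aob g x] to [aob h x] when g = h. *)
Record action (C : category) (G : group_presheaf C) (X : prestack C) :=
  Action {
    aob : forall U, G U -> X U -> X U;
    amap : forall U V (x : X U) (y : X V) (g : G U) (h : G V) (a : fhom x y),
      g = gres (fpr a) h -> fhom (aob g x) (aob h y);
    amap_pr : forall U V (x : X U) (y : X V) (g : G U) (h : G V)
      (a : fhom x y) (e : g = gres (fpr a) h), fpr (amap e) = fpr a;
    amap_id : forall U (x : X U) (g : G U) (e : g = gres (fpr (fid x)) g),
      amap e = fid (aob g x);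
    amap_comp : forall U V W (x : X U) (y : X V) (z : X W)
      (g : G U) (h : G V) (k : G W) (b : fhom y z) (a : fhom x y)
      (eb : h = gres (fpr b) k) (ea : g = gres (fpr a) h)
      (eba : g = gres (fpr (b \c a)) k),
      amap eba = amap eb \c amap ea;
    aassoc : forall U (g h : G U) (x : X U),
      fhom (aob g (aob h x)) (aob (g * h)%g x);
    aassoc_pr : forall U (g h : G U) (x : X U), fpr (aassoc g h x) = idc U;
    aassoc_nat : forall U V (x : X U) (y : X V) (g h : G U) (g' h' : G V)
      (a : fhom x y) (eh : h = gres (fpr a) h')
      (eg : g = gres (fpr (amap eh)) g')
      (egh : (g * h)%g = gres (fpr a) (g' * h')%g),
      aassoc g' h' y \c amap eg = amap egh \c aassoc g h x;
    aunit : forall U (x : X U), fhom (aob 1%g x) x;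
    aunit_pr : forall U (x : X U), fpr (aunit x) = idc U;
    aunit_nat : forall U V (x : X U) (y : X V) (a : fhom x y)
      (e : 1%g = gres (fpr a) 1%g),
      aunit y \c amap e = a \c aunit x;
    apentagon : forall U (g h k : G U) (x : X U)
      (e : g = gres (fpr (aassoc h k x)) g)
      (eA : (g * (h * k))%g = gres (fpr (fid x)) (g * h * k)%g),
      amap eA \c aassoc g (h * k)%g x \c amap e
        = aassoc (g * h)%g k x \c aassoc g h (aob k x);
    atriangle_l : forall U (g : G U) (x : X U)
      (e1 : (1 * g)%g = gres (fpr (fid x)) g),
      amap e1 \c aassoc 1%g g x = aunit (aob g x);
    atriangle_r : forall U (g : G U) (x : X U)
      (e : g = gres (fpr (aunit x)) g)
      (e1 : (g * 1)%g = gres (fpr (fid x)) g),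
      amap e1 \c aassoc g 1%g x = amap e
  }.
Arguments aob {C G X} A {U} g x : rename.
Arguments amap {C G X} A {U V x y g h} a e : rename.
Arguments aassoc {C G X} A {U} g h x : rename.
Arguments aunit {C G X} A {U} x : rename.
Arguments amap_comp {C G X a0 U V W x y z g h k b a} eb ea eba.

Program Definition triv (C : category) (G : group_presheaf C) (X : prestack C) :
    action G X :=
  @Action C G X (fun _ _ x => x) (fun _ _ _ _ _ _ a _ => a) _ _ _
    (fun _ _ _ x => fid x) _ _ (fun _ x => fid x) _ _ _ _ _.
Next Obligation. by []. Qed.
Next Obligation. by []. Qed.
Next Obligation. by []. Qed.
Next Obligation. by intros; exact: fpr_id. Qed.
Next Obligation. by intros; rewrite /= fcompc1 fcomp1c. Qed.
Next Obligation. by intros; exact: fpr_id. Qed.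
Next Obligation. by intros; rewrite /= fcompc1 fcomp1c. Qed.
Next Obligation. by intros; rewrite /= !fcompc1. Qed.
Next Obligation. by intros; rewrite /= !fcompc1. Qed.
Next Obligation. by intros; rewrite /= !fcompc1. Qed.

Record equivariant (C : category) (G : group_presheaf C) (X Y : prestack C)
    (A : action G X) (B : action G Y) (f : functor X Y) := Equivariant {
  eqv :> forall U (g : G U) (x : X U), fhom (fo f (aob A g x)) (aob B g (fo f x));
  eqv_pr : forall U (g : G U) (x : X U), fpr (eqv g x) = idc U;
  eqv_nat : forall U V (x : X U) (y : X V) (g : G U) (h : G V) (a : fhom x y)
    (e : g = gres (fpr a) h) (e' : g = gres (fpr (fm f a)) h),
    eqv h y \c fm f (amap A a e) = amap B (fm f a) e' \c eqv g x;
  eqv_assoc : forall U (g h : G U) (x : X U)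
    (e : g = gres (fpr (eqv h x)) g),
    eqv (g * h)%g x \c fm f (aassoc A g h x)
      = aassoc B g h (fo f x) \c amap B (eqv h x) e \c eqv g (aob A h x);
  eqv_unit : forall U (x : X U),
    aunit B (fo f x) \c eqv 1%g x = fm f (aunit A x)
}.
Arguments eqv {C G X Y A B f} E {U} g x : rename.

Definition equivariant_cell (C : category) (G : group_presheaf C)
    (X Y : prestack C) (A : action G X) (B : action G Y) (f f' : functor X Y)
    (E : equivariant A B f) (E' : equivariant A B f') (eta : two_cell f f')
    : Prop :=
  forall U (g : G U) (x : X U) (e : g = gres (fpr (tc eta x)) g),
    amap B (tc eta x) e \c eqv E g x = eqv E' g x \c tc eta (aob A g x).

Program Definition triv_equivariant (C : category) (G : group_presheaf C)
    (X Y : prestack C) (f : functor X Y) : equivariant (triv G X) (triv G Y) f :=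
  @Equivariant C G X Y (triv G X) (triv G Y) f (fun _ _ x => fid (fo f x))
    _ _ _ _.
Next Obligation. by intros; exact: fpr_id. Qed.
Next Obligation. by intros; rewrite /= fcompc1 fcomp1c. Qed.
Next Obligation. by intros; rewrite /= fm_id !fcompc1. Qed.
Next Obligation. by intros; rewrite /= fm_id !fcompc1. Qed.

Program Definition to_pt_equivariant (C : category) (G : group_presheaf C)
    (X : prestack C) (A : action G X) : equivariant A (triv G (pt C)) (to_pt X) :=
  @Equivariant C G X (pt C) A (triv G (pt C)) (to_pt X) (fun U _ _ => idc U)
    _ _ _ _.
Next Obligation. by []. Qed.
Next Obligation. by intros; rewrite /= amap_pr comp1c compc1. Qed.
Next Obligation. by intros; rewrite /= aassoc_pr !compc1. Qed.
Next Obligation. by intros; rewrite /= aunit_pr !compc1. Qed.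

Section CompEquivariant.
Variables (C : category) (G : group_presheaf C) (X Y Z : prestack C).
Variables (A : action G X) (B : action G Y) (D : action G Z).
Variables (g : functor Y Z) (f : functor X Y).
Variables (F : equivariant B D g) (E : equivariant A B f).

Lemma gres_vert (T : prestack C) (U : C) (h : G U) (x y : T U)
  (a : fhom x y) : fpr a = idc U -> h = gres (fpr a) h.
Proof. by move=> ->; rewrite gres_id. Qed.

Program Definition comp_equivariant : equivariant A D (comp_functor g f) :=
  @Equivariant C G X Z A D (comp_functor g f)
    (fun _ h x => eqv F h (fo f x) \c fm g (eqv E h x)) _ _ _ _.
Next Obligation. by intros; rewrite /= fpr_comp fm_pr !eqv_pr compc1. Qed.
Next Obligation.
move=> U V x y k h a e e' /=.
have e1 : k = gres (fpr (fm f a)) h by rewrite fm_pr.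
by rewrite -fcompA -fm_comp (eqv_nat E e e1) fm_comp fcompA (eqv_nat F e1 e')
  fcompA.
Qed.
Next Obligation.
move=> U k h x e /=.
have e1 : k = gres (fpr (eqv E h x)) k := gres_vert k (eqv_pr E h x).
have e2 : k = gres (fpr (fm g (eqv E h x))) k by rewrite fm_pr.
have e3 : k = gres (fpr (eqv F h (fo f x))) k := gres_vert k (eqv_pr F _ _).
rewrite (amap_comp e3 e2 e) -fcompA -fm_comp (eqv_assoc e1) !fm_comp.
rewrite fcompA (eqv_assoc e3) -!fcompA; congr (_ \c _ \c _).
by rewrite !fcompA (eqv_nat F e1 e2).
Qed.
Next Obligation. by move=> U x /=; rewrite fcompA eqv_unit -fm_comp eqv_unit. Qed.

End CompEquivariant.

(* Commuting actions: an isomorphism g (g' x) = g' (g x), natural in all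
   variables and compatible with the structure of both actions; equivalently,
   an action of the product group. *)
Record commuting (C : category) (G G' : group_presheaf C) (X : prestack C)
    (A : action G X) (A' : action G' X) := Commuting {
  cm :> forall U (g : G U) (g' : G' U) (x : X U),
    fhom (aob A g (aob A' g' x)) (aob A' g' (aob A g x));
  cm_pr : forall U (g : G U) (g' : G' U) (x : X U), fpr (cm g g' x) = idc U;
  cm_nat : forall U V (x : X U) (y : X V) (g : G U) (h : G V) (g' : G' U)
    (h' : G' V) (a : fhom x y) (e : g = gres (fpr a) h)
    (e' : g' = gres (fpr a) h')
    (ee' : g = gres (fpr (amap A' a e')) h)
    (e'e : g' = gres (fpr (amap A a e)) h'),
    cm h h' y \c amap A (amap A' a e') ee' = amap A' (amap A a e) e'e \c cm g g' x;
  cm_assoc_l : forall U (g h : G U) (g' : G' U) (x : X U)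
    (e : g = gres (fpr (cm h g' x)) g)
    (e' : g' = gres (fpr (aassoc A g h x)) g'),
    cm (g * h)%g g' x \c aassoc A g h (aob A' g' x)
      = amap A' (aassoc A g h x) e' \c cm g g' (aob A h x)
          \c amap A (cm h g' x) e;
  cm_assoc_r : forall U (g : G U) (g' h' : G' U) (x : X U)
    (e : g = gres (fpr (aassoc A' g' h' x)) g)
    (e' : g' = gres (fpr (cm g h' x)) g'),
    cm g (g' * h')%g x \c amap A (aassoc A' g' h' x) e
      = aassoc A' g' h' (aob A g x) \c amap A' (cm g h' x) e'
          \c cm g g' (aob A' h' x);
  cm_unit_l : forall U (g' : G' U) (x : X U)
    (e' : g' = gres (fpr (aunit A x)) g'),
    amap A' (aunit A x) e' \c cm 1%g g' x = aunit A (aob A' g' x);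
  cm_unit_r : forall U (g : G U) (x : X U)
    (e : g = gres (fpr (aunit A' x)) g),
    aunit A' (aob A g x) \c cm g 1%g x = amap A (aunit A' x) e
}.
Arguments cm {C G G' X A A'} c {U} g g' x.

Section CommutingTriv.
Variables (C : category) (G G' : group_presheaf C) (X : prestack C).

Program Definition commuting_triv_l (B : action G' X) : commuting (triv G X) B :=
  @Commuting C G G' X (triv G X) B (fun _ _ g' x => fid (aob B g' x))
    _ _ _ _ _ _.
Next Obligation. by intros; exact: fpr_id. Qed.
Next Obligation.
move=> B U V x y g h g' h' a e e' /= _ e''; rewrite fcomp1c fcompc1.
by congr amap; apply: Prop_irrelevance.
Qed.
Next Obligation. by intros; rewrite /= !fcompc1 amap_id. Qed.
Next Obligation. by intros; rewrite /= !fcompc1 fcomp1c amap_id fcompc1. Qed.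
Next Obligation. by intros; rewrite /= !fcompc1 amap_id. Qed.
Next Obligation. by intros; rewrite /= !fcompc1. Qed.

Program Definition commuting_triv_r (B : action G X) : commuting B (triv G' X) :=
  @Commuting C G G' X B (triv G' X) (fun _ g _ x => fid (aob B g x))
    _ _ _ _ _ _.
Next Obligation. by intros; exact: fpr_id. Qed.
Next Obligation.
move=> B U V x y g h g' h' a e e' /= e'' _; rewrite fcomp1c fcompc1.
by congr amap; apply: Prop_irrelevance.
Qed.
Next Obligation. by intros; rewrite /= amap_id !fcompc1 fcomp1c. Qed.
Next Obligation. by intros; rewrite /= amap_id !fcompc1. Qed.
Next Obligation. by intros; rewrite /= !fcompc1. Qed.
Next Obligation. by intros; rewrite /= amap_id !fcompc1. Qed.

End CommutingTriv.

(* A map equivariant for two groups separately is so for the pair of commuting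
   actions.  For [p] : M -> N a G-torsor and [c] the commutation on M, taking
   B = triv and d = commuting_triv_l B' says that the G'-action B' on N is the
   residual one: [p] is G'-equivariant compatibly with its G-invariance, as is
   M -> M/G for the G'-action induced on M/G by functoriality. *)
Definition biequivariant (C : category) (G G' : group_presheaf C)
    (X Y : prestack C) (A : action G X) (A' : action G' X) (c : commuting A A')
    (B : action G Y) (B' : action G' Y) (d : commuting B B')
    (p : functor X Y) (E : equivariant A B p) (E' : equivariant A' B' p)
    : Prop :=
  forall U (g : G U) (g' : G' U) (x : X U)
    (e : g = gres (fpr (eqv E' g' x)) g) (e' : g' = gres (fpr (eqv E g x)) g'),
    cm d g g' (fo p x) \c amap B (eqv E' g' x) e \c eqv E g (aob A' g' x)
      = amap B' (eqv E g x) e' \c eqv E' g' (aob A g x) \c fm p (cm c g g' x).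

(* [q], with its invariance datum [K], exhibits Q as the stacky quotient Y/H:
   the colimit in stacks of the simplicial action groupoid
   ... H x H x Y => H x Y => Y.
   A cocone with vertex Z is a map f : Y -> Z with an isomorphism from
   f (h y) to f y satisfying the cocycle condition over H x H x Y and the
   normalisation over Y (in a (2,1)-category the higher simplices impose
   nothing more); that is, an equivariant map to Z with trivial action.  The
   colimit property says that composition with [q] is an equivalence from the
   groupoid of maps Q -> Z to that of cocones, for every stack Z. *)
Definition is_quotient (C : site) (H : group_presheaf C) (Y : prestack C)
    (A : action H Y) (Q : prestack C) (q : functor Y Q)
    (K : equivariant A (triv H Q) q) : Prop :=
  is_stack Q /\
  forall Z : prestack C, is_stack Z ->
    (forall (f : functor Y Z) (E : equivariant A (triv H Z) f),
       exists (k : functor Q Z) (eta : two_cell (comp_functor k q) f),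
         equivariant_cell (comp_equivariant (triv_equivariant H k) K) E eta) /\
    (forall (k k' : functor Q Z)
       (eta : two_cell (comp_functor k q) (comp_functor k' q)),
       equivariant_cell (comp_equivariant (triv_equivariant H k) K)
                        (comp_equivariant (triv_equivariant H k') K) eta ->
       exists zeta : two_cell k k',
         (forall U (y : Y U), tc zeta (fo q y) = tc eta y) /\
         forall zeta' : two_cell k k',
           (forall U (y : Y U), tc zeta' (fo q y) = tc eta y) ->
           forall U (x : Q U), tc zeta' x = tc zeta x).

Definition is_quotient_stack (C : site) (H : group_presheaf C) (Y : prestack C)
    (A : action H Y) (Q : prestack C) : Prop :=
  exists (q : functor Y Q) (K : equivariant A (triv H Q) q), is_quotient K.

(* [p], with the invariance datum [P], is a G-torsor: for BG = pt/G there are a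
   map c : N -> BG and a G-equivariant 2-cartesian square

       M --> pt
     p |      | b
       N --> BG
          c                                                                  *)
Definition is_torsor (C : site) (G : group_presheaf C) (M N : prestack C)
    (A : action G M) (p : functor M N) (P : equivariant A (triv G N) p)
    : Prop :=
  exists (BG : prestack C) (b : functor (pt C) BG)
         (K : equivariant (triv G (pt C)) (triv G BG) b),
    is_quotient K /\
    exists (c : functor N BG)
           (theta : two_cell (comp_functor c p) (comp_functor b (to_pt M))),
      equivariant_cell (comp_equivariant (triv_equivariant G c) P)
                       (comp_equivariant K (to_pt_equivariant A)) theta /\
      is_equivalence (to_fibre_product theta).

(* Main.v *)
(* Both N/G' and N'/G are the stacky quotient of M by the two commuting actions:
   maps from either one to a stack Z are maps from M to Z with compatible
   invariance data under G and G'.  The point is that a G-torsor p : M -> N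
   satisfies descent, i.e. that maps N -> Z are G-invariant maps M -> Z for
   every stack Z, although N need not be a stack.  This holds by definition for
   pt -> BG and is stable under pullback along c : N -> BG because pulling back
   has a right adjoint: the prestack W over BG whose objects are pairs of an
   object x of BG and a map from the fibre of N over x to Z is again a stack,
   and maps N -> Z are sections of W, hence G-invariant maps from pt to W over
   BG, hence G-invariant maps M -> Z.  Descent for the torsor G' x M -> G' x N
   transfers G'-invariance from M to N. *)

From mathcomp Require Import ssreflect ssrfun ssrbool eqtype monoid.
From mathcomp Require Import boolp.
Require Import Defs.
Set Implicit Arguments.
Unset Strict Implicit.
Unset Printing Implicit Defensive.
Local Open Scope cat_scope.
Local Obligation Tactic := idtac.

(** The classifying stack enters only through its universal property, without a model by torsors,
    and this shapes several steps. The section of W over BG needs that property twice: with target W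
    it turns a G-invariant map from pt into a functor BG -> W, and with target BG it makes this
    functor a section up to a 2-cell. Local surjectivity of pt -> BG is extracted from it too: the
    objects locally in the image form a substack through which the quotient map factors. This
    surjectivity serves for the cocycle and unit laws of the descended G'-invariance, which are
    checked locally on the image of M, as Z is separated, instead of by descent along G' x G' x M.
    The technical weight lies in gluing objects of W. A local family of functors on fibres only
    defines a functor on those objects of the fibre whose structure arrow lies over the covering
    sieve; it extends to the whole fibre because these objects cover every other one and Z is a
    stack. Fibres are comma prestacks rather than fibre products with chosen restrictions, so that
    changing the base point is plain composition. *)

Section Lifting.
Variables (C : category) (X : prestack C).

(** This is the uniqueness half of [fcart]: every arrow is cartesian, hence monic among arrows with
    the same projection. Almost every equation of arrows below is proved by cancelling a well-chosen
    arrow in this way. *)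
Lemma fcancel U V W (x : X U) (y : X V) (z : X W) (a : fhom x y)
    (c c' : fhom z x) : fpr c = fpr c' -> a \c c = a \c c' -> c = c'.
Proof.
move=> e ea.
have ec : fpr a \; fpr c = fpr (a \c c') by rewrite fpr_comp e.
have [d [_ ud]] := fcart ec.
by rewrite -(ud c) // -(ud c').
Qed.

Definition factor U V W (x : X U) (y : X V) (z : X W) (a : fhom x y)
    (b : fhom z y) (h : hom W U) (e : fpr a \; h = fpr b) : fhom z x :=
  sval (cid (fcart e)).

Section FactorTheory.
Variables (U V W : C) (x : X U) (y : X V) (z : X W).
Variables (a : fhom x y) (b : fhom z y) (h : hom W U).
Variable e : fpr a \; h = fpr b.

Lemma factor_pr : fpr (factor e) = h.
Proof. by rewrite /factor; case: cid => c [] []. Qed.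

Lemma factorK : a \c factor e = b.
Proof. by rewrite /factor; case: cid => c [] []. Qed.

Lemma factor_uniq (c : fhom z x) : fpr c = h -> a \c c = b -> c = factor e.
Proof.
by move=> p q; apply: (@fcancel _ _ _ _ _ _ a); rewrite ?factor_pr ?factorK.
Qed.

End FactorTheory.

(** Restrictions are chosen one object at a time, with no functoriality; two choices are compared
    through [factor]. *)
Definition pullback U V (f : hom U V) (y : X V) : X U := sval (cid (flift f y)).

Definition pullback_map U V (f : hom U V) (y : X V) : fhom (pullback f y) y :=
  sval (cid (svalP (cid (flift f y)))).

Lemma pullback_map_pr U V (f : hom U V) (y : X V) : fpr (pullback_map f y) = f.
Proof. exact: svalP (cid (svalP (cid (flift f y)))). Qed.

Lemma vinv_subproof U (x y : X U) (a : fhom x y) :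
  fpr a = idc U -> fpr a \; idc U = fpr (fid y).
Proof. by move=> e; rewrite fpr_id compc1. Qed.

(** The identity of [y] factored through the cartesian arrow [a]; a right inverse by construction,
    and a left inverse by cancelling [a]. *)
Definition vinv U (x y : X U) (a : fhom x y) (e : fpr a = idc U) : fhom y x :=
  factor (vinv_subproof e).

Lemma vinv_pr U (x y : X U) (a : fhom x y) (e : fpr a = idc U) :
  fpr (vinv e) = idc U.
Proof. exact: factor_pr. Qed.

Lemma vinvK U (x y : X U) (a : fhom x y) (e : fpr a = idc U) : a \c vinv e = fid y.
Proof. exact: factorK. Qed.

Lemma vinvKl U (x y : X U) (a : fhom x y) (e : fpr a = idc U) : vinv e \c a = fid x.
Proof.
apply: (@fcancel _ _ _ _ _ _ a); first by rewrite fpr_comp e vinv_pr fpr_id comp1c.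
by rewrite fcompA vinvK fcomp1c fcompc1.
Qed.

Lemma vepi U V (x y : X U) (z : X V) (a : fhom x y) (c c' : fhom y z) :
  fpr a = idc U -> c \c a = c' \c a -> c = c'.
Proof.
by move=> e /(congr1 (fun d => d \c vinv e)); rewrite -!fcompA vinvK !fcompc1.
Qed.

End Lifting.

(** * Dependent products of prestacks *)

Section Comma.
Variables (C : category) (N B : prestack C) (c : functor N B).

(** The arrow [carr] may lie over any arrow [V -> U], so no restriction of [x] has to be chosen: by
    Yoneda this is the fibre product of [N] with the representable [U] over [B]. *)
Record comma_ob U (x : B U) (V : C) :=
  CommaOb { cob : N V; carr : fhom (fo c cob) x }.

Record comma_hom U (x : B U) V V' (u : comma_ob x V) (v : comma_ob x V') :=
  CommaHom { cmap : fhom (cob u) (cob v); cmapE : carr v \c fm c cmap = carr u }.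

Lemma comma_hom_eq U (x : B U) V V' (u : comma_ob x V) (v : comma_ob x V')
  (a b : comma_hom u v) : cmap a = cmap b -> a = b.
Proof.
by case: a b => [a ea] [b eb] /= e; subst; congr CommaHom; apply: Prop_irrelevance.
Qed.

Lemma comma_id_subproof U (x : B U) V (u : comma_ob x V) :
  carr u \c fm c (fid (cob u)) = carr u.
Proof. by rewrite fm_id fcompc1. Qed.

Lemma comma_comp_subproof U (x : B U) V V' V'' (u : comma_ob x V)
  (v : comma_ob x V') (w : comma_ob x V'') (b : comma_hom v w)
  (a : comma_hom u v) : carr w \c fm c (cmap b \c cmap a) = carr u.
Proof. by rewrite fm_comp fcompA !cmapE. Qed.

Program Definition comma U (x : B U) : prestack C :=
  @Prestack C (comma_ob x) (@comma_hom U x) (fun _ _ _ _ a => fpr (cmap a))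
    (fun V u => CommaHom (comma_id_subproof u))
    (fun _ _ _ _ _ _ b a => CommaHom (comma_comp_subproof b a))
    _ _ _ _ _ _ _.
Next Obligation. by intros; exact: fpr_id. Qed.
Next Obligation. by intros; exact: fpr_comp. Qed.
Next Obligation. by intros; apply: comma_hom_eq; apply: fcompA. Qed.
Next Obligation. by intros; apply: comma_hom_eq; apply: fcomp1c. Qed.
Next Obligation. by intros; apply: comma_hom_eq; apply: fcompc1. Qed.
Next Obligation.
move=> U x V V' f [n a]; pose m := pullback_map f n.
exists (CommaOb (a \c fm c m)).
exists (@CommaHom _ _ _ _ (CommaOb (a \c fm c m)) (CommaOb a) m erefl).
exact: pullback_map_pr.
Qed.
Next Obligation.
move=> U x V V' V'' u v w a b h /= e.
have [d [[dp de] ud]] := fcart e.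
have ed : carr u \c fm c d = carr w.
  by rewrite -(cmapE a) -fcompA -fm_comp de cmapE.
exists (CommaHom ed); split; first by split=> //; apply: comma_hom_eq.
by move=> d' [d'p d'e]; apply: comma_hom_eq; apply: ud; rewrite -d'e.
Qed.

Lemma post_subproof U U' (x : B U) (y : B U') (s : fhom x y) V V'
    (u : comma_ob x V) (v : comma_ob x V') (a : comma_hom u v) :
  (s \c carr v) \c fm c (cmap a) = s \c carr u.
Proof. by rewrite -fcompA cmapE. Qed.

Definition post_ob U U' (x : B U) (y : B U') (s : fhom x y) V
  (u : comma_ob x V) : comma_ob y V := CommaOb (s \c carr u).

Program Definition post U U' (x : B U) (y : B U') (s : fhom x y) :
    functor (comma x) (comma y) :=
  @Functor C (comma x) (comma y) (@post_ob U U' x y s)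
    (fun V V' u v a => CommaHom (post_subproof s a)) _ _ _.
Next Obligation. by []. Qed.
Next Obligation. by intros; apply: comma_hom_eq. Qed.
Next Obligation. by intros; apply: comma_hom_eq. Qed.

Variable Z : prestack C.

(* The dependent product of [Z x N] along [c : N -> B]: an object over [U] is
   an object [x] of [B] over [U] with a functor to [Z] from the fibre product
   of [N] and [U] over [B], here modelled by [comma x].  Maps from [B] to this
   prestack over [B] are maps from [N] to [Z]. *)
Record dep_ob (U : C) := DepOb {
  dbase : B U;
  dfun : functor (comma dbase) Z
}.

(* The components are indexed by the arrows [m] of [N] lying over [dmap], not
   only by the objects of [comma (dbase w)]: this is what makes composition
   free of transports along the associativity of composition. *)
Record dep_hom U U' (w : dep_ob U) (w' : dep_ob U') := DepHom {
  dmap : fhom (dbase w) (dbase w');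
  dcell : forall V V' (u : comma (dbase w) V) (v : comma (dbase w') V')
    (m : fhom (cob u) (cob v)), carr v \c fm c m = dmap \c carr u ->
    fhom (fo (dfun w) u) (fo (dfun w') v);
  dcell_pr : forall V V' (u : comma (dbase w) V) (v : comma (dbase w') V')
    (m : fhom (cob u) (cob v)) (e : carr v \c fm c m = dmap \c carr u),
    fpr (dcell e) = fpr m;
  dcell_nat : forall V V' V1 V2 (u : comma (dbase w) V)
    (v : comma (dbase w') V') (u1 : comma (dbase w) V1)
    (v1 : comma (dbase w') V2)
    (m : fhom (cob u) (cob v)) (e : carr v \c fm c m = dmap \c carr u)
    (m1 : fhom (cob u1) (cob v1)) (e1 : carr v1 \c fm c m1 = dmap \c carr u1)
    (a : fhom u u1) (b : fhom v v1), cmap b \c m = m1 \c cmap a ->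
    fm (dfun w') b \c dcell e = dcell e1 \c fm (dfun w) a
}.

(** The type of a cell mentions [dmap] through the commutation proof; quantifying over separate
    proofs for [s] and [t] avoids any transport along the equality of the base arrows. *)
Lemma dep_hom_eq U U' (w : dep_ob U) (w' : dep_ob U') (s t : dep_hom w w') :
  dmap s = dmap t ->
  (forall V V' (u : comma (dbase w) V) (v : comma (dbase w') V')
     (m : fhom (cob u) (cob v)) (e : carr v \c fm c m = dmap s \c carr u)
     (e' : carr v \c fm c m = dmap t \c carr u), dcell e = dcell e') ->
  s = t.
Proof.
case: s t => [s ds ps ns] [t dt pt nt] /= e; subst => h.
have e : ds = dt.
  apply: functional_extensionality_dep => V.
  apply: functional_extensionality_dep => V'.
  apply: functional_extensionality_dep => u.
  apply: functional_extensionality_dep => v.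
  apply: functional_extensionality_dep => m.
  by apply: functional_extensionality_dep => e; apply: h.
by subst; congr DepHom; apply: Prop_irrelevance.
Qed.

End Comma.
Arguments dcell {C N B c Z U U' w w'} d {V V' u v} m e.
Arguments dcell_nat {C N B c Z U U' w w'} d {V V' V1 V2} u v u1 v1 {m} e {m1} e1 a b _.

Section DepPrestack.
Variables (C : category) (N B : prestack C) (c : functor N B) (Z : prestack C).
Local Notation dep_ob := (dep_ob c Z).

Lemma dep_id_subproof U (x : B U) V V' (u : comma_ob c x V)
    (v : comma_ob c x V') (m : fhom (cob u) (cob v)) :
  carr v \c fm c m = fid x \c carr u -> carr v \c fm c m = carr u.
Proof. by rewrite fcomp1c. Qed.

Program Definition dep_id U (w : dep_ob U) : dep_hom w w :=
  @DepHom C N B c Z U U w w (fid (dbase w))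
    (fun V V' u v m e => @fm C _ Z (dfun w) V V' u v
       (CommaHom (dep_id_subproof e))) _ _.
Next Obligation. by intros; rewrite fm_pr. Qed.
Next Obligation.
intros; rewrite -!fm_comp; congr fm; exact: comma_hom_eq.
Qed.

Lemma dep_comp_subproof1 U U' (x : B U) (y : B U') (s : fhom x y) V
    (u : comma_ob c x V) :
  carr (post_ob s u) \c fm c (fid (cob u)) = s \c carr u.
Proof. by rewrite fm_id fcompc1. Qed.

Lemma dep_comp_subproof2 U U' U'' (x : B U) (y : B U') (z : B U'')
    (s : fhom x y) (t : fhom y z) V V' (u : comma_ob c x V)
    (v : comma_ob c z V') (m : fhom (cob u) (cob v)) :
  carr v \c fm c m = (t \c s) \c carr u ->
  carr v \c fm c m = t \c carr (post_ob s u).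
Proof. by move=> ->; rewrite /= fcompA. Qed.

(** The intermediate object is [u] itself pushed along [dmap s], with the identity of [cob u] as
    first arrow, so that nothing is chosen. [dcell_comp] shows that every other factorisation of [m]
    gives the same cell. *)
Program Definition dep_comp U U' U'' (w : dep_ob U) (w' : dep_ob U')
    (w'' : dep_ob U'') (t : dep_hom w' w'') (s : dep_hom w w') :
    dep_hom w w'' :=
  @DepHom C N B c Z U U'' w w'' (dmap t \c dmap s)
    (fun V V' u v m e =>
       dcell t (u := post_ob (dmap s) u) m (dep_comp_subproof2 e) \c
       dcell s (v := post_ob (dmap s) u) (fid (cob u)) (dep_comp_subproof1 _ _))
    _ _.
Next Obligation. by intros; rewrite /= fpr_comp !dcell_pr fpr_id compc1. Qed.
Next Obligation.
move=> U U' U'' w w' w'' t s V V' V1 V2 u v u1 v1 m e m1 e1 a b h /=.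
pose a' : @fhom _ (comma c (dbase w')) _ _ (post_ob (dmap s) u) (post_ob (dmap s) u1) :=
  fm (post c (dmap s)) a.
rewrite fcompA.
rewrite (dcell_nat t (post_ob (dmap s) u) _ (post_ob (dmap s) u1) _ _
  (dep_comp_subproof2 e1) a') //.
rewrite -!fcompA; congr (_ \c _).
by apply: dcell_nat; rewrite /= fcompc1 fcomp1c.
Qed.

Lemma dcellr U U' (w : dep_ob U) (w' : dep_ob U') (s : dep_hom w w') V V' V1
    (u : comma c (dbase w) V) (u1 : comma c (dbase w) V1)
    (v : comma c (dbase w') V') (m : fhom (cob u1) (cob v))
    (e : carr v \c fm c m = dmap s \c carr u1) (a : fhom u u1)
    (e' : carr v \c fm c (m \c cmap a) = dmap s \c carr u) :
  dcell s m e \c fm (dfun w) a = dcell s (m \c cmap a) e'.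
Proof.
rewrite -(dcell_nat s u v u1 v e' e a (fid v)) ?fm_id ?fcomp1c //.
Qed.

Lemma dcelll U U' (w : dep_ob U) (w' : dep_ob U') (s : dep_hom w w') V V' V1
    (u : comma c (dbase w) V) (v1 : comma c (dbase w') V1)
    (v : comma c (dbase w') V') (m : fhom (cob u) (cob v))
    (e : carr v \c fm c m = dmap s \c carr u) (b : fhom v v1)
    (e' : carr v1 \c fm c (cmap b \c m) = dmap s \c carr u) :
  fm (dfun w') b \c dcell s m e = dcell s (cmap b \c m) e'.
Proof.
rewrite (dcell_nat s u v u v1 e e' (fid u) b) ?fm_id ?fcompc1 //.
Qed.

Lemma dcell_congr U U' (w : dep_ob U) (w' : dep_ob U') (s : dep_hom w w') V V'
    (u : comma c (dbase w) V) (v : comma c (dbase w') V')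
    (m m' : fhom (cob u) (cob v))
    (e : carr v \c fm c m = dmap s \c carr u)
    (e' : carr v \c fm c m' = dmap s \c carr u) :
  m = m' -> dcell s m e = dcell s m' e'.
Proof. by move=> em; subst; congr dcell; apply: Prop_irrelevance. Qed.

Lemma dcell_eq U U' (w : dep_ob U) (w' : dep_ob U') (s s' : dep_hom w w') V V'
    (u : comma c (dbase w) V) (v : comma c (dbase w') V')
    (m : fhom (cob u) (cob v)) (e : carr v \c fm c m = dmap s \c carr u)
    (e' : carr v \c fm c m = dmap s' \c carr u) :
  s = s' -> dcell s m e = dcell s' m e'.
Proof. by move=> es; subst; apply: dcell_congr. Qed.

(** The arrow [m1] is also a morphism [j] of the middle comma prestack, from the pushed object used
    in [dep_comp] to [u']. Naturality lets [j] be absorbed either into the cell of [s] or into that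
    of [t]. *)
Lemma dcell_comp U U' U'' (w : dep_ob U) (w' : dep_ob U') (w'' : dep_ob U'')
    (t : dep_hom w' w'') (s : dep_hom w w') V V' V''
    (u : comma c (dbase w) V) (u' : comma c (dbase w') V')
    (u'' : comma c (dbase w'') V'')
    (m1 : fhom (cob u) (cob u')) (e1 : carr u' \c fm c m1 = dmap s \c carr u)
    (m2 : fhom (cob u') (cob u'')) (e2 : carr u'' \c fm c m2 = dmap t \c carr u')
    (m : fhom (cob u) (cob u''))
    (e : carr u'' \c fm c m = dmap (dep_comp t s) \c carr u) :
  m = m2 \c m1 -> dcell (dep_comp t s) m e = dcell t m2 e2 \c dcell s m1 e1.
Proof.
move=> em; subst m.
pose j : @fhom _ (comma c (dbase w')) _ _ (post_ob (dmap s) u) u' :=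
  @CommaHom _ _ _ _ _ _ _ _ (post_ob (dmap s) u) u' m1 e1.
have e1' : carr u' \c fm c (cmap j \c fid (cob u)) = dmap s \c carr u.
  by rewrite fcompc1.
have -> : dcell s m1 e1 = dcell s (cmap j \c fid (cob u)) e1'.
  by apply: dcell_congr; rewrite fcompc1.
rewrite -(dcelll (dep_comp_subproof1 (dmap s) u) e1') fcompA; congr (_ \c _).
rewrite (dcellr (u := post_ob (dmap s) u) e2 (a := j)) //.
  exact: (dep_comp_subproof2 e).
by move=> e'; apply: dcell_congr.
Qed.

Lemma dcell_id U (w : dep_ob U) V V' (u : comma c (dbase w) V)
    (v : comma c (dbase w) V') (m : fhom u v)
    (e : carr v \c fm c (cmap m) = dmap (dep_id w) \c carr u) :
  dcell (dep_id w) (cmap m) e = fm (dfun w) m.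
Proof. by rewrite /=; congr fm; apply: comma_hom_eq. Qed.

(** The cartesian lift of [s]: the functor on the fibre over [dbase w] is precomposed with pushing
    along [s]. *)
Definition dep_restr_ob U V (x : B U) (w : dep_ob V) (s : fhom x (dbase w)) :
  dep_ob U := DepOb (comp_functor (dfun w) (post c s)).

Program Definition dep_restr U V (x : B U) (w : dep_ob V)
    (s : fhom x (dbase w)) : dep_hom (dep_restr_ob s) w :=
  @DepHom C N B c Z U V (dep_restr_ob s) w s (fun V1 V2 u v m e =>
    @fm C _ Z (dfun w) V1 V2 (post_ob s u) v
      (@CommaHom C N B c V _ _ _ (post_ob s u) v m e)) _ _.
Next Obligation.
by move=> U V x w s V1 V2 u v m e; exact: (fm_pr (dfun w)).
Qed.
Next Obligation.
move=> U V x w s V1 V2 V3 V4 u v u1 v1 m e m1 e1 a b h1 /=.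
by rewrite -!fm_comp; congr fm; apply: comma_hom_eq.
Qed.

Section DepFactor.
Variables (U V W : C) (w1 : dep_ob U) (w2 : dep_ob V) (w3 : dep_ob W).
Variables (s : dep_hom w1 w2) (s' : dep_hom w3 w2).
Variable d : fhom (dbase w3) (dbase w1).
Hypothesis ed : dmap s \c d = dmap s'.

Lemma dep_factor_subproof1 V1 V2 (u : comma c (dbase w3) V1)
    (v : comma c (dbase w1) V2) (m : fhom (cob u) (cob v)) :
  carr v \c fm c m = d \c carr u ->
  carr (post_ob (dmap s) v) \c fm c m = dmap s' \c carr u.
Proof. by move=> e; rewrite /= -fcompA e fcompA ed. Qed.

Lemma dep_factor_subproof2 V1 V2 (u : comma c (dbase w3) V1)
    (v : comma c (dbase w1) V2) (m : fhom (cob u) (cob v))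
    (e : carr v \c fm c m = d \c carr u) :
  fpr (dcell s (v := post_ob (dmap s) v) _ (dep_comp_subproof1 (dmap s) v)) \; fpr m
    = fpr (dcell s' (v := post_ob (dmap s) v) _ (dep_factor_subproof1 e)).
Proof. by rewrite !dcell_pr fpr_id comp1c. Qed.

(** The cells of [s] at identity arrows are vertical, hence invertible, so the cells of the
    factorisation are forced: they are those of [s'] with the cell of [s] cancelled. Thus
    cartesianness in the dependent product reduces to that in [B]. *)
Program Definition dep_factor : dep_hom w3 w1 :=
  @DepHom C N B c Z _ _ w3 w1 d
    (fun V1 V2 u v m e => factor (dep_factor_subproof2 e)) _ _.
Next Obligation. by intros; rewrite factor_pr. Qed.
Next Obligation.
move=> V1 V2 V3 V4 u v u1 v1 m e m1 e1 a b h.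
apply: (fcancel (a := dcell s (v := post_ob (dmap s) v1) _ (dep_comp_subproof1 (dmap
  s) v1))).
  rewrite !fpr_comp !factor_pr !fm_pr.
  by move: (congr1 (@fpr _ _ _ _ _ _) h); rewrite !fpr_comp.
rewrite [RHS]fcompA factorK fcompA.
pose b' : @fhom _ (comma c (dbase w2)) _ _ (post_ob (dmap s) v) (post_ob (dmap s) v1) :=
  fm (post c (dmap s)) b.
rewrite -(dcell_nat s _ _ _ _ (dep_comp_subproof1 (dmap s) v) _ b b') ?fcompc1 ?fcomp1c //.
rewrite -fcompA factorK; exact: dcell_nat.
Qed.

Lemma dep_factorK : dep_comp s dep_factor = s'.
Proof.
apply: dep_hom_eq => // V1 V2 u v m e e'.
have e1 : carr (post_ob d u) \c fm c (fid (cob u)) = dmap dep_factor \c carr u.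
  exact: dep_comp_subproof1.
have e2 : carr v \c fm c m = dmap s \c carr (post_ob d u).
  by rewrite /= fcompA ed.
rewrite (dcell_comp (u' := post_ob d u) e1 e2) ?fcompc1 //.
pose j : @fhom _ (comma c (dbase w2)) _ _ (post_ob (dmap s) (post_ob d u)) v :=
  @CommaHom _ _ _ _ _ _ _ _ (post_ob (dmap s) (post_ob d u)) v m e2.
have e3 : carr v \c fm c (cmap j \c fid (cob u)) = dmap s \c carr (post_ob d u).
  by rewrite fcompc1.
have -> : dcell s (u := post_ob d u) m e2 = dcell s (u := post_ob d u) (cmap j \c fid
  (cob u)) e3.
  by apply: dcell_congr; rewrite fcompc1.
rewrite -(dcelll (dep_comp_subproof1 (dmap s) (post_ob d u)) e3) -fcompA factorK.
rewrite dcelll; first by rewrite /= fcompc1.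
by move=> e4; apply: dcell_congr; rewrite /= fcompc1.
Qed.

Lemma dep_factor_uniq (t : dep_hom w3 w1) :
  dmap t = d -> dep_comp s t = s' -> t = dep_factor.
Proof.
move=> et es; apply: dep_hom_eq => // V1 V2 u v m e e'.
apply: (fcancel (a := dcell s (v := post_ob (dmap s) v) _ (dep_comp_subproof1 (dmap s) v))).
  by rewrite !dcell_pr.
have e3 : carr (post_ob (dmap s) v) \c fm c m = dmap (dep_comp s t) \c carr u.
  by rewrite /= -fcompA e fcompA.
rewrite /= factorK -(dcell_comp (u'' := post_ob (dmap s) v) e (dep_comp_subproof1 _
  _) e3) ?fcomp1c //.
exact: dcell_eq.
Qed.

End DepFactor.

Program Definition dep_prestack : prestack C :=
  @Prestack C dep_ob (fun U V w w' => dep_hom w w')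
    (fun _ _ _ _ s => fpr (dmap s)) dep_id dep_comp _ _ _ _ _ _ _.
Next Obligation. by intros; exact: fpr_id. Qed.
Next Obligation. by intros; exact: fpr_comp. Qed.
Next Obligation.
move=> U V W T x y z t c1 b a; apply: dep_hom_eq; first exact: fcompA.
move=> V1 V2 u v m e e'.
pose u1 := post_ob (dmap a) u; pose u2 := post_ob (dmap b) u1.
have ea : carr u1 \c fm c (fid (cob u)) = dmap a \c carr u := dep_comp_subproof1 _ _.
have eb : carr u2 \c fm c (fid (cob u)) = dmap b \c carr u1 := dep_comp_subproof1 _ u1.
have ec : carr v \c fm c m = dmap c1 \c carr u2 by rewrite e' /= !fcompA.
have eba : carr u2 \c fm c (fid (cob u)) = dmap (dep_comp b a) \c carr u.
  by rewrite eb /= fcompA.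
have ecb : carr v \c fm c m = dmap (dep_comp c1 b) \c carr u1.
  by rewrite ec /= fcompA.
rewrite (dcell_comp (u' := u2) eba ec) ?fcompc1 //.
rewrite (dcell_comp (u' := u1) ea eb) ?fcompc1 //.
rewrite (dcell_comp (u' := u1) ea ecb) ?fcompc1 //.
by rewrite (dcell_comp (u := u1) (u' := u2) eb ec) ?fcompc1 // fcompA.
Qed.
Next Obligation.
move=> U V x y a; apply: dep_hom_eq; first exact: fcomp1c.
move=> V1 V2 u v m e e'.
have e1 : carr v \c fm c (fid (cob v)) = dmap (dep_id y) \c carr v.
  by rewrite fm_id fcompc1 /= fcomp1c.
rewrite (dcell_comp (u' := v) e' e1) ?fcomp1c //.
by rewrite (dcell_id (m := fid v) e1) fm_id fcomp1c.
Qed.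
Next Obligation.
move=> U V x y a; apply: dep_hom_eq; first exact: fcompc1.
move=> V1 V2 u v m e e'.
have e1 : carr u \c fm c (fid (cob u)) = dmap (dep_id x) \c carr u.
  by rewrite fm_id fcompc1 /= fcomp1c.
rewrite (dcell_comp (u' := u) e1 e') ?fcompc1 //.
by rewrite (dcell_id (m := fid u) e1) fm_id fcompc1.
Qed.
Next Obligation.
move=> U V h w.
pose s := pullback_map h (dbase w).
by exists (dep_restr_ob s), (dep_restr s); apply: pullback_map_pr.
Qed.
Next Obligation.
move=> U V W x y z a b h /= e.
have [d [[dp de] ud]] := fcart e.
exists (dep_factor de); split; first by split=> //; apply: dep_factorK.
move=> t [tp te]; apply/esym/dep_factor_uniq => //.
by apply/esym/ud; split=> //; rewrite -te.
Qed.

End DepPrestack.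

(** * Gluing in stacks *)

Lemma sieve_ext (C : category) (U : C) (S T : sieve U) :
  (forall V (f : hom V U), S V f <-> T V f) -> S = T.
Proof.
case: S T => [S Sp] [T Tp] /= h.
have e : S = T.
  apply: functional_extensionality_dep => V.
  by apply: functional_extensionality_dep => f; apply: propositional_extensionality.
by subst; congr Sieve; apply: Prop_irrelevance.
Qed.

Lemma covering_all (C : site) (U : C) (S : sieve U) :
  (forall V (f : hom V U), S V f) -> covering S.
Proof.
move=> h; suff -> : S = max_sieve U by apply: covering_max.
by apply: sieve_ext => V f; split.
Qed.

Section Representable.
Variables (C : category) (X : prestack C) (U : C) (z : X U).

Lemma point_subproof V W (f : sieve_prestack (max_sieve U) V)
    (g : sieve_prestack (max_sieve U) W) (h : fhom f g) :
  fpr (pullback_map (sval g) z) \; fpr h = fpr (pullback_map (sval f) z).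
Proof. by rewrite !pullback_map_pr; exact: svalP h. Qed.

(** The Yoneda functor: the map from the representable prestack classified by [z], built from the
    chosen restrictions. *)
Program Definition point : functor (sieve_prestack (max_sieve U)) X :=
  @Functor C (sieve_prestack (max_sieve U)) X
    (fun V f => pullback (sval f) z)
    (fun V W f g h => factor (point_subproof h)) _ _ _.
Next Obligation. by intros; apply: factor_pr. Qed.
Next Obligation.
by intros; apply/esym/factor_uniq; rewrite ?fpr_id ?fcompc1.
Qed.
Next Obligation.
intros; apply/esym/factor_uniq; first by rewrite !fpr_comp !factor_pr.
by rewrite fcompA !factorK.
Qed.

End Representable.

(** * The stack condition in terms of arrows of the total category *)

Section StackCriterion.
Variables (C : site) (X : prestack C).

(** A single lift [d] of each [f] is enough in the premise, because any two lifts of [f] with target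
    [z] differ by an isomorphism. *)
Definition separated : Prop :=
  forall (U V : C) (S : sieve U), covering S ->
  forall (z : X U) (w : X V) (a b : fhom z w), fpr a = fpr b ->
  (forall W (f : hom W U), S W f ->
     exists (x : X W) (d : fhom x z), fpr d = f /\ a \c d = b \c d) -> a = b.

Definition homs_glue : Prop :=
  forall (U V : C) (S : sieve U), covering S ->
  forall (z : X U) (w : X V) (h : hom U V)
    (beta : forall W (x : X W) (d : fhom x z), S W (fpr d) -> fhom x w),
  (forall W (x : X W) (d : fhom x z) (s : S W (fpr d)),
     fpr (beta W x d s) = h \; fpr d) ->
  (forall W W' (x : X W) (x' : X W') (d : fhom x z) (s : S W (fpr d))
     (m : fhom x' x) (s' : S W' (fpr (d \c m))),
     beta W' x' (d \c m) s' = beta W x d s \c m) ->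
  exists a : fhom z w, fpr a = h /\
    forall W (x : X W) (d : fhom x z) (s : S W (fpr d)), a \c d = beta W x d s.

Definition obs_glue : Prop :=
  forall (U : C) (S : sieve U), covering S ->
  forall s : functor (sieve_prestack S) X,
  exists (z : X U) (iota : forall V (f : sieve_prestack S V), fhom (fo s f) z),
    (forall V f, fpr (iota V f) = sval f) /\
    forall V W (f : sieve_prestack S V) (g : sieve_prestack S W) (h : fhom f g),
      iota W g \c fm s h = iota V f.

(** Factoring through the restriction of [w] makes [a] and [b] vertical; each then induces a 2-cell
    of representable functors. The two 2-cells agree on the sieve, hence everywhere by the
    uniqueness clause of the stack condition, and their values at the identity recover [a] and
    [b]. *)
Lemma stack_separated : is_stack X -> separated.
Proof.
move=> stX U V S cS z w a b e h.
have [_ ff] := stX U S cS.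
pose k := point z; pose k' := point (pullback (fpr a) w).
pose p := pullback_map (fpr a) w.
have pa0 : fpr p \; idc U = fpr a by rewrite pullback_map_pr compc1.
have pb0 : fpr p \; idc U = fpr b by rewrite pullback_map_pr compc1.
have cell (d : fhom z (pullback (fpr a) w)) (dp : fpr d = idc U) :
  {t : two_cell k k' | forall V f,
     pullback_map (sval f) _ \c @tc _ _ _ _ _ t V f = d \c pullback_map (sval f) _}.
  have e1 W (f : sieve_prestack (max_sieve U) W) :
      fpr (pullback_map (sval f) (pullback (fpr a) w)) \; idc W
        = fpr (d \c pullback_map (sval f) z).
    by rewrite fpr_comp !pullback_map_pr dp compc1 comp1c.
  unshelve eexists (@TwoCell _ _ _ k k' (fun W f => factor (e1 W f)) _ _).
  - by intros; rewrite factor_pr.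
  - move=> W W' f g m; apply: (fcancel (a := pullback_map (sval g) _)).
      by rewrite !fpr_comp !factor_pr comp1c compc1.
    by rewrite !fcompA !factorK -fcompA factorK.
  - by intros; rewrite factorK.
have [ta ha] := cell (factor pa0) (factor_pr pa0).
have [tb hb] := cell (factor pb0) (factor_pr pb0).
have [zeta [_ uz]] := ff k k'
  (@TwoCell _ _ _ (comp_functor k (sieve_incl S)) (comp_functor k' (sieve_incl S))
    (fun V x => tc ta (fo (sieve_incl S) x)) (fun V x => tc_pr ta _)
    (fun V W x y m => tc_nat ta (fm (sieve_incl S) m))).
have ua := uz ta (fun _ _ => erefl).
have ub : forall W x, tc tb x = @tc _ _ _ _ _ zeta W x.
  apply: uz => W [f Sf] /=.
  apply: (fcancel (a := pullback_map f _)); first exact: etrans (tc_pr tb (exist _ f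
    I)) (esym (tc_pr ta (exist _ f I))).
  rewrite (hb _ (exist _ f I)) (ha _ (exist _ f I)) /=.
  apply: (fcancel (a := p)).
    by rewrite !fpr_comp !factor_pr.
  rewrite !fcompA !factorK.
  have [x [d [dp de]]] := h W f Sf.
  have ex : fpr d \; idc W = fpr (pullback_map f z).
    by rewrite pullback_map_pr dp compc1.
  by rewrite -(factorK ex) !fcompA de.
move: (ua U (exist _ (idc U) I)); rewrite -ub => eab.
have := congr1 (fun d => pullback_map (idc U) _ \c d) eab.
rewrite /= (ha _ (exist _ (idc U) I)) (hb _ (exist _ (idc U) I)) /=.
move/vepi => /(_ (pullback_map_pr _ _)) ed.
by rewrite -(factorK pa0) ed factorK.
Qed.

Lemma stack_homs_glue : is_stack X -> homs_glue.
Proof.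
move=> stX U V S cS z w h beta beta_pr beta_nat.
have beta_congr W (x : X W) (d d' : fhom x z) (s : S W (fpr d))
    (s' : S W (fpr d')) : d = d' -> beta W x d s = beta W x d' s'.
  by move=> e; subst; congr beta; apply: Prop_irrelevance.
have [_ ff] := stX U S cS.
pose p := pullback_map h w; pose w' := pullback h w.
pose k := point z; pose k' := point w'.
have Sd W (f : sieve_prestack S W) : S W (fpr (pullback_map (sval f) z)).
  by rewrite pullback_map_pr; exact: svalP f.
have e W (f : sieve_prestack S W) :
    fpr (p \c pullback_map (sval f) w') \; idc W = fpr (beta _ _ _ (Sd W f)).
  by rewrite fpr_comp compc1 beta_pr !pullback_map_pr.
(* The family [beta], read at the chosen restrictions of [z], is a 2-cell over the sieve between the
   functors classified by [z] and by the restriction of [w]. *)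
have [eta etaE] : {eta : two_cell (comp_functor k (sieve_incl S))
    (comp_functor k' (sieve_incl S)) | forall W f, tc eta f = factor (e W f)}.
  unshelve eexists (@TwoCell _ _ _ (comp_functor k (sieve_incl S))
    (comp_functor k' (sieve_incl S)) (fun W f => factor (e W f)) _ _) => //.
    by intros; rewrite factor_pr.
  move=> W W' f g m.
  apply: (fcancel (a := p \c pullback_map (sval g) w')).
    by rewrite !fpr_comp !factor_pr comp1c compc1.
  rewrite !fcompA factorK -[(p \c _) \c _]fcompA factorK.
  pose m' : fhom (pullback (sval f) z) (pullback (sval g) z) :=
    fm k (fm (sieve_incl S) m).
  have em : pullback_map (sval g) z \c m' = pullback_map (sval f) z.
    exact: factorK.
  have Sm : S W (fpr (pullback_map (sval g) z \c m')) by rewrite em; exact: Sd.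
  rewrite -[fm (comp_functor k _) m]/m' -(beta_nat _ _ _ _ _ (Sd W' g) _ Sm) [RHS]factorK.
  exact: beta_congr.
have [zeta [hz _]] := ff k k' eta.
pose one : sieve_prestack (max_sieve U) U := exist _ (idc U) I.
have vz : fpr (pullback_map (idc U) z) = idc U := pullback_map_pr _ _.
have ha W (f : sieve_prestack S W) :
  (p \c pullback_map (idc U) w' \c tc zeta one \c vinv vz) \c pullback_map (sval f) z
    = beta _ _ _ (Sd W f).
  pose m : fhom (fo (sieve_incl S) f) one := exist _ (sval f) (comp1c _).
  have em : pullback_map (sval f) z = pullback_map (idc U) z \c fm k m.
    by rewrite /= factorK.
  rewrite [in LHS]em -!fcompA [vinv _ \c _]fcompA vinvKl fcomp1c (tc_nat zeta m).
  rewrite [pullback_map (idc U) w' \c _]fcompA [pullback_map _ _ \c fm k' m]factorK.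
  by rewrite hz etaE fcompA factorK.
(* The glued arrow is the extended 2-cell at the identity of [U]; the outer factors undo the
   restriction along the identity, which need not be the object itself. *)
exists (p \c pullback_map (idc U) w' \c tc zeta one \c vinv vz); split.
  by rewrite !fpr_comp (tc_pr zeta one) vinv_pr !pullback_map_pr !compc1.
move=> W x d s.
pose f : sieve_prestack S W := exist _ (fpr d) s.
have ed : fpr (pullback_map (sval f) z) \; idc W = fpr d.
  by rewrite pullback_map_pr compc1.
have Sm : S W (fpr (pullback_map (sval f) z \c factor ed)) by rewrite factorK.
transitivity (beta _ _ _ Sm).
  by rewrite (beta_nat _ _ _ _ _ (Sd W f)) -ha -[RHS]fcompA factorK.
by apply: beta_congr; rewrite factorK.
Qed.

Lemma stack_obs_glue : is_stack X -> obs_glue.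
Proof.
move=> stX U S cS s; have [es _] := stX U S cS.
have [k [t]] := es s.
pose one : sieve_prestack (max_sieve U) U := exist _ (idc U) I.
pose m V (f : sieve_prestack S V) : fhom (fo (sieve_incl S) f) one :=
  exist _ (sval f) (comp1c _).
exists (fo k one).
exists (fun V f => fm k (m V f) \c vinv (tc_pr t f)); split.
  by move=> V f; rewrite fpr_comp vinv_pr fm_pr compc1.
move=> V W f g h.
apply: (vepi (a := tc t f)); first exact: tc_pr.
rewrite -!fcompA -tc_nat vinvKl fcompc1 [vinv _ \c _]fcompA vinvKl fcomp1c.
apply: etrans (esym (fm_comp k _ _)) _.
by congr fm; apply: sieve_hom_eq; exact: svalP h.
Qed.

(** The three conditions are what can be verified for a dependent product, where arrows are explicit
    but 2-cells between functors out of a representable are unwieldy. *)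
Lemma stackP : is_stack X <-> [/\ separated, homs_glue & obs_glue].
Proof.
split=> [stX|[sep hg og] U S cS].
  split; [exact: stack_separated|exact: stack_homs_glue|exact: stack_obs_glue].
split=> [s|k k' eta].
  have [z [iota [iota_pr iota_nat]]] := og U S cS s.
  have e V (f : sieve_prestack S V) :
      fpr (iota V f) \; idc V = fpr (pullback_map (sval f) z).
    by rewrite pullback_map_pr iota_pr compc1.
  exists (point z); constructor.
  apply: (@TwoCell _ _ _ (comp_functor (point z) (sieve_incl S)) s
    (fun V f => factor (e V f))) => [V f|V W f g h]; first exact: factor_pr.
  apply: (fcancel (a := iota _ g)).
    by rewrite !fpr_comp !factor_pr !fm_pr compc1 comp1c.
  by rewrite !fcompA iota_nat !factorK.
have ex V (f : sieve_prestack (max_sieve U) V) :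
  exists a : fhom (fo k f) (fo k' f), fpr a = idc V /\
    forall W (g : sieve_prestack S W) (h : fhom (fo (sieve_incl S) g) f),
      a \c fm k h = fm k' h \c tc eta g.
  (* The component at [f] is glued over the sieve pulled back to [V]. An arrow [d] in that sieve is,
     up to a vertical [factor], the image under [k] of an arrow [hh] from an object of [S], where
     [eta] is given. *)
  pose T := pullback_sieve (sval f) S.
  have cT : covering T by apply: covering_pullback.
  have gP W (x : X W) (d : fhom x (fo k f)) : T W (fpr d) -> S W (sval f \; fpr d) by [].
  pose gg W (x : X W) (d : fhom x (fo k f)) (s : T W (fpr d)) : sieve_prestack S W :=
    exist _ _ (gP W x d s).
  pose hh W (x : X W) (d : fhom x (fo k f)) (s : T W (fpr d)) :
    fhom (fo (sieve_incl S) (gg W x d s)) f := exist _ (fpr d) erefl.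
  have e W (x : X W) (d : fhom x (fo k f)) (s : T W (fpr d)) :
      fpr (fm k (hh W x d s)) \; idc W = fpr d by rewrite fm_pr compc1.
  have [] := hg V V T cT _ (fo k' f) (idc V)
    (fun W x d s => fm k' (hh W x d s) \c tc eta (gg W x d s) \c factor (e W x d s)).
  - by move=> W x d s; rewrite !fpr_comp factor_pr (tc_pr eta (gg W x d s)) fm_pr
    !comp1c !compc1.
  - move=> W W' x x' d s m s'.
    have ev : sval (gg W x d s) \; fpr m = sval (gg W' x' (d \c m) s').
      by rewrite /= fpr_comp compA.
    pose v : fhom (gg W' x' (d \c m) s') (gg W x d s) := exist _ (fpr m) ev.
    have ehh : hh W' x' (d \c m) s' = hh W x d s \c fm (sieve_incl S) v.
      by apply: sieve_hom_eq; rewrite /= fpr_comp.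
    rewrite [X in fm k' X]ehh fm_comp -!fcompA; congr (_ \c _).
    rewrite [fm k' _ \c _]fcompA -(tc_nat eta v) -!fcompA; congr (_ \c _).
    apply: (fcancel (a := fm k (hh W x d s))).
      by rewrite !fpr_comp !factor_pr !fm_pr /= compc1 comp1c.
    rewrite !fcompA -[fm k _ \c fm _ _]fm_comp factorK.
    rewrite -[RHS](factorK (e W' x' (d \c m) s')).
    by congr (fm k _ \c _).
  move=> a [ap ae]; exists a; split=> // W g h.
  have Tg : T W (fpr (fm k h)).
    rewrite fm_pr /T /=; move: (svalP h) => /= ->; exact: svalP g.
  rewrite (ae _ _ _ Tg) fcompA.
  have ev : sval g \; idc W = sval (gg W _ (fm k h) Tg).
    rewrite /= compc1 fm_pr; exact/esym/(svalP h).
  pose v : fhom (gg W _ (fm k h) Tg) g := exist _ (idc W) ev.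
  have ehh : hh W _ (fm k h) Tg = h \c fm (sieve_incl S) v.
    by apply: sieve_hom_eq; rewrite /= fm_pr compc1.
  rewrite [X in fm k' X]ehh fm_comp -[(_ \c fm k' _) \c _]fcompA -(tc_nat eta v) -!fcompA.
  rewrite -[X in _ \c X = _]fcompc1 -[RHS]fcompc1 -!fcompA; congr (_ \c _ \c _).
  rewrite fcompc1.
  apply: (fcancel (a := fm k h)).
    by rewrite !fpr_comp factor_pr fm_pr fpr_id compc1.
  by rewrite fcompA -[fm k h \c fm _ _]fm_comp -ehh factorK fcompc1.
pose t V f := sval (cid (ex V f)).
have t_pr V f : fpr (t V f) = idc V by case: (svalP (cid (ex V f))).
have tE V f W g (h : fhom (fo (sieve_incl S) g) f) : t V f \c @fm _ _ _ k W _ _ _ h =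
  fm k' h \c tc eta g.
  exact: (proj2 (svalP (cid (ex V f)))).
unshelve eexists (@TwoCell _ _ _ k k' t t_pr _).
  move=> V V' f f' m.
  apply: (sep V V' (pullback_sieve (sval f) S)).
  - exact: covering_pullback.
  - by rewrite !fpr_comp !t_pr !fm_pr comp1c compc1.
  move=> W g s.
  pose h : fhom (fo (sieve_incl S) (exist (S W) (sval f \; g) s)) f := exist _ g erefl.
  exists (fo k (fo (sieve_incl S) (exist (S W) (sval f \; g) s))), (fm k h); split;
    first by rewrite fm_pr.
  rewrite -!fcompA (tE V f _ (exist (S W) (sval f \; g) s)) -fm_comp.
  by rewrite (tE V' f' _ (exist (S W) (sval f \; g) s)) fm_comp -!fcompA.
split=> [V f|zeta' hz V f].
  have := tE _ (fo (sieve_incl S) f) _ f (fid _).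
  by rewrite !fm_id fcompc1 fcomp1c.
apply: (sep V V (pullback_sieve (sval f) S)).
- exact: covering_pullback.
- by rewrite tc_pr /= t_pr.
move=> W g s.
pose h : fhom (fo (sieve_incl S) (exist (S W) (sval f \; g) s)) f := exist _ g erefl.
exists (fo k (fo (sieve_incl S) (exist (S W) (sval f \; g) s))), (fm k h); split;
  first by rewrite fm_pr.
by rewrite tc_nat hz (tE V f _ (exist (S W) (sval f \; g) s)).
Qed.

End StackCriterion.

Section GlueAlong.
Variables (C : site) (Y Z : prestack C) (phi : functor Y Z).
Variables (U V : C) (S : sieve U).
Hypothesis coverS : covering S.
Variables (y : Y U) (w : Z V).

(** Every restriction of [phi y] is isomorphic to the image of a restriction of [y], so arrows out
    of [phi y] can be tested in [Y]. With [phi] the functor of an object of the dependent product,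
    sieves are thus refined inside the fibre. *)
Lemma separated_along (a b : fhom (fo phi y) w) : separated Z ->
  fpr a = fpr b ->
  (forall W (x : Y W) (nu : fhom x y), S W (fpr nu) ->
     a \c fm phi nu = b \c fm phi nu) -> a = b.
Proof.
move=> sep e h; apply: (sep _ _ S) => // W f Sf.
exists (fo phi (pullback f y)), (fm phi (pullback_map f y)).
rewrite fm_pr pullback_map_pr; split=> //.
by apply: h; rewrite pullback_map_pr.
Qed.

Lemma homs_glue_along (h : hom U V)
    (T : forall W (x : Y W) (nu : fhom x y), S W (fpr nu) -> fhom (fo phi x) w) :
  homs_glue Z ->
  (forall W (x : Y W) (nu : fhom x y) (s : S W (fpr nu)),
     fpr (T W x nu s) = h \; fpr nu) ->
  (forall W W' (x : Y W) (x' : Y W') (nu : fhom x y) (s : S W (fpr nu))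
     (mu : fhom x' x) (s' : S W' (fpr (nu \c mu))),
     T W' x' (nu \c mu) s' = T W x nu s \c fm phi mu) ->
  exists a : fhom (fo phi y) w, fpr a = h /\
    forall W (x : Y W) (nu : fhom x y) (s : S W (fpr nu)),
      a \c fm phi nu = T W x nu s.
Proof.
move=> hg T_pr T_nat.
have T_congr W (x : Y W) (nu nu' : fhom x y) (s : S W (fpr nu))
    (s' : S W (fpr nu')) : nu = nu' -> T W x nu s = T W x nu' s'.
  by move=> e; subst; congr T; apply: Prop_irrelevance.
pose nu W (f : hom W U) := pullback_map f y.
have Snu W (x : Z W) (d : fhom x (fo phi y)) (s : S W (fpr d)) :
  S W (fpr (nu W (fpr d))) by rewrite pullback_map_pr.
have e W (x : Z W) (d : fhom x (fo phi y)) :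
    fpr (fm phi (nu W (fpr d))) \; idc W = fpr d.
  by rewrite fm_pr pullback_map_pr compc1.
(* The datum [T] is extended to an arbitrary arrow [d] into [phi y] by factoring [d] through the
   image of the chosen restriction of [y]. *)
have [] := hg U V S coverS (fo phi y) w h
  (fun W x d s => T W _ (nu W (fpr d)) (Snu W x d s) \c factor (e W x d)).
- by move=> W x d s; rewrite fpr_comp T_pr factor_pr compc1 pullback_map_pr.
- move=> W W' x x' d s m s'.
  have ej : fpr (nu W (fpr d)) \; fpr m = fpr (nu W' (fpr (d \c m))).
    by rewrite !pullback_map_pr fpr_comp.
  have s2 : S W' (fpr (nu W (fpr d) \c factor ej)) by rewrite factorK; apply: Snu.
  rewrite -(T_congr _ _ _ _ s2) ?factorK // (T_nat _ _ _ _ _ (Snu W x d s)).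
  rewrite -!fcompA; congr (_ \c _).
  apply: (fcancel (a := fm phi (nu W (fpr d)))).
    by rewrite [LHS]fpr_comp [RHS]fpr_comp fm_pr !factor_pr compc1 comp1c.
  by rewrite !fcompA -fm_comp !factorK.
move=> a [ap ae]; exists a; split=> // W x m s.
have s1 : S W (fpr (fm phi m)) by rewrite fm_pr.
rewrite (ae _ _ _ s1).
have ej : fpr (nu W (fpr (fm phi m))) \; idc W = fpr m.
  by rewrite pullback_map_pr fm_pr compc1.
have s2 : S W (fpr (nu W (fpr (fm phi m)) \c factor ej)) by rewrite factorK.
rewrite -(T_congr _ _ _ _ s2) ?factorK // (T_nat _ _ _ _ _ (Snu W _ _ s1)).
congr (_ \c _); apply: (fcancel (a := fm phi (nu W (fpr (fm phi m))))).
  by rewrite [RHS]fm_pr !factor_pr.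
by rewrite factorK -fm_comp factorK.
Qed.

End GlueAlong.

(** * Extending functors from a full sub-prestack that covers every object *)

Section SubPrestack.
Variables (C : category) (Y : prestack C) (P : forall U, Y U -> Prop).
Hypothesis P_stable : forall U V (x : Y U) (y : Y V), fhom x y -> P y -> P x.

Program Definition sub_prestack : prestack C :=
  @Prestack C (fun U => {y : Y U | P y}) (fun U V x y => fhom (sval x) (sval y))
    (fun _ _ _ _ a => fpr a) (fun _ x => fid (sval x))
    (fun _ _ _ _ _ _ b a => b \c a) _ _ _ _ _ _ _.
Next Obligation. by intros; apply: fpr_id. Qed.
Next Obligation. by intros; apply: fpr_comp. Qed.
Next Obligation. by intros; apply: fcompA. Qed.
Next Obligation. by intros; apply: fcomp1c. Qed.
Next Obligation. by intros; apply: fcompc1. Qed.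
Next Obligation.
move=> U V f [y py]; exists (exist _ _ (P_stable (pullback_map f y) py)).
by exists (pullback_map f y); apply: pullback_map_pr.
Qed.
Next Obligation. by move=> U V W x y z a b h e; apply: (fcart e). Qed.

Definition sub_incl : functor sub_prestack Y.
Proof. by apply: (@Functor C sub_prestack Y (fun U x => sval x) (fun _ _ _ _ a =>
  a)). Defined.

Program Definition sub_sieve U (y : Y U) : sieve U :=
  @Sieve C U (fun V f => exists (x : Y V) (a : fhom x y), fpr a = f /\ P x) _.
Next Obligation.
move=> U y V W f g [x [a [<- px]]].
exists (pullback g x), (a \c pullback_map g x); split.
  by rewrite fpr_comp pullback_map_pr.
exact: P_stable (pullback_map g x) px.
Qed.

Lemma sub_sieveP U V (y : Y U) (f : hom V U) :
  sub_sieve y V f -> P (pullback f y).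
Proof.
move=> [x [a [ea px]]].
have e : fpr a \; idc V = fpr (pullback_map f y).
  by rewrite pullback_map_pr compc1.
exact: P_stable (factor e) px.
Qed.

End SubPrestack.

Section Extension.
Variables (C : site) (Y Z : prestack C) (P : forall U, Y U -> Prop).
Hypothesis P_stable : forall U V (x : Y U) (y : Y V), fhom x y -> P y -> P x.
Hypothesis P_cover : forall U (y : Y U), covering (sub_sieve P_stable y).
Hypothesis stackZ : is_stack Z.
Variable s : functor (sub_prestack P_stable) Z.

Let sepZ : separated Z. Proof. by have [] := (stackP Z).1 stackZ. Qed.
Let homZ : homs_glue Z. Proof. by have [] := (stackP Z).1 stackZ. Qed.
Let obZ : obs_glue Z. Proof. by have [] := (stackP Z).1 stackZ. Qed.

Section Cocone.
Variables (U : C) (y : Y U).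
Let S := sub_sieve P_stable y.

Definition sub_pull V (f : sieve_prestack S V) : sub_prestack P_stable V :=
  exist _ (pullback (sval f) y) (sub_sieveP (svalP f)).

Lemma sub_pull_subproof V W (f : sieve_prestack S V) (g : sieve_prestack S W)
    (h : fhom f g) :
  fpr (pullback_map (sval g) y) \; sval h = fpr (pullback_map (sval f) y).
Proof. by rewrite !pullback_map_pr; exact: svalP h. Qed.

Program Definition sub_diagram : functor (sieve_prestack S) Z :=
  @Functor C (sieve_prestack S) Z (fun V f => fo s (sub_pull f))
    (fun V W f g h => @fm _ _ _ s V W (sub_pull f) (sub_pull g)
       (factor (sub_pull_subproof h))) _ _ _.
Next Obligation. by intros; rewrite fm_pr; apply: factor_pr. Qed.
Next Obligation.
move=> V f; rewrite -fm_id; congr fm; symmetry; refine (@factor_uniq C Y _ _ _ _ _ _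
  _ _ _ _ _ _ _) => /=.
  exact: fpr_id.
by rewrite fcompc1.
Qed.
Next Obligation.
move=> V W V' f g f' b a; rewrite -fm_comp; congr fm; symmetry; refine (@factor_uniq
  C Y _ _ _ _ _ _ _ _ _ _ _ _ _) => /=.
  by rewrite fpr_comp !factor_pr.
by rewrite fcompA !factorK.
Qed.

(** Gluing in [Z] applies to a diagram indexed by arrows of the base, with a chosen restriction for
    each. Here its result is freed from these choices: the cocone is indexed by all arrows into [y]
    from objects satisfying [P]. *)
Lemma sub_cocone : exists (z : Z U)
    (iota : forall V (x : sub_prestack P_stable V), fhom (sval x) y -> fhom (fo s x) z),
  (forall V x a, fpr (iota V x a) = fpr a) /\
  forall V V' (x : sub_prestack P_stable V) (x' : sub_prestack P_stable V')
    (a : fhom (sval x) y) (m : fhom x' x), iota V' x' (a \c m) = iota V x a \c fm s m.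
Proof.
have [z [iota [iota_pr iota_nat]]] := obZ (P_cover y) sub_diagram.
have Sa V (x : sub_prestack P_stable V) (a : fhom (sval x) y) : S V (fpr a).
  by exists (sval x), a; split=> //; exact: svalP x.
pose f V (x : sub_prestack P_stable V) (a : fhom (sval x) y) : sieve_prestack S V :=
  exist _ _ (Sa V x a).
have e V (x : sub_prestack P_stable V) (a : fhom (sval x) y) : fpr (pullback_map
  (sval (f V x a)) y) \; idc V = fpr a.
  by rewrite pullback_map_pr compc1.
exists z, (fun V x a => iota V (f V x a) \c @fm _ _ _ s V V x (sub_pull (f V x a))
  (factor (e V x a))).
split=> [V x a|V V' x x' a m].
  by rewrite fpr_comp iota_pr fm_pr /= factor_pr compc1.
have eh : sval (f V x a) \; fpr m = sval (f V' x' (a \c m)) by rewrite /= fpr_comp.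
pose h : fhom (f V' x' (a \c m)) (f V x a) := exist _ (fpr m) eh.
rewrite -(iota_nat _ _ _ _ h) -!fcompA; congr (_ \c _).
rewrite /= -!fm_comp; congr fm.
apply: (fcancel (a := pullback_map (fpr a) y)).
  by rewrite /= [LHS]fpr_comp [RHS]fpr_comp !factor_pr comp1c compc1.
by rewrite /= !fcompA !factorK.
Qed.

End Cocone.

(** The extension sends [y] to the object glued from [s] over the covering of [y] by objects
    satisfying [P]. Arrows are glued likewise, and functoriality follows because the cocone legs are
    jointly epimorphic. *)
Lemma sub_extension : exists k : functor Y Z,
  inhabited (two_cell (comp_functor k (sub_incl P_stable)) s).
Proof.
pose z U (y : Y U) := sval (cid (sub_cocone y)).
pose iota U (y : Y U) := sval (cid (svalP (cid (sub_cocone y)))).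
have iota_pr U (y : Y U) V (x : sub_prestack P_stable V) (a : fhom (sval x) y) : fpr
  (iota U y V x a) = fpr a.
  by have [h _] := svalP (cid (svalP (cid (sub_cocone y)))); apply: h.
have iota_nat U (y : Y U) V V' (x : sub_prestack P_stable V)
      (x' : sub_prestack P_stable V') (a : fhom (sval x) y) m :
    iota U y V' x' (a \c m) = iota U y V x a \c fm s m.
  by have [_ h] := svalP (cid (svalP (cid (sub_cocone y)))); apply: h.
have uniq U V (y : Y U) (w : Z V) (b b' : fhom (z U y) w) : fpr b = fpr b' ->
    (forall W (x : sub_prestack P_stable W) (a : fhom (sval x) y), b \c iota U y W x
      a = b' \c iota U y W x a) ->
    b = b'.
  move=> e h; apply: (sepZ (P_cover y)) => // W f [x [a [<- px]]].
  exists (fo s (exist _ x px)), (iota U y W (exist _ x px) a).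
  by rewrite iota_pr.
have ex U V (y : Y U) (y' : Y V) (b : fhom y y') : exists k : fhom (z U y) (z V y'),
    fpr k = fpr b /\ forall W (x : sub_prestack P_stable W) (a : fhom (sval x) y), k
      \c iota U y W x a = iota V y' W x (b \c a).
  pose S := sub_sieve P_stable y.
  pose x W (f : hom W U) (Sf : S W f) : sub_prestack P_stable W :=
    sub_pull (exist _ f Sf).
  pose nu W (f : hom W U) (Sf : S W f) : fhom (sval (x W f Sf)) y := pullback_map f y.
  have e W (v : Z W) (d : fhom v (z U y)) (Sd : S W (fpr d)) :
      fpr (iota U y W (x W (fpr d) Sd) (nu W (fpr d) Sd)) \; idc W = fpr d.
    by rewrite iota_pr pullback_map_pr compc1.
  have [] := homZ (P_cover y) (h := fpr b)
    (beta := fun W v d Sd => iota V y' W (x W (fpr d) Sd) (b \c nu W (fpr d) Sd)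
       \c factor (e W v d Sd)).
  - by move=> W v d Sd; rewrite fpr_comp factor_pr iota_pr fpr_comp pullback_map_pr compc1.
  - move=> W W' v v' d Sd m Sdm.
    have ej : fpr (nu W (fpr d) Sd) \; fpr m = fpr (nu W' (fpr (d \c m)) Sdm).
      by rewrite !pullback_map_pr /= fpr_comp.
    pose j : fhom (x W' (fpr (d \c m)) Sdm) (x W (fpr d) Sd) := factor ej.
    have ejj : nu W' (fpr (d \c m)) Sdm = nu W (fpr d) Sd \c j by rewrite factorK.
    rewrite [X in b \c X]ejj fcompA iota_nat -!fcompA; congr (_ \c _).
    apply: (fcancel (a := iota U y W (x W (fpr d) Sd) (nu W (fpr d) Sd))).
      rewrite [LHS]fpr_comp [RHS]fpr_comp fm_pr !factor_pr compc1 comp1c.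
      exact: factor_pr.
    rewrite !fcompA -iota_nat factorK -[RHS](factorK (e W' v' (d \c m) Sdm)).
    by congr (_ \c _); congr iota; rewrite ejj.
  move=> k [kp ke]; exists k; split=> // W v a.
  have Sd : S W (fpr (iota U y W v a)).
    by exists (sval v), a; rewrite iota_pr; split=> //; exact: svalP v.
  rewrite (ke _ _ _ Sd).
  have ej : fpr (nu W _ Sd) \; idc W = fpr a.
    by rewrite pullback_map_pr /= iota_pr compc1.
  pose j : fhom v (x W _ Sd) := factor ej.
  have ea : a = nu W _ Sd \c j by rewrite factorK.
  rewrite [in RHS]ea fcompA iota_nat; congr (_ \c _).
  apply: (fcancel (a := iota U y W (x W _ Sd) (nu W _ Sd))).
    rewrite factor_pr fm_pr; exact/esym/factor_pr.
  by rewrite factorK -iota_nat -ea.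
pose km U V (y : Y U) (y' : Y V) b := sval (cid (ex U V y y' b)).
have km_pr U V (y : Y U) (y' : Y V) b : fpr (km U V y y' b) = fpr b.
  by have [] := svalP (cid (ex U V y y' b)).
have kmE U V (y : Y U) (y' : Y V) b W (x : sub_prestack P_stable W) a : km U V y y' b
  \c iota U y W x a = iota V y' W x (b \c a).
  by have [_] := svalP (cid (ex U V y y' b)); apply.
have km_id U (y : Y U) : km U U y y (fid y) = fid (z U y).
  apply: uniq => [|W x a]; first by rewrite km_pr !fpr_id.
  by rewrite kmE !fcomp1c.
have km_comp U V W (x : Y U) (y : Y V) (v : Y W) b a :
    km U W x v (b \c a) = km V W y v b \c km U V x y a.
  apply: uniq => [|T t d]; first by rewrite km_pr !fpr_comp !km_pr.
  by rewrite -fcompA !kmE fcompA.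
pose k : functor Y Z := Functor km_pr km_id km_comp.
exists k.
(* On an object already satisfying [P], the leg at its identity is vertical, so its inverse compares
   the glued object with the original value. *)
have e U (x : sub_prestack P_stable U) : fpr (iota U (sval x) U x (fid _)) = idc U.
  by rewrite iota_pr fpr_id.
constructor; unshelve eapply (@TwoCell _ _ _
  (comp_functor k (sub_incl P_stable)) s (fun U x => vinv (e U x)) _ _).
- by move=> U x; apply: vinv_pr.
- move=> U V x y a; apply: (fcancel (a := iota V (sval y) V y (fid _))).
    by rewrite !fpr_comp !vinv_pr !fm_pr comp1c compc1.
  rewrite fcompA vinvK fcomp1c fcompA -iota_nat /=.
  apply: (vepi (e U x)); rewrite -fcompA vinvKl fcompc1 kmE.
  by congr iota; rewrite fcomp1c fcompc1.
Qed.

End Extension.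

(** * Dependent products of stacks *)

Section DepStack.
Variables (C : site) (N B : prestack C) (c : functor N B) (Z : prestack C).
Hypothesis stackB : is_stack B.
Hypothesis stackZ : is_stack Z.
Local Notation W := (dep_prestack c Z).

Let sepB : separated B. Proof. by have [] := (stackP B).1 stackB. Qed.
Let sepZ : separated Z. Proof. by have [] := (stackP Z).1 stackZ. Qed.

Definition dep_pr : functor W B.
Proof.
by apply: (@Functor C W B (fun U w => dbase w) (fun U V w w' s => dmap s)).
Defined.

Lemma dep_separated : separated W.
Proof.
move=> U V S cS w w' s t e h.
have em : dmap s = dmap t.
  apply: (sepB cS) => // V' f Sf; have [x [d [dp de]]] := h V' f Sf.
  by exists (dbase x), (dmap d); split=> //; apply: (congr1 (fun r => dmap r) de).
apply: dep_hom_eq => // V1 V2 u v m e1 e2.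
apply: (separated_along (S := pullback_sieve (fpr (carr u)) S)
  (covering_pullback _ cS) (phi := dfun w)) => //; first by rewrite !dcell_pr.
move=> V' u' nu Snu.
(* The arrow [d] along which [s] and [t] agree has a base through which [carr u'] factors. This
   moves [u'] to an object [u0] over [dbase x], where the cell of [d] is vertical and can be
   cancelled; what remains is a cell of the two equal composites. *)
have [x [d [dp de]]] := h _ _ Snu.
have ek : fpr (dmap d) \; idc V' = fpr (carr u').
  by rewrite -(cmapE nu) fpr_comp fm_pr compc1; exact: dp.
pose u0 : comma c (dbase x) V' := CommaOb (factor ek).
have e0 : carr u' \c fm c (fid (cob u')) = dmap d \c carr u0.
  by rewrite fm_id fcompc1 factorK.
apply: (vepi (a := dcell d (u := u0) (v := u') (fid (cob u')) e0)).
  by rewrite dcell_pr fpr_id.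
have es : carr v \c fm c (m \c cmap nu) = dmap s \c carr u'.
  by rewrite fm_comp fcompA e1 -fcompA cmapE.
have et : carr v \c fm c (m \c cmap nu) = dmap t \c carr u' by rewrite -em.
rewrite (dcellr e1 es) (dcellr e2 et).
have esd : carr v \c fm c (m \c cmap nu) = dmap (dep_comp s d) \c carr u0.
  by rewrite es /= -fcompA factorK.
have etd : carr v \c fm c (m \c cmap nu) = dmap (dep_comp t d) \c carr u0.
  by rewrite et /= -fcompA factorK.
rewrite -(dcell_comp (u := u0) e0 es esd) ?fcompc1 // -(dcell_comp (u := u0) e0 et
  etd) ?fcompc1 //.
exact: dcell_eq.
Qed.

Lemma dcell_restr U V V1 V2 (w : dep_ob c Z U) (x : B V) (d : fhom x (dbase w))
    (u : comma c x V1) (v : comma c (dbase w) V2) (m : fhom (cob u) (cob v))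
    (e : carr v \c fm c m = dmap (dep_restr d) \c carr u) :
  dcell (dep_restr d) m e
    = @fm _ _ _ (dfun w) V1 V2 (post_ob d u) v
        (@CommaHom _ _ _ _ _ _ _ _ (post_ob d u) v m e).
Proof. by []. Qed.

Section RestrFactor.
Variables (U V V' : C) (w : dep_ob c Z U) (x : B V) (x' : B V').
Variables (d : fhom x (dbase w)) (d' : fhom x' (dbase w)) (k : fhom x' x).
Hypothesis ek : d \c k = d'.

Definition restr_factor : dep_hom (dep_restr_ob d') (dep_restr_ob d) :=
  @dep_factor _ _ _ _ _ _ _ _ _ _ _ (dep_restr d) (dep_restr d') k ek.

Lemma restr_factorK : dep_comp (dep_restr d) restr_factor = dep_restr d'.
Proof. exact: dep_factorK. Qed.

Lemma dcell_restr_factor V1 V2 (u : comma c x' V1) (v : comma c x V2)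
    (m : fhom (cob u) (cob v)) (e : carr v \c fm c m = dmap restr_factor \c carr u)
    (e' : carr (post_ob d v) \c fm c m = carr (post_ob d' u)) :
  dcell restr_factor m e
    = @fm _ _ _ (dfun w) V1 V2 (post_ob d' u) (post_ob d v)
        (@CommaHom _ _ _ _ _ _ _ _ (post_ob d' u) (post_ob d v) m e').
Proof.
apply: (fcancel (a := dcell (dep_restr d) (v := post_ob d v) _ (dep_comp_subproof1 d v))).
  by rewrite dcell_pr; symmetry; exact: (fm_pr (dfun w)).
rewrite [LHS]factorK !dcell_restr; symmetry.
apply: etrans (esym (fm_comp (dfun w) _ _)) _.
by congr fm; apply: comma_hom_eq; rewrite /= fcomp1c.
Qed.

End RestrFactor.

(** The base arrow is glued in [B] and each cell in [Z], over the sieve of refinements of [u] whose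
    structure arrow falls in [S]. *)
Lemma dep_homs_glue : homs_glue W.
Proof.
move=> U V S cS w w' h beta beta_pr beta_nat.
have [_ homB _] := (stackP B).1 stackB; have [_ homZ _] := (stackP Z).1 stackZ.
have beta_congr X (x : W X) (d d' : fhom x w) (s : S X (fpr d))
    (s' : S X (fpr d')) : d = d' -> beta X x d s = beta X x d' s'.
  by move=> e; subst; congr beta; apply: Prop_irrelevance.
(* Only canonical restrictions of [w] are kept, since these are indexed by arrows of [B] alone;
   [b_factor] expresses the compatibility of the family through the comparison arrows
   [restr_factor]. *)
pose b X (x : B X) (d : fhom x (dbase w)) (s : S X (fpr d)) :
  dep_hom (dep_restr_ob d) w' := beta X (dep_restr_ob d) (dep_restr d) s.
have b_factor X X' (x : B X) (x' : B X') (d : fhom x (dbase w)) s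
    (d' : fhom x' (dbase w)) s' (k : fhom x' x) (ek : d \c k = d') :
    b X' x' d' s' = dep_comp (b X x d s) (restr_factor ek).
  have s2 : S X' (fpr (dep_comp (dep_restr d) (restr_factor ek) : @fhom _ W _ _ _ _)).
    by rewrite /= ek.
  rewrite -[RHS](beta_nat _ _ _ _ _ _ (restr_factor ek) s2).
  by apply: beta_congr; exact/esym/restr_factorK.
have [s0 [s0p s0E]] : exists s0 : fhom (dbase w) (dbase w'), fpr s0 = h /\
    forall X (x : B X) (d : fhom x (dbase w)) s, s0 \c d = dmap (b X x d s).
  apply: (homB U V S cS (dbase w) (dbase w') h (fun X x d s => dmap (b X x d s))).
    by move=> X x d s; exact: (beta_pr X (dep_restr_ob d) (dep_restr d) s).
  by move=> X X' x x' d s m s'; rewrite (b_factor _ _ _ _ _ s _ s' m erefl).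
(* The tautological object over the image of [n]. Any [u] is isomorphic, through [j], to the
   tautological object of [cob u] pushed along [carr u]; when [carr u] lies over [S], this reads off
   the required cell [T] from the local arrow at [carr u]. *)
pose one X (n : N X) : comma c (fo c n) X := CommaOb (fid (fo c n)).
have e_one X (u : comma c (dbase w) X) :
    carr (post_ob (carr u) (one X (cob u))) \c fm c (fid (cob u)) = carr u.
  by rewrite /= fm_id !fcompc1.
pose j X (u : comma c (dbase w) X) : fhom u (post_ob (carr u) (one X (cob u))) :=
  @CommaHom _ _ _ _ _ _ _ _ u (post_ob (carr u) (one X (cob u))) _ (e_one X u).
pose T X (u : comma c (dbase w) X) s X' (v : comma c (dbase w') X')
    (m : fhom (cob u) (cob v))
    (e : carr v \c fm c m = dmap (b X _ (carr u) s) \c carr (one X (cob u))) :=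
  dcell (b X _ (carr u) s) (u := one X (cob u)) m e \c fm (dfun w) (j X u).
have eT X (u : comma c (dbase w) X) s X' (v : comma c (dbase w') X')
    (m : fhom (cob u) (cob v)) : carr v \c fm c m = s0 \c carr u ->
    carr v \c fm c m = dmap (b X _ (carr u) s) \c carr (one X (cob u)).
  by move=> ->; rewrite fcompc1 s0E.
have T_pr X (u : comma c (dbase w) X) s X' (v : comma c (dbase w') X')
    (m : fhom (cob u) (cob v)) e : fpr (T X u s X' v m e) = fpr m.
  by rewrite fpr_comp dcell_pr fm_pr /= fpr_id compc1.
have T_congr X (u : comma c (dbase w) X) s s' X' (v : comma c (dbase w') X')
    (m m' : fhom (cob u) (cob v)) e e' :
    m = m' -> T X u s X' v m e = T X u s' X' v m' e'.
  move=> em; subst m'; have es : s = s' by apply: Prop_irrelevance.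
  by subst s'; congr (_ \c _); apply: dcell_congr.
have T_nat X Y (u : comma c (dbase w) X) s (u1 : comma c (dbase w) Y) s1
    (a : fhom u1 u) X' (v : comma c (dbase w') X') (m : fhom (cob u) (cob v)) e e1 :
    T Y u1 s1 X' v (m \c cmap a) e1 = T X u s X' v m e \c fm (dfun w) a.
  have ek := cmapE a; rewrite /T.
  have e2 : carr v \c fm c (m \c cmap a)
      = dmap (dep_comp (b X _ (carr u) s) (restr_factor ek)) \c carr (one Y (cob u1)).
    by rewrite -(b_factor _ _ _ _ _ s _ s1).
  rewrite (dcell_eq (w := dep_restr_ob (carr u1)) (u := one Y (cob u1)) e1 e2
    (b_factor _ _ _ _ _ _ _ _ _ ek)).
  have e3 : carr (one X (cob u)) \c fm c (cmap a)
      = dmap (restr_factor ek) \c carr (one Y (cob u1)).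
    by rewrite /= fcomp1c fcompc1.
  rewrite (dcell_comp (w := dep_restr_ob (carr u1)) (w' := dep_restr_ob (carr u)) (u
    := one Y (cob u1)) (u' := one X (cob u)) e3 e) // -!fcompA; congr (_ \c _).
  rewrite (dcell_restr_factor (u := one Y (cob u1)) (v := one X (cob u)) e3) => [|e4].
    by rewrite /= !fcompc1.
  by rewrite -!fm_comp; congr fm; apply: comma_hom_eq; rewrite /= fcompc1 fcomp1c.
pose Q X (u : comma c (dbase w) X) := pullback_sieve (fpr (carr u)) S.
have SQ X (u : comma c (dbase w) X) X1 (u1 : comma c (dbase w) X1) (nu : fhom u1 u) :
    Q X u X1 (fpr nu) -> S X1 (fpr (carr u1)).
  by rewrite -(cmapE nu) fpr_comp fm_pr.
have eQ X (u : comma c (dbase w) X) X1 (u1 : comma c (dbase w) X1) (nu : fhom u1 u)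
    X' (v : comma c (dbase w') X') (m : fhom (cob u) (cob v)) :
    carr v \c fm c m = s0 \c carr u ->
    carr v \c fm c (m \c cmap nu) = s0 \c carr u1.
  by move=> e; rewrite fm_comp fcompA e -fcompA cmapE.
have ex X (u : comma c (dbase w) X) X' (v : comma c (dbase w') X')
    (m : fhom (cob u) (cob v)) (e : carr v \c fm c m = s0 \c carr u) :
    exists t : fhom (fo (dfun w) u) (fo (dfun w') v), fpr t = fpr m /\
      forall X1 (u1 : comma c (dbase w) X1) (nu : fhom u1 u) s,
        t \c fm (dfun w) nu
          = T X1 u1 (SQ _ _ _ _ nu s) X' v (m \c cmap nu) (eT _ _ _ _ _ _ (eQ _ _ _ _
            nu _ _ _ e)).
  apply: (homs_glue_along (S := Q X u) _ (h := fpr m)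
    (T := fun X1 u1 nu s => T X1 u1 (SQ _ _ _ _ nu s) X' v (m \c cmap nu) (eT _ _ _ _
      _ _ (eQ _ _ _ _ nu _ _ _ e)))) => //.
  - exact: covering_pullback.
  - by move=> X1 u1 nu s; rewrite T_pr fpr_comp.
  - move=> X1 X2 u1 u2 nu s mu s'; rewrite -T_nat.
    + exact: SQ s'.
    + by move=> s2; apply: (eT X2 u2); apply: (eQ X1 u1); apply: (eQ X u).
    by move=> s2 e'; apply: T_congr; rewrite /= fcompA.
pose t X (u : comma c (dbase w) X) X' (v : comma c (dbase w') X')
    (m : fhom (cob u) (cob v)) (e : carr v \c fm c m = s0 \c carr u) :=
  sval (cid (ex X u X' v m e)).
have t_pr X (u : comma c (dbase w) X) X' (v : comma c (dbase w') X') m e :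
    fpr (t X u X' v m e) = fpr m.
  by have [] := svalP (cid (ex X u X' v m e)).
have tE X (u : comma c (dbase w) X) X' (v : comma c (dbase w') X') m e
    X1 (u1 : comma c (dbase w) X1) (nu : fhom u1 u) s e1 :
    Q X u X1 (fpr nu) ->
    t X u X' v m e \c fm (dfun w) nu = T X1 u1 s X' v (m \c cmap nu) e1.
  move=> q; have [_ te] := svalP (cid (ex X u X' v m e)).
  by rewrite (te _ _ _ q); apply: T_congr.
have t_nat X X' X1 X2 (u : comma c (dbase w) X) (v : comma c (dbase w') X')
    (u1 : comma c (dbase w) X1) (v1 : comma c (dbase w') X2)
    (m : fhom (cob u) (cob v)) (e : carr v \c fm c m = s0 \c carr u)
    (m1 : fhom (cob u1) (cob v1)) (e1 : carr v1 \c fm c m1 = s0 \c carr u1)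
    (a : fhom u u1) (g : fhom v v1) : cmap g \c m = m1 \c cmap a ->
    fm (dfun w') g \c t X u X' v m e = t X1 u1 X2 v1 m1 e1 \c fm (dfun w) a.
  move=> em; apply: (separated_along (S := Q X u) _ (phi := dfun w)) => //.
  - exact: covering_pullback.
  - rewrite !fpr_comp !t_pr !fm_pr.
    by move: (congr1 (@fpr _ _ _ _ _ _) em); rewrite !fpr_comp.
  move=> X0 u0 nu q.
  have s : S X0 (fpr (carr u0)) := SQ _ _ _ _ _ q.
  have q' : Q X1 u1 X0 (fpr (a \c nu)).
    by move: q; rewrite /Q /= -(cmapE a) !fpr_comp fm_pr compA.
  have e2 := eT _ _ s _ _ _ (eQ _ _ _ _ nu _ _ _ e).
  have e3 := eT _ _ s _ _ _ (eQ _ _ _ _ (a \c nu) _ _ _ e1).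
  rewrite -!fcompA -fm_comp (tE _ _ _ _ _ _ _ _ _ s e2 q) (tE _ _ _ _ _ _ _ _ _ s e3 q').
  rewrite /T fcompA; congr (_ \c _).
  have e4 : carr v1 \c fm c (cmap g \c m \c cmap nu)
      = dmap (b X0 _ (carr u0) s) \c carr (one X0 (cob u0)).
    by rewrite fcompA em -fcompA.
  by rewrite (dcelll (w := dep_restr_ob (carr u0)) (u := one X0 (cob u0)) _ e4);
    apply: dcell_congr; rewrite /= fcompA em -fcompA.
pose a : dep_hom w w' := @DepHom _ _ _ c Z U V w w' s0
  (fun X X' u v m e => t X u X' v m e) (fun X X' u v m e => t_pr _ _ _ _ m e) t_nat.
have aE X (x : B X) (d : fhom x (dbase w)) s : dep_comp a (dep_restr d) = b X x d s.
  apply: dep_hom_eq => [|X1 X2 u v m e e']; first exact: s0E.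
  have e1 : carr (post_ob d u) \c fm c (fid (cob u)) = dmap (dep_restr d) \c carr u.
    exact: dep_comp_subproof1.
  have e2 : carr v \c fm c m = dmap a \c carr (post_ob d u) by rewrite e /= fcompA.
  rewrite (dcell_comp (u' := post_ob d u) e1 e2) ?fcompc1 // dcell_restr.
  pose p : comma c (dbase w) X1 := post_ob d u.
  pose nu : fhom p p := @CommaHom _ _ _ _ _ _ _ _ (post_ob d u) (post_ob d u) _ e1.
  have q : Q X1 p X1 (fpr nu).
    by rewrite /Q /= fpr_id compc1 fpr_comp; apply: sieveP.
  have s1 : S X1 (fpr (carr p)) by rewrite /= fpr_comp; apply: sieveP.
  have e3 : carr v \c fm c (m \c cmap nu)
      = dmap (b X1 _ (carr p) s1) \c carr (one X1 (cob p)).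
    by apply: (eT X1 p); rewrite fcompc1.
  rewrite (tE X1 p _ v m e2 _ p nu s1 e3 q) /T.
  have e4 : carr v \c fm c (m \c fid _)
      = dmap (dep_comp (b X x d s) (restr_factor (erefl (d \c carr u)))) \c carr (one
        X1 (cob u)).
    by rewrite -(b_factor _ _ _ _ _ s _ s1).
  rewrite (dcell_eq (w := dep_restr_ob (d \c carr u)) (u := one X1 (cob u)) e3 e4
    (b_factor _ _ _ _ _ _ _ _ _ _)).
  have e5 : carr u \c fm c (fid (cob u))
      = dmap (restr_factor (erefl (d \c carr u))) \c carr (one X1 (cob u)).
    by rewrite /= fm_id.
  rewrite (dcell_comp (w := dep_restr_ob (d \c carr u)) (w' := dep_restr_ob d) (u :=
    one X1 (cob u)) (u' := u) e5 e') // (dcell_restr_factor (u := one X1 (cob u)) (v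
      := u) e5) => [|e6].
    by rewrite /= fm_id !fcompc1.
  rewrite -[LHS]fcompA -fm_comp -[RHS]fcompc1; congr (_ \c _).
  apply: etrans (fm_id (dfun w) p); congr fm.
  by apply: comma_hom_eq; rewrite /= fcompc1.
exists a; split=> // X x d s.
(* An arbitrary [d] factors through the canonical restriction along its base arrow, which carries
   the identity from canonical restrictions to all arrows over [S]. *)
have ed : dmap d \c fid (dbase x) = dmap d by rewrite fcompc1.
have edd := dep_factorK (s := dep_restr (dmap d)) ed.
have s2 : S X (fpr (dep_comp (dep_restr (dmap d)) (dep_factor (s := dep_restr (dmap
  d)) ed) : @fhom _ W _ _ _ _)).
  by rewrite /= ed.
rewrite (beta_congr _ _ _ _ _ s2 (esym edd)).
rewrite (beta_nat X X (dep_restr_ob (dmap d)) x (dep_restr (dmap d)) s _ s2).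
rewrite -[beta _ _ _ _]aE -[in LHS]edd.
exact: (@fcompA _ W).
Qed.

End DepStack.

Section DepObs.
Variables (C : site) (N B : prestack C) (c : functor N B) (Z : prestack C).
Hypothesis stackB : is_stack B.
Hypothesis stackZ : is_stack Z.
Local Notation W := (dep_prestack c Z).

Section Glue.
Variables (U : C) (S : sieve U).
Hypothesis coverS : covering S.
Variable D : functor (sieve_prestack S) W.
Variables (x : B U)
  (j : forall V (f : sieve_prestack S V), fhom (dbase (fo D f)) x).
Hypothesis j_pr : forall V (f : sieve_prestack S V), fpr (j f) = sval f.
Hypothesis j_nat : forall V V' (f : sieve_prestack S V) (g : sieve_prestack S V')
  (h : fhom f g), j g \c dmap (fm D h) = j f.

Let P V (u : comma c x V) : Prop := S V (fpr (carr u)).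

Lemma glue_stable V V' (u : comma c x V) (v : comma c x V') :
  fhom u v -> P v -> P u.
Proof. by move=> a; rewrite /P -(cmapE a) fpr_comp; apply: sieveP. Qed.

(** Refining [u] along the sieve [S] pulled back by the projection of [carr u] puts its structure
    arrow over [S], so the covering is inherited. *)
Lemma glue_cover V (u : comma c x V) : covering (sub_sieve glue_stable u).
Proof.
apply: (covering_local (covering_pullback (fpr (carr u)) coverS)) => V' f Sf.
apply: covering_all => V1 g.
exists (pullback (f \; g) u), (pullback_map (f \; g) u).
rewrite pullback_map_pr; split=> //.
rewrite /P -(cmapE (pullback_map (f \; g) u)) fpr_comp fm_pr.
rewrite -[fpr (cmap _)]/(fpr (pullback_map (f \; g) u)) pullback_map_pr compA.
exact: sieveP.
Qed.

Let Y := sub_prestack glue_stable.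

Definition glue_index V (u : Y V) : sieve_prestack S V :=
  exist _ (fpr (carr (sval u))) (svalP u).

Lemma glue_factor_subproof V (u : Y V) :
  fpr (j (glue_index u)) \; idc V = fpr (carr (sval u)).
Proof. by rewrite j_pr compc1. Qed.

Definition glue_factor V (u : Y V) : comma c (dbase (fo D (glue_index u))) V :=
  CommaOb (factor (glue_factor_subproof u)).

Lemma glue_map_subproof V V' (u : Y V) (v : Y V') (a : fhom u v) :
  sval (glue_index v) \; fpr (cmap a) = sval (glue_index u).
Proof. by rewrite /= -(cmapE a) fpr_comp fm_pr. Qed.

Definition glue_map V V' (u : Y V) (v : Y V') (a : fhom u v) :
  fhom (glue_index u) (glue_index v) := exist _ _ (glue_map_subproof a).

Lemma glue_cell_subproof V V' (u : Y V) (v : Y V') (a : fhom u v) :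
  carr (glue_factor v) \c fm c (cmap a)
    = dmap (fm D (glue_map a)) \c carr (glue_factor u).
Proof.
apply: (fcancel (a := j (glue_index v))).
  rewrite !fpr_comp !factor_pr fm_pr comp1c compc1.
  exact: esym (fm_pr D (glue_map a)).
by rewrite !fcompA factorK j_nat factorK cmapE.
Qed.

(** An object whose structure arrow lies over [S] names its own index in the diagram, namely the
    projection of that arrow. Factoring it through the leg [j] at this index gives a point of the
    local fibre, where the local functor is evaluated. *)
Program Definition glue_functor : functor Y Z :=
  @Functor C Y Z (fun V u => fo (dfun (fo D (glue_index u))) (glue_factor u))
    (fun V V' u v a => dcell (fm D (glue_map a)) (u := glue_factor u) (v := glue_factor v)
       (cmap a) (glue_cell_subproof a))
    _ _ _.
Next Obligation. by intros; apply: dcell_pr. Qed.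
Next Obligation.
move=> V u.
have e : fm D (glue_map (fid u)) = dep_id (fo D (glue_index u)).
  by rewrite -[RHS](fm_id D); congr fm; apply: sieve_hom_eq; apply: fpr_id.
have e1 : carr (glue_factor u) \c fm c (cmap (fid (glue_factor u)))
    = dmap (dep_id (fo D (glue_index u))) \c carr (glue_factor u).
  by rewrite fm_id fcompc1 fcomp1c.
rewrite (dcell_eq (u := glue_factor u) (v := glue_factor u) _ e1 e).
by rewrite (dcell_id (m := fid (glue_factor u))) fm_id.
Qed.
Next Obligation.
move=> V V1 V2 u v w b a.
have e : fm D (glue_map (b \c a)) = dep_comp (fm D (glue_map b)) (fm D (glue_map a)).
  by rewrite -[RHS](fm_comp D); congr fm; apply: sieve_hom_eq; apply: fpr_comp.
have e1 : carr (glue_factor w) \c fm c (cmap (b \c a))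
    = dmap (dep_comp (fm D (glue_map b)) (fm D (glue_map a))) \c carr (glue_factor u).
  by rewrite -e; apply: glue_cell_subproof.
rewrite (dcell_eq (u := glue_factor u) (v := glue_factor w) _ e1 e).
exact: (dcell_comp (u' := glue_factor v)).
Qed.

Variable phi : functor (comma c x) Z.
Variable kappa : two_cell (comp_functor phi (sub_incl glue_stable)) glue_functor.

Let w : W U := DepOb phi.

Section Leg.
Variables (V : C) (f : sieve_prestack S V).

Lemma leg_subproof V1 (u : comma c (dbase (fo D f)) V1) : P (post_ob (j f) u).
Proof. by rewrite /P /= fpr_comp j_pr; apply/sieveP/(svalP f). Qed.

Definition leg_ob V1 (u : comma c (dbase (fo D f)) V1) : Y V1 :=
  exist _ (post_ob (j f) u) (leg_subproof u).

Lemma leg_index_subproof V1 (u : comma c (dbase (fo D f)) V1) :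
  sval f \; fpr (carr u) = sval (glue_index (leg_ob u)).
Proof. by rewrite /= fpr_comp j_pr. Qed.

Definition leg_index V1 (u : comma c (dbase (fo D f)) V1) :
  fhom (glue_index (leg_ob u)) f := exist _ _ (leg_index_subproof u).

Lemma leg_cell_subproof V1 (u : comma c (dbase (fo D f)) V1) :
  carr u \c fm c (fid (cob u))
    = dmap (fm D (leg_index u)) \c carr (glue_factor (leg_ob u)).
Proof.
apply: (fcancel (a := j f)).
  rewrite !fpr_comp factor_pr fm_pr compc1 fpr_id compc1.
  exact: esym (fm_pr D (leg_index u)).
by rewrite fm_id fcompc1 fcompA j_nat factorK.
Qed.

Definition leg_cell V1 (u : comma c (dbase (fo D f)) V1) :=
  dcell (fm D (leg_index u)) (u := glue_factor (leg_ob u)) (v := u)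
    (fid (cob u)) (leg_cell_subproof u).

Lemma leg_cell_pr V1 (u : comma c (dbase (fo D f)) V1) : fpr (leg_cell u) = idc V1.
Proof. by rewrite dcell_pr fpr_id. Qed.

(** The pushed object [leg_ob u] has as index the arrow [f] composed with the projection of
    [carr u], not [f]. The diagram supplies the cell [leg_cell] between the two evaluations, and
    [kappa] passes to the extended functor. *)
Definition leg V1 (u : comma c (dbase (fo D f)) V1) :
    fhom (fo (dfun (fo D f)) u) (fo phi (post_ob (j f) u)) :=
  vinv (tc_pr kappa (leg_ob u)) \c vinv (leg_cell_pr u).

Lemma leg_pr V1 (u : comma c (dbase (fo D f)) V1) : fpr (leg u) = idc V1.
Proof. by rewrite fpr_comp !vinv_pr compc1. Qed.

End Leg.

Lemma leg_nat V V' (f : sieve_prestack S V) (f' : sieve_prestack S V')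
    (h : fhom f f') V1 V2 (u : comma c (dbase (fo D f)) V1)
    (v : comma c (dbase (fo D f')) V2) (m : fhom (cob u) (cob v))
    (e : carr v \c fm c m = dmap (fm D h) \c carr u)
    (e' : carr (post_ob (j f') v) \c fm c m = carr (post_ob (j f) u)) :
  fm phi (@CommaHom _ _ _ _ _ _ _ _ (post_ob (j f) u) (post_ob (j f') v) m e') \c leg u
    = leg v \c dcell (fm D h) m e.
Proof.
set a := @CommaHom _ _ _ _ _ _ _ _ (post_ob (j f) u) (post_ob (j f') v) m e'.
pose a' : fhom (leg_ob u) (leg_ob v) := a.
apply: (fcancel (a := tc kappa (leg_ob v))).
  by rewrite [LHS]fpr_comp [RHS]fpr_comp fm_pr !leg_pr dcell_pr comp1c compc1.
have nat := tc_nat kappa a'.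
rewrite [LHS]fcompA -[fm phi a]/(fm (comp_functor phi (sub_incl glue_stable)) a') nat.
rewrite /leg -!fcompA [tc kappa (leg_ob u) \c _]fcompA vinvK fcomp1c.
rewrite [tc kappa (leg_ob v) \c _]fcompA vinvK fcomp1c.
apply: (fcancel (a := leg_cell v)).
  by rewrite !fpr_comp !vinv_pr fm_pr dcell_pr comp1c compc1.
rewrite [RHS]fcompA vinvK fcomp1c.
apply: (vepi (leg_cell_pr u)); rewrite -!fcompA vinvKl fcompc1.
(* Once [kappa] and the leg cells are cancelled, naturality is functoriality of [D] on a square of
   sieve arrows, which commutes since both sides have the same projection. *)
have em : fm D (leg_index v) \c fm D (glue_map a') = fm D h \c fm D (leg_index u).
  rewrite -!fm_comp; congr fm; apply: sieve_hom_eq => /=.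
  have hp : fpr (dmap (fm D h)) = sval h := fm_pr D h.
  by move: (congr1 (@fpr _ _ _ _ _ _) e); rewrite !fpr_comp fm_pr hp.
have e1 : carr v \c fm c m = dmap (dep_comp (fm D (leg_index v)) (fm D (glue_map a')))
     \c carr (glue_factor (leg_ob u)).
  rewrite -[dmap _]/(dmap (fm D (leg_index v)) \c dmap (fm D (glue_map a'))).
  rewrite -[RHS]fcompA -(glue_cell_subproof a') fcompA.
  by rewrite -(leg_cell_subproof v) fm_id fcompc1.
have e2 : carr v \c fm c m = dmap (dep_comp (fm D h) (fm D (leg_index u)))
     \c carr (glue_factor (leg_ob u)).
  by rewrite -[dep_comp _ _]em.
pose gu := glue_factor (leg_ob u); pose gv := glue_factor (leg_ob v).
transitivity (dcell (dep_comp (fm D (leg_index v)) (fm D (glue_map a')))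
    (u := gu) (v := v) m e1).
  by symmetry; apply: (dcell_comp (u := gu) (u' := gv)); rewrite /= fcomp1c.
rewrite (dcell_eq (u := gu) e1 e2 em).
by apply: (dcell_comp (u := gu) (u' := u)); rewrite fcompc1.
Qed.

Program Definition glue_leg V (f : sieve_prestack S V) : dep_hom (fo D f) w :=
  @DepHom _ _ _ c Z _ _ (fo D f) w (j f)
    (fun V1 V2 u v m e =>
       @fm _ _ _ phi V1 V2 (post_ob (j f) u) v
         (@CommaHom _ _ _ _ _ _ _ _ (post_ob (j f) u) v m e) \c leg u) _ _.
Next Obligation.
by move=> V f V1 V2 u v m e; rewrite fpr_comp leg_pr compc1; exact: (fm_pr phi).
Qed.
Next Obligation.
move=> V f V1 V2 V3 V4 u v u1 v1 m e m1 e1 a b h /=.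
have e2 : carr u1 \c fm c (cmap a) = dmap (fm D (fid f)) \c carr u.
  by rewrite fm_id /= fcomp1c cmapE.
have e2' : carr (post_ob (j f) u1) \c fm c (cmap a) = carr (post_ob (j f) u).
  by rewrite /= -fcompA cmapE.
have -> : fm (dfun (fo D f)) a = dcell (fm D (fid f)) (cmap a) e2.
  have e3 : carr u1 \c fm c (cmap a) = dmap (dep_id (fo D f)) \c carr u.
    by rewrite /= fcomp1c cmapE.
  by rewrite (dcell_eq e2 e3) ?dcell_id //; exact: (fm_id D).
rewrite -[RHS]fcompA -(leg_nat _ e2') [LHS]fcompA [RHS]fcompA -!fm_comp.
by congr (fm _ _ \c leg u); apply: comma_hom_eq.
Qed.

Lemma glue_legE V V' (f : sieve_prestack S V) (g : sieve_prestack S V')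
  (h : fhom f g) : dep_comp (glue_leg g) (fm D h) = glue_leg f.
Proof.
apply: dep_hom_eq => [|V1 V2 u v m e e']; first exact: j_nat.
pose v' := post_ob (dmap (fm D h)) u.
have e1 : carr v' \c fm c (fid (cob u)) = dmap (fm D h) \c carr u.
  exact: dep_comp_subproof1.
have e2 : carr v \c fm c m = dmap (glue_leg g) \c carr v'.
  by rewrite e /= fcompA.
rewrite (dcell_comp (u' := v') e1 e2) ?fcompc1 //=.
have e3 : carr (post_ob (j g) v') \c fm c (fid (cob u)) = carr (post_ob (j f) u).
  by rewrite /= fm_id fcompc1 fcompA j_nat.
rewrite -[LHS]fcompA -(leg_nat e1 e3) fcompA -fm_comp; congr (fm _ _ \c _).
by apply: comma_hom_eq; rewrite /= fcompc1.
Qed.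

End Glue.

Lemma dep_obs_glue : obs_glue W.
Proof.
move=> U S cS D.
have [_ _ obB] := (stackP B).1 stackB.
have [x [j [j_pr j_nat]]] := obB U S cS (comp_functor (dep_pr c Z) D).
have [phi [kappa]] := sub_extension (glue_cover (x := x) cS) stackZ (glue_functor
  j_pr j_nat).
exists (DepOb phi), (fun V f => glue_leg kappa f); split.
  exact: j_pr.
by move=> V V' f g h; apply: glue_legE.
Qed.

Lemma dep_stack : is_stack W.
Proof.
apply/stackP; split.
- exact: dep_separated.
- exact: dep_homs_glue.
- exact: dep_obs_glue.
Qed.

End DepObs.

(** * Torsors over the classifying stack *)

(** Objects of [pt] are bare [tt], which determine neither the site nor the base object; the
    annotated form guides unification. *)
Definition pt_ob (C : category) (U : C) : pt C U := tt.

Definition pt_map (C : category) (Y : prestack C) (b : functor (pt C) Y) U V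
    (h : hom U V) : fhom (fo b (pt_ob U)) (fo b (pt_ob V)) :=
  @fm C (pt C) Y b U V (pt_ob U) (pt_ob V) h.

Lemma pt_map_pr (C : category) (Y : prestack C) (b : functor (pt C) Y) U V
  (h : hom U V) : fpr (pt_map b h) = h.
Proof. exact: (@fm_pr _ _ _ b U V (pt_ob U) (pt_ob V) h). Qed.

Lemma pt_map_id (C : category) (Y : prestack C) (b : functor (pt C) Y) U :
  pt_map b (idc U) = fid _.
Proof. exact: (@fm_id _ _ _ b U (pt_ob U)). Qed.

Lemma pt_map_comp (C : category) (Y : prestack C) (b : functor (pt C) Y) U V W
  (g : hom V W) (h : hom U V) : pt_map b (g \; h) = pt_map b g \c pt_map b h.
Proof. exact: (@fm_comp _ _ _ b U V W (pt_ob U) (pt_ob V) (pt_ob W) g h). Qed.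

(* The cartesianness of the square defining a torsor, spelled out: [M] is the
   prestack of objects of [N] with a trivialisation of their image in [BG]. *)
Record torsor_chart (C : category) (G : group_presheaf C) (M N : prestack C)
    (A : action G M) (p : functor M N) (P : equivariant A (triv G N) p)
    (BG : prestack C) (b : functor (pt C) BG)
    (K : equivariant (triv G (pt C)) (triv G BG) b) (c : functor N BG)
    (theta : forall U (m : M U), fhom (fo c (fo p m)) (fo b (pt_ob U))) : Prop := {
  chart_pr : forall U (m : M U), fpr (theta U m) = idc U;
  chart_nat : forall U V (m : M U) (m' : M V) (a : fhom m m'),
    theta V m' \c fm c (fm p a) = pt_map b (fpr a) \c theta U m;
  chart_eqv : forall U (g : G U) (m : M U),
    theta U m \c fm c (eqv P g m) = eqv K g (pt_ob U) \c theta U (aob A g m);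
  chart_lift : forall U V (n : N V) (a : fhom (fo c n) (fo b (pt_ob U))),
    exists (m : M V) (e : fhom (fo p m) n),
      fpr e = idc V /\ a \c fm c e = pt_map b (fpr a) \c theta V m;
  chart_full : forall U V (m : M U) (m' : M V) (d : fhom (fo p m) (fo p m')),
    theta V m' \c fm c d = pt_map b (fpr d) \c theta U m ->
    exists t : fhom m m', fm p t = d;
  chart_faithful : forall U V (m : M U) (m' : M V) (t t' : fhom m m'),
    fm p t = fm p t' -> t = t'
}.

(** An equivalence is essentially surjective, full and faithful; the clauses are these properties of
    M -> N x_BG pt, rewritten with objects and arrows of [N]. *)
Lemma is_torsor_chart (C : site) (G : group_presheaf C) (M N : prestack C)
    (A : action G M) (p : functor M N) (P : equivariant A (triv G N) p) :
  is_torsor P -> exists (BG : prestack C) (b : functor (pt C) BG)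
    (K : equivariant (triv G (pt C)) (triv G BG) b) (c : functor N BG)
    (theta : forall U (m : M U), fhom (fo c (fo p m)) (fo b (pt_ob U))),
  is_quotient K /\ torsor_chart P K theta.
Proof.
case=> BG [b [K [quotK [c [theta [theta_eqv [g [[alpha] [beta]]]]]]]]].
set F := to_fibre_product theta in g alpha beta.
exists BG, b, K, c, (fun U m => tc theta m); split=> //.
have F_faithful U V (x : M U) (y : M V) (t t' : fhom x y) : fm F t = fm F t' -> t = t'.
  move=> e; apply: (vepi (tc_pr alpha x)).
  rewrite -[t]/(fm (id_functor M) t) -[t']/(fm (id_functor M) t') -!(tc_nat alpha).
  by rewrite -![fm (comp_functor _ _) _]/(fm g (fm F _)) e.
have g_faithful U V (x : fibre_product c b U) (y : fibre_product c b V)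
    (t t' : fhom x y) : fm g t = fm g t' -> t = t'.
  move=> e; apply: (vepi (tc_pr beta x)).
  rewrite -[t]/(fm (id_functor (fibre_product c b)) t).
  rewrite -[t']/(fm (id_functor (fibre_product c b)) t') -!(tc_nat beta).
  by rewrite -![fm (comp_functor _ _) _]/(fm F (fm g _)) e.
split.
- by move=> U m; exact: (tc_pr theta m).
- by move=> U V m m' a; apply: (tc_nat theta a).
- move=> U h m.
  have e : h = gres (fpr (tc theta m)) h by apply: gres_vert; exact: (tc_pr theta m).
  have := theta_eqv U h m e; rewrite /= fcomp1c => ->.
  by rewrite -[fm b (idc U)]/(pt_map b (idc U)) pt_map_id fcompc1.
- move=> U V n a.
  (* The arrow [a] may lie over any arrow of the base; removing the image of its projection under
     [b] leaves a vertical arrow, as an object of the fibre product requires. *)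
  have e : fpr (pt_map b (fpr a)) \; idc V = fpr a by rewrite pt_map_pr compc1.
  pose o : fibre_product c b V := @FpOb _ _ _ _ c b V n (pt_ob V) (factor e) (factor_pr e).
  pose d := tc beta o.
  have dp : fpr (fph1 d) = idc V := tc_pr beta o.
  exists (fo g o), (fph1 d); split=> //.
  rewrite -{1}(factorK e) -fcompA (fph_iso d) /=.
  have -> : fm b (fph2 d) = pt_map b (idc V) by rewrite -dp (fph_pr d).
  by rewrite pt_map_id fcomp1c.
- move=> U V m m' d e.
  pose delta : fhom (fo F m) (fo F m') :=
    @FpHom _ _ _ _ _ _ _ _ (fo F m) (fo F m') d (fpr d) erefl e.
  exists (tc alpha m' \c fm g delta \c vinv (tc_pr alpha m)).
  suff h : fm F (tc alpha m' \c fm g delta \c vinv (tc_pr alpha m)) = delta.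
    exact: (congr1 (fun x => fph1 x) h).
  apply: g_faithful; apply: (fcancel (a := tc alpha m')).
    rewrite !fm_pr !fpr_comp vinv_pr fm_pr (tc_pr alpha m').
    by rewrite comp1c compc1.
  rewrite -[fm g _]/(fm (comp_functor g F) _) (tc_nat alpha) /=.
  by rewrite -!fcompA vinvKl fcompc1.
- move=> U V m m' t t' e; apply: F_faithful; apply: fp_hom_eq => //=.
  by rewrite -[LHS](fm_pr p) -[RHS](fm_pr p) e.
Qed.

(** * Local surjectivity of a quotient map, from its universal property *)

Section LocallyTrivial.
Variables (C : site) (H : group_presheaf C) (Y : prestack C) (A : action H Y).
Variables (Q : prestack C) (q : functor Y Q) (K : equivariant A (triv H Q) q).
Hypothesis quotK : is_quotient K.

Definition locally_in_image U (x : Q U) : Prop :=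
  exists2 S : sieve U, covering S &
    forall V (f : hom V U), S V f ->
      exists (y : Y V) (a : fhom (fo q y) x), fpr a = f.

Lemma locally_in_image_stable U V (x : Q U) (y : Q V) :
  fhom x y -> locally_in_image y -> locally_in_image x.
Proof.
move=> a [S cS h]; exists (pullback_sieve (fpr a) S); first exact: covering_pullback.
move=> W f Sf; have [z [d dp]] := h _ _ Sf.
by exists z, (factor (esym dp)); apply: factor_pr.
Qed.

Let I := sub_prestack locally_in_image_stable.

(** A full sub-prestack of a stack is a stack when membership is local; here that is the
    transitivity of coverings. *)
Lemma locally_in_image_stack : is_stack I.
Proof.
have [stackQ _] := quotK; have [sep hg og] := (stackP Q).1 stackQ.
apply/stackP; split.
- move=> U V S cS z w a b e h; apply: (sep _ _ _ cS) => // W f Sf.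
  by have [x [d [dp de]]] := h W f Sf; exists (sval x), d.
- move=> U V S cS z w h beta beta_pr beta_nat.
  pose o W (x : Q W) (d : fhom x (sval z)) : I W :=
    exist _ x (locally_in_image_stable d (svalP z)).
  have [] := hg U V S cS (sval z) (sval w) h
    (fun W x d s => beta W (o W x d) d s).
  + by move=> W x d s; apply: (beta_pr W (o W x d) d s).
  + move=> W W' x x' d s m s'.
    by apply: (beta_nat W W' (o W x d) (o W' x' (d \c m)) d s m s').
  move=> a [ap ae]; exists a; split=> // W x d s.
  apply: etrans (ae W (sval x) d s) _.
  case: x d s => x px d s; rewrite /o /=.
  by have -> : locally_in_image_stable d (svalP z) = px by apply: Prop_irrelevance.
- move=> U S cS s.
  have [z [iota [iota_pr iota_nat]]] :=
    og U S cS (comp_functor (sub_incl locally_in_image_stable) s).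
  have pz : locally_in_image z.
    pose T := @Sieve C U (fun V f => exists (y : Y V) (a : fhom (fo q y) z), fpr a = f).
    have Tp V W (f : hom V U) (g : hom W V) :
        (exists (y : Y V) (a : fhom (fo q y) z), fpr a = f) ->
        exists (y : Y W) (a : fhom (fo q y) z), fpr a = f \; g.
      move=> [y [a <-]]; exists (pullback g y), (a \c fm q (pullback_map g y)).
      by rewrite fpr_comp fm_pr pullback_map_pr.
    exists (T Tp) => //; apply: (covering_local cS) => V f Sf.
    have [S' cS' h'] := svalP (fo s (exist _ f Sf)).
    apply: (covering_local cS') => W g Sg; apply: covering_all => W' g'.
    have [y [a ap]] := h' _ _ (sieveP g' Sg).
    exists y, (iota V (exist _ f Sf) \c a).
    by rewrite fpr_comp iota_pr ap.
  by exists (exist _ z pz), iota.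
Qed.

(** The quotient map and its invariance land in the substack [I], so they extend to [k : Q -> I].
    Followed by the inclusion, [k] agrees with the identity along [q], hence admits a 2-cell to the
    identity; so [x] is isomorphic to an object of [I]. *)
Lemma quotient_locally_in_image U (x : Q U) : locally_in_image x.
Proof.
have [_ univ] := quotK.
have im V (y : Y V) : locally_in_image (fo q y).
  exists (max_sieve V) => [|W f _]; first exact: covering_max.
  by exists (pullback f y), (fm q (pullback_map f y)); rewrite fm_pr pullback_map_pr.
pose q' : functor Y I := @Functor C Y I (fun V y => exist _ _ (im V y))
  (fun _ _ _ _ a => fm q a) (fun _ _ _ _ a => fm_pr q a)
  (fun _ y => fm_id q y) (fun _ _ _ _ _ _ b a => fm_comp q b a).
pose K' : equivariant A (triv H I) q' :=
  @Equivariant C H Y I A (triv H I) q' (fun V g y => eqv K g y)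
    (fun V g y => eqv_pr K g y)
    (fun _ _ _ _ _ _ a e e' => eqv_nat K e e')
    (fun _ g h y e => @eqv_assoc _ _ _ _ _ _ _ K _ g h y e)
    (fun _ y => @eqv_unit _ _ _ _ _ _ _ K _ y).
have [es _] := univ I locally_in_image_stack.
have [k [eta eta_eqv]] := es q' K'.
pose i := sub_incl locally_in_image_stable.
have [_ ff] := univ Q (proj1 quotK).
pose eta' : two_cell (comp_functor (comp_functor i k) q) (comp_functor (id_functor Q) q) :=
  @TwoCell _ _ _ (comp_functor (comp_functor i k) q) (comp_functor (id_functor Q) q)
    (fun V y => tc eta y) (fun V y => tc_pr eta y)
    (fun _ _ _ _ a => tc_nat eta a).
have [|zeta _] := ff (comp_functor i k) (id_functor Q) eta'.
  move=> V g y e; rewrite /= !fcomp1c.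
  by have := eta_eqv V g y e; rewrite /= !fcomp1c.
exact: locally_in_image_stable (vinv (tc_pr zeta x)) (svalP (fo k x)).
Qed.

End LocallyTrivial.

(* A torsor is locally surjective, [pt -> BG] being so. *)
Lemma chart_locally_surjective (C : site) (G : group_presheaf C)
    (M N : prestack C) (A : action G M) (p : functor M N)
    (P : equivariant A (triv G N) p) (BG : prestack C) (b : functor (pt C) BG)
    (K : equivariant (triv G (pt C)) (triv G BG) b) (c : functor N BG)
    (theta : forall U (m : M U), fhom (fo c (fo p m)) (fo b (pt_ob U)))
    U (n : N U) :
  is_quotient K -> torsor_chart P K theta -> locally_in_image p n.
Proof.
move=> quotK chart.
have [S cS h] := quotient_locally_in_image quotK (fo c n).
exists S => // V f Sf; have [[] [a ap]] := h V f Sf.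
pose nu := pullback_map f n.
have e : fpr (fm c nu) \; idc V = fpr a by rewrite fm_pr pullback_map_pr compc1.
have [m [d [dp _]]] := chart_lift chart (vinv (factor_pr e : fpr (factor e : fhom (fo
  b (pt_ob V)) _) = idc V)).
by exists m, (nu \c d); rewrite fpr_comp dp pullback_map_pr compc1.
Qed.

(** * Descent along a torsor *)

(** Multiplicativity makes the restriction of the unit idempotent, and cancellation does the
    rest. *)
Lemma gres1 (C : category) (G : group_presheaf C) (U V : C) (f : hom U V) :
  gres f (1 : G V)%g = 1%g.
Proof.
have e : (gres f (1 : G V) * gres f 1 = gres f 1 * 1)%g by rewrite -gresM !mulg1.
exact: mulgI e.
Qed.

Section Descent.
Variables (C : site) (G : group_presheaf C) (M N : prestack C).
Variables (A : action G M) (p : functor M N) (P : equivariant A (triv G N) p).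
Variables (BG : prestack C) (b : functor (pt C) BG).
Variable K : equivariant (triv G (pt C)) (triv G BG) b.
Variable c : functor N BG.
Variable theta : forall U (m : M U), fhom (fo c (fo p m)) (fo b (pt_ob U)).
Hypothesis quotK : is_quotient K.
Hypothesis chart : torsor_chart P K theta.
Variable Z : prestack C.
Hypothesis stackZ : is_stack Z.

Local Notation base U := (fo b (pt_ob U)).
Local Notation W := (dep_prestack c Z).

Section Lifts.
Variables (U V : C) (u : comma c (base U) V).

(** Over the trivial torsor the fibre of [N] is M x U, by cartesianness of the defining square; this
    is the component in [M], chosen together with its comparison [lift_map]. *)
Definition lift_ob : M V := sval (cid (chart_lift chart (carr u))).

Definition lift_map : fhom (fo p lift_ob) (cob u) :=
  sval (cid (svalP (cid (chart_lift chart (carr u))))).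

Lemma lift_map_pr : fpr lift_map = idc V.
Proof. by have [] := svalP (cid (svalP (cid (chart_lift chart (carr u))))). Qed.

Lemma lift_mapE :
  carr u \c fm c lift_map = pt_map b (fpr (carr u)) \c theta lift_ob.
Proof. by have [] := svalP (cid (svalP (cid (chart_lift chart (carr u))))). Qed.

(* [sigma] is the comparison of [b] with [y] given by the trivialisation of [x]:
   it is a restriction map for the functoriality in [pt] and is composed with
   the action of [G] on [b] for the equivariance. *)
Lemma lift_arrow V' (x : M V') (n : N V') (r : fhom (fo p x) n)
    U' (y : BG U') (a : fhom (fo c n) y) (sigma : fhom (base V') y)
    (m : fhom (cob u) n) (s : fhom (base U) y) :
  fpr r = idc V' -> a \c fm c r = sigma \c theta x ->
  a \c fm c m = s \c carr u ->
  sigma \c pt_map b (fpr m) = s \c pt_map b (fpr (carr u)) ->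
  exists t : fhom lift_ob x, r \c fm p t = m \c lift_map.
Proof.
move=> rp er em es.
pose d := vinv rp \c m \c lift_map.
have ed : r \c d = m \c lift_map by rewrite fcompA vinvK fcomp1c.
have dp : fpr d = fpr m by rewrite !fpr_comp vinv_pr lift_map_pr comp1c compc1.
have [t et] : exists t : fhom lift_ob x, fm p t = d.
  apply: (chart_full chart); apply: (fcancel (a := sigma)).
    by rewrite [LHS]fpr_comp [RHS]fpr_comp fm_pr pt_map_pr !(chart_pr chart) comp1c compc1.
  rewrite fcompA -er -fcompA -fm_comp ed fm_comp fcompA em -fcompA lift_mapE.
  by rewrite !fcompA -es dp.
by exists t; rewrite et.
Qed.

End Lifts.

Lemma lift_uniq V V' (x : M V) (x' : M V') (n : N V') (r : fhom (fo p x') n)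
    (t t' : fhom x x') :
  fpr r = idc V' -> r \c fm p t = r \c fm p t' -> t = t'.
Proof.
move=> rp e; apply: (chart_faithful chart); apply: (fcancel (a := r)) => //.
by have := congr1 (@fpr _ _ _ _ _ _) e; rewrite !fpr_comp rp !comp1c.
Qed.

Lemma comma_lift U V V' (u : comma c (base U) V) (v : comma c (base U) V')
    (m : fhom u v) : exists t : fhom (lift_ob u) (lift_ob v),
  lift_map v \c fm p t = cmap m \c lift_map u.
Proof.
apply: (lift_arrow (a := carr v) (sigma := pt_map b (fpr (carr v))) (s := fid _)).
- exact: lift_map_pr.
- exact: lift_mapE.
- by rewrite cmapE fcomp1c.
- by rewrite -pt_map_comp fcomp1c -(cmapE m) fpr_comp fm_pr.
Qed.

Lemma hom_lift U U' (h : hom U U') V V' (u : comma c (base U) V)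
    (v : comma c (base U') V') (m : fhom (cob u) (cob v)) :
  carr v \c fm c m = pt_map b h \c carr u ->
  exists t : fhom (lift_ob u) (lift_ob v), lift_map v \c fm p t = m \c lift_map u.
Proof.
move=> e.
apply: (lift_arrow (a := carr v) (sigma := pt_map b (fpr (carr v))) (s := pt_map b
  h)) => //.
- exact: lift_map_pr.
- exact: lift_mapE.
- rewrite -!pt_map_comp; congr pt_map.
  by have := congr1 (@fpr _ _ _ _ _ _) e; rewrite !fpr_comp fm_pr pt_map_pr.
Qed.

Lemma pt_eqv_nat U V (h : hom U V) (g : G V) :
  eqv K g (pt_ob V) \c pt_map b h = pt_map b h \c eqv K (gres h g) (pt_ob U).
Proof.
have e' : gres h g = gres (fpr (pt_map b h)) g by rewrite pt_map_pr.
exact: (@eqv_nat _ _ _ _ _ _ _ K U V (pt_ob U) (pt_ob V) (gres h g) g h erefl e').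
Qed.

(** Composing with [eqv K g] changes the trivialisation by [g], so [m] lifts to an arrow into the
    translate of the lift of [v], by [g] restricted along [carr v]. *)
Lemma act_lift U (g : G U) V V' (u : comma c (base U) V)
    (v : comma c (base U) V') (m : fhom (cob u) (cob v)) :
  carr v \c fm c m = eqv K g (pt_ob U) \c carr u ->
  exists t : fhom (lift_ob u) (aob A (gres (fpr (carr v)) g) (lift_ob v)),
    (lift_map v \c eqv P (gres (fpr (carr v)) g) (lift_ob v)) \c fm p t
      = m \c lift_map u.
Proof.
move=> e; set g' := gres _ g.
apply: (lift_arrow (a := carr v)
  (sigma := pt_map b (fpr (carr v)) \c eqv K g' (pt_ob V')) (s := eqv K g (pt_ob U))) => //.
- by rewrite fpr_comp lift_map_pr (eqv_pr P) compc1.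
- by rewrite fm_comp fcompA lift_mapE -!fcompA (chart_eqv chart).
- rewrite -pt_eqv_nat -fcompA -pt_map_comp; congr (_ \c pt_map _ _).
  by have := congr1 (@fpr _ _ _ _ _ _) e; rewrite !fpr_comp fm_pr (eqv_pr K) comp1c.
Qed.

Section Existence.
Variables (f : functor M Z) (E : equivariant A (triv G Z) f).

(** Arrows of [M] are determined by their images in [N], so equations between values of [f] and [E]
    are verified in [N], with [P] in the place of [E]. All laws of [desc_eqv] reduce to this. *)
Lemma act_eq V V' (x : M V) (x' : M V') (n : N V') (r : fhom (fo p x') n)
    (g g' : G V') (t : fhom x (aob A g x')) (t' : fhom x (aob A g' x')) :
  fpr r = idc V' -> g = g' ->
  r \c eqv P g x' \c fm p t = r \c eqv P g' x' \c fm p t' ->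
  eqv E g x' \c fm f t = eqv E g' x' \c fm f t'.
Proof.
move=> rp eg; subst g' => e; congr (_ \c fm f _).
apply: (lift_uniq (r := r \c eqv P g x')); first by rewrite fpr_comp rp (eqv_pr P) compc1.
by rewrite -!fcompA.
Qed.

Lemma act_eq1 V V' (x : M V) (x' : M V') (n : N V') (r : fhom (fo p x') n)
    (g : G V') (t : fhom x (aob A g x')) (t' : fhom x x') :
  fpr r = idc V' -> g = 1%g ->
  r \c eqv P g x' \c fm p t = r \c fm p t' -> eqv E g x' \c fm f t = fm f t'.
Proof.
move=> rp eg; subst g => e.
have e1 := eqv_unit E x'; rewrite /= fcomp1c in e1.
have e2 := eqv_unit P x'; rewrite /= fcomp1c in e2.
rewrite e1 -fm_comp; congr (fm f); apply: (lift_uniq rp).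
by rewrite fm_comp -e2.
Qed.

Lemma act_natP V V' (x : M V) (x' : M V') (g : G V) (g' : G V') (t : fhom x x')
    (e : g = gres (fpr t) g') :
  eqv P g' x' \c fm p (amap A t e) = fm p t \c eqv P g x.
Proof.
have e' : g = gres (fpr (fm p t)) g' by rewrite fm_pr.
exact: (eqv_nat P e e').
Qed.

Lemma act_natE V V' (x : M V) (x' : M V') (g : G V) (g' : G V') (t : fhom x x')
    (e : g = gres (fpr t) g') :
  eqv E g' x' \c fm f (amap A t e) = fm f t \c eqv E g x.
Proof.
have e' : g = gres (fpr (fm f t)) g' by rewrite fm_pr.
exact: (eqv_nat E e e').
Qed.

Lemma lift_fpr V V' (x : M V) (x' : M V') (n : N V) (n' : N V')
    (r : fhom (fo p x) n) (r' : fhom (fo p x') n') (t : fhom x x') (m : fhom n n') :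
  fpr r = idc V -> fpr r' = idc V' -> r' \c fm p t = m \c r -> fpr t = fpr m.
Proof.
move=> rp rp' e; have := congr1 (@fpr _ _ _ _ _ _) e.
by rewrite !fpr_comp rp rp' fm_pr comp1c compc1.
Qed.

(** Under the identification of the fibre with M x U, this is the projection to [M] followed by
    [f]. *)
Program Definition desc_fun U : functor (comma c (base U)) Z :=
  @Functor C (comma c (base U)) Z (fun V u => fo f (lift_ob u))
    (fun V V' u v m => fm f (sval (cid (comma_lift m)))) _ _ _.
Next Obligation.
move=> U V V' u v m; apply: etrans (fm_pr f _) _.
exact: (lift_fpr (lift_map_pr u) (lift_map_pr v) (svalP (cid (comma_lift m)))).
Qed.
Next Obligation.
move=> U V u; rewrite -fm_id; congr (fm f); apply: (lift_uniq (lift_map_pr u)).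
by rewrite (svalP (cid (comma_lift _))) fm_id fcompc1 fcomp1c.
Qed.
Next Obligation.
move=> U V V' V'' u v w m' m; rewrite -fm_comp; congr (fm f).
apply: (lift_uniq (lift_map_pr w)).
rewrite (svalP (cid (comma_lift _))) fm_comp fcompA (svalP (cid (comma_lift m'))).
by rewrite -!fcompA (svalP (cid (comma_lift m))).
Qed.

Definition desc_ob U : W U := DepOb (desc_fun U).

Program Definition desc_arrow U U' (h : hom U U') :
    dep_hom (desc_ob U) (desc_ob U') :=
  @DepHom _ _ _ c Z _ _ (desc_ob U) (desc_ob U') (pt_map b h)
    (fun V V' u v m e => fm f (sval (cid (hom_lift e)))) _ _.
Next Obligation.
move=> U U' h V V' u v m e; apply: etrans (fm_pr f _) _.
exact: (lift_fpr (lift_map_pr u) (lift_map_pr v) (svalP (cid (hom_lift e)))).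
Qed.
Next Obligation.
move=> U U' h V V' V1 V2 u v u1 v1 m e m1 e1 a a' em /=.
rewrite -!fm_comp; congr (fm f); apply: (lift_uniq (lift_map_pr v1)).
rewrite !fm_comp !fcompA (svalP (cid (comma_lift a'))) (svalP (cid (hom_lift e1))).
by rewrite -!fcompA (svalP (cid (comma_lift a))) (svalP (cid (hom_lift e))) !fcompA em.
Qed.

(** Changing the trivialisation by [g] translates the lifts, and the invariance [E] of [f] brings
    the values back; this makes the point of W attached to [f] a G-invariant one, over the
    invariance of [b]. *)
Program Definition desc_act U (g : G U) : dep_hom (desc_ob U) (desc_ob U) :=
  @DepHom _ _ _ c Z _ _ (desc_ob U) (desc_ob U) (eqv K g (pt_ob U))
    (fun V V' u v m e => eqv E _ (lift_ob v) \c fm f (sval (cid (act_lift e)))) _ _.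
Next Obligation.
move=> U g V V' u v m e; apply: etrans (fpr_comp _ _) _.
rewrite (eqv_pr E) comp1c; apply: etrans (fm_pr f _) _.
have h := svalP (cid (act_lift e)).
apply: (lift_fpr (lift_map_pr u) _ h).
by rewrite fpr_comp lift_map_pr (eqv_pr P) compc1.
Qed.
Next Obligation.
move=> U g V V' V1 V2 u v u1 v1 m e m1 e1 a a' em /=.
set t := sval (cid (act_lift e)); set t1 := sval (cid (act_lift e1)).
set s := sval (cid (comma_lift a)); set s' := sval (cid (comma_lift a')).
have ht := svalP (cid (act_lift e)); have ht1 := svalP (cid (act_lift e1)).
have hs := svalP (cid (comma_lift a)); have hs' := svalP (cid (comma_lift a')).
rewrite -/t -/t1 -/s -/s' in ht ht1 hs hs'.
have eg : gres (fpr (carr v)) g = gres (fpr s') (gres (fpr (carr v1)) g).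
  rewrite -gres_comp (lift_fpr (lift_map_pr v) (lift_map_pr v1) hs').
  by rewrite -(cmapE a') fpr_comp fm_pr.
rewrite fcompA -(act_natE eg) -!fcompA -!fm_comp.
rewrite -fcompA in ht; rewrite -fcompA in ht1.
apply: (act_eq (lift_map_pr v1)) => //.
rewrite !fm_comp [X in _ \c X = _]fcompA act_natP -[X in _ \c X = _]fcompA.
rewrite [LHS]fcompA hs' -[LHS]fcompA ht.
by rewrite [X in _ = _ \c X]fcompA [RHS]fcompA ht1 -[RHS]fcompA hs !fcompA em.
Qed.

Lemma hom_liftE U U' (h : hom U U') V V' (u : comma c (base U) V)
    (v : comma c (base U') V') (m : fhom (cob u) (cob v))
    (e : carr v \c fm c m = pt_map b h \c carr u) :
  lift_map v \c fm p (sval (cid (hom_lift e))) = m \c lift_map u.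
Proof. exact: (svalP (cid (hom_lift e))). Qed.

Lemma act_liftE U (g : G U) V V' (u : comma c (base U) V)
    (v : comma c (base U) V') (m : fhom (cob u) (cob v))
    (e : carr v \c fm c m = eqv K g (pt_ob U) \c carr u) :
  lift_map v \c eqv P (gres (fpr (carr v)) g) (lift_ob v)
    \c fm p (sval (cid (act_lift e))) = m \c lift_map u.
Proof. by have := svalP (cid (act_lift e)); rewrite -fcompA. Qed.

Program Definition desc_functor : functor (pt C) W :=
  @Functor C (pt C) W (fun U _ => desc_ob U) (fun U V _ _ h => desc_arrow h) _ _ _.
Next Obligation. by intros; apply: pt_map_pr. Qed.
Next Obligation.
move=> U []; apply: (@dep_hom_eq _ _ _ _ _ _ _ (desc_ob U) (desc_ob U)) => [|V V' u v
  m e e']; first exact: pt_map_id.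
congr (fm f); apply: (lift_uniq (lift_map_pr v)).
by rewrite hom_liftE (svalP (cid (comma_lift _))).
Qed.
Next Obligation.
move=> U V V' [] [] [] h' h; apply: (@dep_hom_eq _ _ _ _ _ _ _ (desc_ob U) (desc_ob
  V')) => [|V1 V2 u v m e e'].
  exact: pt_map_comp.
apply: etrans (fm_comp f _ _); congr (fm f); apply: (lift_uniq (lift_map_pr v)).
by rewrite hom_liftE fm_comp fcompA hom_liftE -fcompA hom_liftE fcomp1c.
Qed.

Program Definition desc_eqv : equivariant (triv G (pt C)) (triv G W) desc_functor :=
  @Equivariant C G (pt C) W (triv G (pt C)) (triv G W) desc_functor
    (fun U g _ => desc_act g) _ _ _ _.
Next Obligation. by move=> U g x; exact: (eqv_pr K g (pt_ob U)). Qed.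
Next Obligation.
move=> U V [] [] g h a e e'.
apply: (@dep_hom_eq _ _ _ _ _ _ _ (desc_ob U) (desc_ob V)) => [|V1 V2 u v m e1 e2].
  by apply: etrans (pt_eqv_nat a h) _; rewrite -[gres a h]e.
set v1 := post_ob (pt_map b a) u; set v2 := post_ob (eqv K g (pt_ob U)) u.
have h1 : carr v1 \c fm c (fid (cob u)) = pt_map b a \c carr u.
  exact: dep_comp_subproof1.
have h2 : carr v \c fm c m = eqv K h (pt_ob V) \c carr v1.
  by rewrite e1 /= -fcompA.
have h3 : carr v2 \c fm c (fid (cob u)) = eqv K g (pt_ob U) \c carr u.
  exact: dep_comp_subproof1.
have h4 : carr v \c fm c m = pt_map b a \c carr v2.
  by rewrite e2 /= -fcompA.
have -> : dcell (dep_comp (desc_act h) (desc_arrow a)) m e1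
    = (eqv E _ (lift_ob v) \c fm f (sval (cid (act_lift (U := V) (u := v1) (v := v) h2))))
      \c fm f (sval (cid (hom_lift (U := U) (U' := V) (u := u) (v := v1) h1))).
  by apply: (@dcell_comp _ _ _ _ _ _ _ _ (desc_ob U) (desc_ob V) (desc_ob V)
    (desc_act h) (desc_arrow a) _ _ _ u v1 v _ h1 _ h2); rewrite fcompc1.
have -> : dcell (dep_comp (desc_arrow a) (desc_act g)) m e2
    = fm f (sval (cid (hom_lift (U := U) (U' := V) (u := v2) (v := v) h4)))
      \c (eqv E _ (lift_ob v2) \c fm f (sval (cid (act_lift (U := U) (u := u) (v :=
        v2) h3)))).
  by apply: (@dcell_comp _ _ _ _ _ _ _ _ (desc_ob U) (desc_ob U) (desc_ob V)
    (desc_arrow a) (desc_act g) _ _ _ u v2 v _ h3 _ h4); rewrite fcompc1.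
have := act_liftE (U := U) (u := u) (v := v2) h3.
have := act_liftE (U := V) (u := v1) (v := v) h2.
have := hom_liftE (U := U) (U' := V) (u := u) (v := v1) h1.
have := hom_liftE (U := U) (U' := V) (u := v2) (v := v) h4.
set t4 := sval _; set t1 := sval _; set t2 := sval _; set t3 := sval _.
move=> q4 q1 q2 q3.
have eg : gres (fpr (carr v2)) g = gres (fpr t4) (gres (fpr (carr v)) h).
  rewrite -gres_comp (lift_fpr (lift_map_pr v2) (lift_map_pr v) q4).
  rewrite [g in LHS](e : g = gres a h) -gres_comp.
  have := congr1 (@fpr _ _ _ _ _ _) h4; rewrite !fpr_comp fm_pr pt_map_pr => -> //.
rewrite [RHS]fcompA -(act_natE eg) -!fcompA -!fm_comp.
apply: (act_eq (lift_map_pr v)) => //.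
rewrite !fm_comp [X in _ = _ \c X]fcompA act_natP -[X in _ = _ \c X]fcompA.
rewrite [RHS]fcompA q4 -[RHS]fcompA q3.
by rewrite [X in _ \c X = _]fcompA [LHS]fcompA q2 -[LHS]fcompA q1.
Qed.
Next Obligation.
move=> U g h [] e; rewrite [RHS]fcomp1c.
apply: etrans (congr1 _ (fm_id desc_functor _)) _; rewrite fcompc1.
apply: (@dep_hom_eq _ _ _ _ _ _ _ (desc_ob U) (desc_ob U)) => [|V1 V2 u v m e1 e2].
  have e' : g = gres (fpr (eqv K h (pt_ob U))) g by apply/gres_vert/eqv_pr.
  have := @eqv_assoc _ _ _ _ _ _ _ K U g h (pt_ob U) e'; rewrite /= fcomp1c => <-.
  by rewrite -[fm b _]/(pt_map b (idc U)) pt_map_id fcompc1.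
set v1 := post_ob (eqv K g (pt_ob U)) u.
have h1 : carr v1 \c fm c (fid (cob u)) = eqv K g (pt_ob U) \c carr u.
  exact: dep_comp_subproof1.
have h2 : carr v \c fm c m = eqv K h (pt_ob U) \c carr v1.
  by rewrite e2 /= -fcompA.
have -> : dcell (dep_comp (desc_act h) (desc_act g)) m e2
    = (eqv E _ (lift_ob v) \c fm f (sval (cid (act_lift (U := U) (u := v1) (v := v) h2))))
      \c (eqv E _ (lift_ob v1) \c fm f (sval (cid (act_lift (U := U) (u := u) (v :=
        v1) h1)))).
  by apply: (@dcell_comp _ _ _ _ _ _ _ _ (desc_ob U) (desc_ob U) (desc_ob U)
    (desc_act h) (desc_act g) _ _ _ u v1 v _ h1 _ h2); rewrite fcompc1.
rewrite -[dcell _ _ e1]/(eqv E _ (lift_ob v) \c fm f (sval (cid (act_lift (U := U) (u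
  := u) (v := v) e1)))).
have := act_liftE (U := U) (u := u) (v := v) e1.
have := act_liftE (U := U) (u := v1) (v := v) h2.
have := act_liftE (U := U) (u := u) (v := v1) h1.
set t1 := sval _; set t2 := sval _; set t := sval _.
move=> q1 q2 q.
have t2p : fpr t2 = fpr m.
  rewrite fcompA in q2.
  apply: (lift_fpr (lift_map_pr v1) _ q2).
  by rewrite fpr_comp lift_map_pr (eqv_pr P) compc1.
(* The element by which [v1] is translated must be the restriction along [t2] of the one for [v], so
   that the action by [g] can be moved past [t2] by naturality. *)
have eg : gres (fpr (carr v1)) g = gres (fpr t2) (gres (fpr (carr v)) g).
  rewrite -gres_comp t2p.
  have := congr1 (@fpr _ _ _ _ _ _) h2.
  by rewrite !fpr_comp fm_pr !(eqv_pr K) !comp1c => ->; rewrite /= ?fpr_comp ?(eqv_pr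
    K) ?comp1c.
rewrite -[RHS]fcompA [X in _ = _ \c X]fcompA -(act_natE eg).
set g' := gres (fpr (carr v)) g; set h' := gres (fpr (carr v)) h.
have e' : g' = gres (fpr (eqv E h' (lift_ob v))) g' by apply/gres_vert/eqv_pr.
have := @eqv_assoc _ _ _ _ _ _ _ E _ g' h' (lift_ob v) e'; rewrite /= fcomp1c => eE.
rewrite -[X in _ = _ \c X]fcompA [RHS]fcompA -eE -!fcompA -!fm_comp.
apply: (act_eq (lift_map_pr v)); first exact: gresM.
have e'' : g' = gres (fpr (eqv P h' (lift_ob v))) g' by apply/gres_vert/eqv_pr.
have := @eqv_assoc _ _ _ _ _ _ _ P _ g' h' (lift_ob v) e''; rewrite /= fcomp1c => eP.
rewrite q !fm_comp [X in _ = _ \c X]fcompA eP -[X in _ = _ \c X]fcompA.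
rewrite [X in _ = _ \c _ \c X]fcompA act_natP -[X in _ = _ \c _ \c X]fcompA.
rewrite [X in _ = _ \c X]fcompA [RHS]fcompA q2 -[RHS]fcompA q1.
by rewrite fcomp1c.
Qed.
Next Obligation.
move=> U []; rewrite [LHS]fcomp1c; apply: etrans (esym (fm_id desc_functor _)).
apply: (@dep_hom_eq _ _ _ _ _ _ _ (desc_ob U) (desc_ob U)) => [|V1 V2 u v m e1 e2].
  have := @eqv_unit _ _ _ _ _ _ _ K U (pt_ob U); rewrite /= fcomp1c => ->.
  exact: (pt_map_id b U).
rewrite -[dcell _ _ e1]/(eqv E _ (lift_ob v) \c fm f (sval (cid (act_lift (U := U) (u
  := u) (v := v) e1)))).
have e3 : carr v \c fm c m = carr u by rewrite e2 fcomp1c.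
pose m' : fhom u v := CommaHom e3.
transitivity (fm f (sval (cid (comma_lift m')))).
  apply: (act_eq1 (lift_map_pr v)); first exact: gres1.
  by rewrite act_liftE (svalP (cid (comma_lift m'))).
congr (fm f); apply: (lift_uniq (lift_map_pr v)).
by rewrite !(svalP (cid (comma_lift _))).
Qed.

End Existence.
End Descent.

(** * Invariant maps descend: evaluating a section of the dependent product *)

Section DescentExists.
Variables (C : site) (G : group_presheaf C) (M N : prestack C).
Variables (A : action G M) (p : functor M N) (P : equivariant A (triv G N) p).
Variables (BG : prestack C) (b : functor (pt C) BG).
Variable K : equivariant (triv G (pt C)) (triv G BG) b.
Variable c : functor N BG.
Variable theta : forall U (m : M U), fhom (fo c (fo p m)) (fo b (pt_ob U)).
Hypothesis quotK : is_quotient K.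
Hypothesis chart : torsor_chart P K theta.
Variable Z : prestack C.
Hypothesis stackZ : is_stack Z.
Variables (f : functor M Z) (E : equivariant A (triv G Z) f).

Local Notation base U := (fo b (pt_ob U)).
Local Notation W := (dep_prestack c Z).

(* [sigma] is a section, up to [zeta], of the projection from [W] to [BG]. *)
Variable sigma : functor BG W.
Variable epsilon : two_cell (comp_functor sigma b) (desc_functor chart f).
Hypothesis epsilon_eqv : equivariant_cell
  (comp_equivariant (triv_equivariant G sigma) K) (desc_eqv chart E) epsilon.
Variable zeta : two_cell (comp_functor (dep_pr c Z) sigma) (id_functor BG).
Hypothesis zeta_base : forall U,
  tc zeta (base U) = dmap (tc epsilon (pt_ob U)).

(** The tautological point [n] of its own fibre, transported by [zeta] because [sigma] is a section
    only up to isomorphism. Evaluating [sigma] there is the transposition from sections of W to maps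
    N -> Z. *)
Definition section_ob U (n : N U) : comma c (dbase (fo sigma (fo c n))) U :=
  @CommaOb _ _ _ c _ _ _ n (vinv (tc_pr zeta (fo c n))).

Lemma section_obE U (n : N U) : tc zeta (fo c n) \c carr (section_ob n) = fid _.
Proof. exact: vinvK. Qed.

Lemma section_map_subproof U V (n : N U) (n' : N V) (m : fhom n n') :
  carr (section_ob n') \c fm c m = dmap (fm sigma (fm c m)) \c carr (section_ob n).
Proof.
have hp : fpr (dmap (fm sigma (fm c m))) = fpr m by rewrite -[RHS](fm_pr c); exact:
  (fm_pr sigma).
apply: (fcancel (a := tc zeta (fo c n'))).
  by rewrite !fpr_comp !vinv_pr fm_pr hp comp1c compc1.
rewrite !fcompA section_obE fcomp1c.
have -> : tc zeta (fo c n') \c dmap (fm sigma (fm c m)) = fm c m \c tc zeta (fo c n).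
  exact: (tc_nat zeta (fm c m)).
by rewrite -fcompA section_obE fcompc1.
Qed.

Program Definition section_functor : functor N Z :=
  @Functor C N Z (fun U n => fo (dfun (fo sigma (fo c n))) (section_ob n))
    (fun U V n n' m => dcell (fm sigma (fm c m)) (u := section_ob n)
       (v := section_ob n') m (section_map_subproof m)) _ _ _.
Next Obligation. by intros; apply: dcell_pr. Qed.
Next Obligation.
move=> U n; pose w := fo sigma (fo c n).
have e : fm sigma (fm c (fid n)) = dep_id w.
  by rewrite fm_id; exact: (fm_id sigma).
have e1 : carr (section_ob n) \c fm c (cmap (fid (section_ob n)))
    = dmap (dep_id w) \c carr (section_ob n).
  by rewrite /= fm_id fcomp1c fcompc1.
rewrite (dcell_eq (u := section_ob n) (v := section_ob n) _ e1 e).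
by rewrite (dcell_id (w := w) (m := fid (section_ob n))) fm_id.
Qed.
Next Obligation.
move=> U V V' n n' n'' m' m.
have e : fm sigma (fm c (m' \c m)) = dep_comp (fm sigma (fm c m')) (fm sigma (fm c m)).
  by rewrite fm_comp; exact: (fm_comp sigma).
have e1 : carr (section_ob n'') \c fm c (m' \c m)
    = dmap (dep_comp (fm sigma (fm c m')) (fm sigma (fm c m))) \c carr (section_ob n).
  by rewrite -e; exact: section_map_subproof.
rewrite (dcell_eq (u := section_ob n) (v := section_ob n'') _ e1 e).
exact: (dcell_comp (u' := section_ob n')).
Qed.

Section Comparison.
Variables (U : C) (m : M U).

Definition triv_ob : comma c (base U) U := CommaOb (theta m).

(** For the object [p m] with its own trivialisation [theta m], the chosen lift recovers [m] up to
    an isomorphism. *)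
Lemma triv_lift : exists t : fhom (lift_ob chart triv_ob) m,
  fm p t = lift_map chart triv_ob.
Proof.
apply: (chart_full chart); rewrite -[theta m]/(carr triv_ob) lift_mapE.
by rewrite lift_map_pr /= (chart_pr chart).
Qed.

Definition triv_map := sval (cid triv_lift).

Lemma triv_mapE : fm p triv_map = lift_map chart triv_ob.
Proof. exact: (svalP (cid triv_lift)). Qed.

Lemma triv_map_pr : fpr triv_map = idc U.
Proof. by rewrite -(fm_pr p) triv_mapE lift_map_pr. Qed.

Definition comparison_arrow : dep_hom (fo sigma (fo c (fo p m))) (desc_ob chart f U) :=
  dep_comp (tc epsilon (pt_ob U)) (fm sigma (theta m)).

Lemma comparison_subproof :
  carr triv_ob \c fm c (fid (fo p m))
    = dmap comparison_arrow \c carr (section_ob (fo p m)).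
Proof.
rewrite fm_id fcompc1 /= -zeta_base.
have -> : tc zeta (base U) \c dmap (fm sigma (theta m))
    = theta m \c tc zeta (fo c (fo p m)) by exact: (tc_nat zeta (theta m)).
by rewrite -fcompA vinvK fcompc1.
Qed.

Definition comparison_cell :
    fhom (fo section_functor (fo p m)) (fo f (lift_ob chart triv_ob)) :=
  dcell comparison_arrow (u := section_ob (fo p m)) (v := triv_ob)
    (fid (fo p m)) comparison_subproof.

Definition comparison : fhom (fo section_functor (fo p m)) (fo f m) :=
  fm f triv_map \c comparison_cell.

Lemma comparison_pr : fpr comparison = idc U.
Proof.
rewrite fpr_comp fm_pr triv_map_pr comp1c.
refine (etrans (dcell_pr (w' := desc_ob chart f U) (d := comparison_arrow) (u :=
  section_ob (fo p m)) (v := triv_ob)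
  comparison_subproof) (fpr_id _)).
Qed.

End Comparison.

(** Naturality of [theta] and of [epsilon] makes two composites in W equal ([es]); both sides of the
    claim are read off from the same cell of these composites. *)
Lemma comparison_nat U V (m : M U) (m' : M V) (a : fhom m m') :
  comparison m' \c fm section_functor (fm p a) = fm f a \c comparison m.
Proof.
pose h := fpr a.
have es : dep_comp (comparison_arrow m') (fm sigma (fm c (fm p a)))
    = dep_comp (desc_arrow chart f h) (comparison_arrow m).
  transitivity (tc epsilon (pt_ob V) \c fm sigma (theta m' \c fm c (fm p a)) : @fhom
    _ W _ _ _ _).
    by rewrite fm_comp; symmetry; exact: (@fcompA _ W).
  rewrite (chart_nat chart) fm_comp.
  rewrite [LHS](@fcompA _ W) [RHS](@fcompA _ W).
  have nat := @tc_nat _ _ _ _ _ epsilon U V (pt_ob U) (pt_ob V) h.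
  exact: (congr1 (fun d => d \c fm sigma (theta m)) nat).
have e1 : carr (triv_ob m') \c fm c (fm p a)
    = dmap (dep_comp (comparison_arrow m') (fm sigma (fm c (fm p a))))
      \c carr (section_ob (fo p m)).
  rewrite -[dmap _]/(dmap (comparison_arrow m') \c dmap (fm sigma (fm c (fm p a)))).
  rewrite -[RHS]fcompA -section_map_subproof fcompA -comparison_subproof.
  by rewrite fm_id fcompc1.
have e2 : carr (triv_ob m') \c fm c (fm p a)
    = dmap (dep_comp (desc_arrow chart f h) (comparison_arrow m))
      \c carr (section_ob (fo p m)) by rewrite -es.
have e3 : carr (triv_ob m') \c fm c (fm p a) = dmap (desc_arrow chart f h) \c carr
  (triv_ob m).
  exact: (chart_nat chart).
have q : comparison_cell m' \c fm section_functor (fm p a)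
    = fm f (sval (cid (hom_lift chart (u := triv_ob m) (v := triv_ob m') e3)))
      \c comparison_cell m.
  transitivity (dcell (dep_comp (comparison_arrow m') (fm sigma (fm c (fm p a))))
        (u := section_ob (fo p m)) (v := triv_ob m') (fm p a) e1).
    symmetry; exact: (dcell_comp (w'' := desc_ob chart f V) (t := comparison_arrow m')
      (u := section_ob (fo p m)) (u' := section_ob (fo p m'))
      (u'' := triv_ob m') (section_map_subproof (fm p a)) (comparison_subproof m')
      e1 (esym (fcomp1c _))).
  rewrite (dcell_eq (w' := desc_ob chart f V) (u := section_ob (fo p m))
    (v := triv_ob m') e1 e2 es).
  exact: (dcell_comp (w' := desc_ob chart f U) (w'' := desc_ob chart f V)
    (t := desc_arrow chart f h) (s := comparison_arrow m) (u := section_ob (fo p m))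
      (u' := triv_ob m)
    (u'' := triv_ob m') (comparison_subproof m) e3 e2 (esym (fcompc1 _))).
rewrite /comparison -[LHS]fcompA q [LHS]fcompA [RHS]fcompA -!fm_comp.
congr (fm f _ \c _).
apply: (chart_faithful chart); rewrite !fm_comp !triv_mapE.
exact: (hom_liftE chart (u := triv_ob m) (v := triv_ob m') e3).
Qed.

(** As for naturality, with [pt_map] replaced by the action on the trivial torsor: [es] now rests on
    [chart_eqv] and on the equivariance of [epsilon]. *)
Lemma comparison_eqv U (g : G U) (m : M U) :
  comparison m \c fm section_functor (eqv P g m)
    = eqv E g m \c comparison (aob A g m).
Proof.
pose q := eqv P g m; pose gm := aob A g m.
have eg : g = gres (fpr (tc epsilon (pt_ob U))) g by apply/gres_vert/tc_pr.
have es : dep_comp (comparison_arrow m) (fm sigma (fm c q))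
    = dep_comp (desc_act chart E g) (comparison_arrow gm).
  transitivity (tc epsilon (pt_ob U) \c fm sigma (theta m \c fm c q) : @fhom _ W _ _ _ _).
    by rewrite fm_comp; symmetry; exact: (@fcompA _ W).
  rewrite (chart_eqv chart) fm_comp.
  rewrite [LHS](@fcompA _ W) [RHS](@fcompA _ W).
  have nat : (tc epsilon (pt_ob U) : @fhom _ W _ _ _ _) \c fm sigma (eqv K g (pt_ob U))
      = (desc_act chart E g : @fhom _ W _ _ _ _) \c tc epsilon (pt_ob U).
    apply: etrans _ (epsilon_eqv eg).
    by congr (_ \c _); symmetry; exact: (@fcomp1c _ W).
  exact: (congr1 (fun d => d \c fm sigma (theta gm)) nat).
have e1 : carr (triv_ob m) \c fm c q
    = dmap (dep_comp (comparison_arrow m) (fm sigma (fm c q)))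
      \c carr (section_ob (fo p gm)).
  rewrite -[dmap _]/(dmap (comparison_arrow m) \c dmap (fm sigma (fm c q))).
  rewrite -[RHS]fcompA -section_map_subproof fcompA -comparison_subproof.
  by rewrite fm_id fcompc1.
have e2 : carr (triv_ob m) \c fm c q
    = dmap (dep_comp (desc_act chart E g) (comparison_arrow gm))
      \c carr (section_ob (fo p gm)) by rewrite -es.
have e3 : carr (triv_ob m) \c fm c q = dmap (desc_act chart E g) \c carr (triv_ob gm).
  exact: (chart_eqv chart).
have := act_liftE chart (u := triv_ob gm) (v := triv_ob m) e3.
set s := sval _ => qs.
have r : comparison_cell m \c fm section_functor q
    = eqv E (gres (fpr (carr (triv_ob m))) g) (lift_ob chart (triv_ob m))
      \c fm f s \c comparison_cell gm.
  transitivity (dcell (dep_comp (comparison_arrow m) (fm sigma (fm c q)))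
        (u := section_ob (fo p gm)) (v := triv_ob m) q e1).
    symmetry; exact: (dcell_comp (w'' := desc_ob chart f U) (t := comparison_arrow m)
      (u := section_ob (fo p gm)) (u' := section_ob (fo p m))
      (u'' := triv_ob m) (section_map_subproof q) (comparison_subproof m)
      e1 (esym (fcomp1c _))).
  rewrite (dcell_eq (w' := desc_ob chart f U) (u := section_ob (fo p gm))
    (v := triv_ob m) e1 e2 es) [RHS]fcompA.
  exact: (dcell_comp (w' := desc_ob chart f U) (w'' := desc_ob chart f U)
    (t := desc_act chart E g) (s := comparison_arrow gm) (u := section_ob (fo p gm))
      (u' := triv_ob gm)
    (u'' := triv_ob m) (comparison_subproof gm) e3 e2 (esym (fcompc1 _))).
rewrite /comparison -[LHS]fcompA r.
have eg' : gres (fpr (carr (triv_ob m))) g = gres (fpr (triv_map m)) g.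
  by rewrite triv_map_pr /= (chart_pr chart).
rewrite [LHS]fcompA -(act_natE E eg') -!fcompA; congr (_ \c _).
rewrite [LHS]fcompA -fm_comp; congr (fm f _ \c _).
apply: (lift_uniq chart (r := q)); first exact: (eqv_pr P).
rewrite fm_comp fcompA (act_natP P eg') triv_mapE -fcompA qs.
by rewrite triv_mapE.
Qed.

Lemma section_descends : exists (k : functor N Z) (eta : two_cell (comp_functor k p) f),
  equivariant_cell (comp_equivariant (triv_equivariant G k) P) E eta.
Proof.
exists section_functor, (@TwoCell _ _ _ (comp_functor section_functor p) f
  comparison comparison_pr comparison_nat).
move=> U g m e; rewrite /= fcomp1c; exact: comparison_eqv.
Qed.

End DescentExists.

Lemma descent_exists (C : site) (G : group_presheaf C) (M N : prestack C)
    (A : action G M) (p : functor M N) (P : equivariant A (triv G N) p)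
    (BG : prestack C) (b : functor (pt C) BG)
    (K : equivariant (triv G (pt C)) (triv G BG) b) (c : functor N BG)
    (theta : forall U (m : M U), fhom (fo c (fo p m)) (fo b (pt_ob U)))
    (Z : prestack C) (f : functor M Z) (E : equivariant A (triv G Z) f) :
  is_quotient K -> torsor_chart P K theta -> is_stack Z ->
  exists (k : functor N Z) (eta : two_cell (comp_functor k p) f),
    equivariant_cell (comp_equivariant (triv_equivariant G k) P) E eta.
Proof.
move=> quotK chart stackZ; have [stackBG univ] := quotK.
have [es _] := univ _ (dep_stack c stackBG stackZ).
have [sigma [epsilon epsilon_eqv]] := es _ (desc_eqv chart E).
have [_ ff] := univ _ stackBG.
pose pr := dep_pr c Z.
(* The base of [desc_ob U] is the value of [b] itself, so the base components of [epsilon] compare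
   the projection of [sigma] with the identity along [b]. The universal property with target BG
   extends this to [zeta]. *)
pose cell U (x : pt C U) : fhom (dbase (fo sigma (fo b x))) (fo b x) :=
  match x with tt => dmap (tc epsilon (pt_ob U)) end.
have cell_pr U (x : pt C U) : fpr (cell U x) = idc U.
  by case: x; exact: (tc_pr epsilon (pt_ob U)).
have cell_nat U V (x : pt C U) (y : pt C V) (a : fhom x y) :
    cell V y \c fm (comp_functor (comp_functor pr sigma) b) a
      = fm (comp_functor (id_functor BG) b) a \c cell U x.
  case: x y a => [] [] a.
  exact: (congr1 (fun d => dmap d) (@tc_nat _ _ _ _ _ epsilon U V (pt_ob U) (pt_ob V) a)).
have [|zeta [hz _]] := ff (comp_functor pr sigma) (id_functor BG)
  (@TwoCell _ _ _ (comp_functor (comp_functor pr sigma) b)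
     (comp_functor (id_functor BG) b) cell cell_pr cell_nat).
  move=> U g [] e; rewrite /= !fcomp1c.
  have eg : g = gres (fpr (tc epsilon (pt_ob U))) g by apply/gres_vert/tc_pr.
  have := congr1 (fun d => dmap d) (epsilon_eqv U g (pt_ob U) eg).
  by rewrite /= fcomp1c.
apply: (section_descends epsilon_eqv (zeta := zeta)) => U.
exact: hz.
Qed.

(** * Descent of 2-cells *)

Section ConstantSection.
Variables (C : category) (N B : prestack C) (c : functor N B) (Z : prestack C).
Variable k : functor N Z.

Program Definition comma_forget U (x : B U) : functor (comma c x) N :=
  @Functor C (comma c x) N (fun V u => cob u) (fun V V' u v m => cmap m) _ _ _.
Solve All Obligations with by [].

(** The transpose of [k]: on every fibre, the functor that forgets the structure arrow and applies
    [k]. *)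
Definition const_ob U (x : B U) : dep_ob c Z U :=
  DepOb (comp_functor k (comma_forget x)).

Program Definition const_arrow U V (x : B U) (y : B V) (s : fhom x y) :
    dep_hom (const_ob x) (const_ob y) :=
  @DepHom _ _ _ c Z U V (const_ob x) (const_ob y) s
    (fun V1 V2 u v m e => fm k m) _ _.
Next Obligation. by intros; apply: (fm_pr k). Qed.
Next Obligation.
move=> U V x y s V1 V2 V3 V4 u v u1 v1 m e m1 e1 a a' em /=.
by rewrite -!fm_comp em.
Qed.

Program Definition const_section : functor B (dep_prestack c Z) :=
  @Functor C B (dep_prestack c Z) const_ob const_arrow _ _ _.
Next Obligation. by []. Qed.
Next Obligation. by move=> U x; apply: dep_hom_eq. Qed.
Next Obligation.
move=> U V V' x y z s' s; apply: dep_hom_eq => // V1 V2 u v m e e' /=.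
by rewrite fm_id fcompc1.
Qed.

End ConstantSection.

Section DescentUnique.
Variables (C : site) (G : group_presheaf C) (M N : prestack C).
Variables (A : action G M) (p : functor M N) (P : equivariant A (triv G N) p).
Variables (BG : prestack C) (b : functor (pt C) BG).
Variable K : equivariant (triv G (pt C)) (triv G BG) b.
Variable c : functor N BG.
Variable theta : forall U (m : M U), fhom (fo c (fo p m)) (fo b (pt_ob U)).
Hypothesis quotK : is_quotient K.
Hypothesis chart : torsor_chart P K theta.
Variable Z : prestack C.
Hypothesis stackZ : is_stack Z.
Variables (k k' : functor N Z).
Variable eta : two_cell (comp_functor k p) (comp_functor k' p).
Hypothesis eta_eqv : equivariant_cell (comp_equivariant (triv_equivariant G k) P)
  (comp_equivariant (triv_equivariant G k') P) eta.

Local Notation base U := (fo b (pt_ob U)).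
Local Notation W := (dep_prestack c Z).

Lemma eta_eqvE U (g : G U) (m : M U) :
  tc eta m \c fm k (eqv P g m) = fm k' (eqv P g m) \c tc eta (aob A g m).
Proof.
have e : g = gres (fpr (tc eta m)) g by apply: gres_vert; exact: (tc_pr eta m).
by have := eta_eqv e; rewrite /= !fcomp1c.
Qed.

Section LocalCell.
Variables (U V : C) (u : comma c (base U) V).

Lemma local_cell_subproof : fpr (fm k (lift_map chart u)) = idc V.
Proof. by rewrite fm_pr lift_map_pr. Qed.

(* [eta] transported from [M] to the objects of [N] with trivialised image. *)
Definition local_cell : fhom (fo k (cob u)) (fo k' (cob u)) :=
  fm k' (lift_map chart u) \c tc eta (lift_ob chart u) \c vinv local_cell_subproof.

Lemma local_cell_pr : fpr local_cell = idc V.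
Proof.
rewrite !fpr_comp vinv_pr fm_pr lift_map_pr compc1 comp1c; exact: (tc_pr eta).
Qed.

Lemma local_cellE :
  local_cell \c fm k (lift_map chart u) = fm k' (lift_map chart u) \c tc eta (lift_ob
    chart u).
Proof. by rewrite /local_cell -!fcompA vinvKl fcompc1. Qed.

Lemma local_cell_nat V' (n : N V') (m : fhom (cob u) n) (z : fhom (fo k n) (fo k' n))
    (x : M V') (r : fhom (fo p x) n) (t : fhom (lift_ob chart u) x) :
  z \c fm k r = fm k' r \c tc eta x -> r \c fm p t = m \c lift_map chart u ->
  z \c fm k m = fm k' m \c local_cell.
Proof.
move=> hz et; apply: (vepi local_cell_subproof).
rewrite -[LHS]fcompA -[RHS]fcompA local_cellE -fm_comp -et [in RHS]fcompA -fm_comp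
  -et !fm_comp.
have n1 : tc eta x \c fm k (fm p t) = fm k' (fm p t) \c tc eta (lift_ob chart u).
  exact: (tc_nat eta t).
by rewrite fcompA hz -!fcompA n1.
Qed.

End LocalCell.

Lemma local_cell_hom U U' (h : hom U U') V V' (u : comma c (base U) V)
    (v : comma c (base U') V') (m : fhom (cob u) (cob v)) :
  carr v \c fm c m = pt_map b h \c carr u -> local_cell v \c fm k m = fm k' m \c
    local_cell u.
Proof.
move=> e; have [t et] := hom_lift chart e.
exact: local_cell_nat (local_cellE v) et.
Qed.

(** Here the equivariance of [eta] enters: the local cell at [v] commutes with [lift_map] even after
    a translation by the group. *)
Lemma local_cell_act U (g : G U) V V' (u : comma c (base U) V)
    (v : comma c (base U) V') (m : fhom (cob u) (cob v)) :
  carr v \c fm c m = eqv K g (pt_ob U) \c carr u ->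
  local_cell v \c fm k m = fm k' m \c local_cell u.
Proof.
move=> e; have [t et] := act_lift chart e.
apply: local_cell_nat et.
by rewrite !fm_comp fcompA local_cellE -!fcompA eta_eqvE.
Qed.

Lemma local_cell_triv U (m : M U) : local_cell (triv_ob theta m) = tc eta m.
Proof.
have [t et] := triv_lift chart m.
apply: (vepi (local_cell_subproof (triv_ob theta m))); rewrite local_cellE -et.
by rewrite -[LHS](tc_nat eta t).
Qed.

Program Definition local_cell_arrow U :
    dep_hom (const_ob c k (base U)) (const_ob c k' (base U)) :=
  @DepHom _ _ _ c Z U U (const_ob c k (base U)) (const_ob c k' (base U)) (fid _)
    (fun V1 V2 u v m e => local_cell v \c fm k m) _ _.
Next Obligation.
move=> U V1 V2 u v m e; apply: etrans (fpr_comp _ _) _.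
by rewrite local_cell_pr comp1c; exact: (fm_pr k).
Qed.
Next Obligation.
move=> U V1 V2 V3 V4 u v u1 v1 m e m1 e1 a a' em /=.
have ea : carr v1 \c fm c (cmap a') = pt_map b (idc U) \c carr v.
  by rewrite pt_map_id fcomp1c cmapE.
by rewrite fcompA -(local_cell_hom ea) -!fcompA -!fm_comp em.
Qed.

(** A 2-cell from [k] to [k'] is an arrow over BG between their constant sections. Such an arrow is
    given along [b] by the local cells, extended by the universal property with target W, and
    evaluated at tautological points. *)
Lemma descent_cell : exists zeta : two_cell k k', forall U (m : M U),
  tc zeta (fo p m) = tc eta m.
Proof.
have [stackBG univ] := quotK.
have [_ ffW] := univ _ (dep_stack c stackBG stackZ).
have [_ ffB] := univ _ stackBG.
pose cell U (x : pt C U) : @fhom _ W _ _ (const_ob c k (fo b x)) (const_ob c k' (fo b x)) :=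
  match x with tt => local_cell_arrow U end.
have cell_pr U (x : pt C U) : fpr (cell U x) = idc U by case: x; exact: fpr_id.
have cell_nat U V (x : pt C U) (y : pt C V) (a : fhom x y) :
    cell V y \c fm (comp_functor (const_section c k) b) a
      = fm (comp_functor (const_section c k') b) a \c cell U x.
  case: x y a => [] [] h.
  apply: (@dep_hom_eq _ _ _ _ _ _ _ (const_ob c k (base U)) (const_ob c k' (base V))).
    by rewrite /= fcomp1c fcompc1.
  move=> V1 V2 u v m e e' /=; rewrite !fm_id !fcompc1.
  have ea : carr (post_ob (fid (base U)) u) \c fm c (fid (cob u)) = pt_map b (idc U)
    \c carr u.
    by rewrite pt_map_id fm_id /= fcompc1.
  have := local_cell_hom ea; rewrite !fm_id fcomp1c fcompc1 => ->.
  apply: (local_cell_hom (h := h)); by rewrite e /= fcomp1c.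
have [|xi [hxi _]] := ffW (const_section c k) (const_section c k')
  (@TwoCell _ _ _ (comp_functor (const_section c k) b)
     (comp_functor (const_section c k') b) cell cell_pr cell_nat).
  move=> U g [] e; rewrite -![comp_equivariant _ _ _ _ _]/(fid _ \c _) !(@fcomp1c _ W).
  apply: (@dep_hom_eq _ _ _ _ _ _ _ (const_ob c k (base U)) (const_ob c k' (base U))).
    by rewrite /= fcomp1c fcompc1.
  move=> V1 V2 u v m e1 e2 /=; rewrite !fm_id !fcompc1.
  have ea : carr (post_ob (fid (base U)) u) \c fm c (fid (cob u)) = pt_map b (idc U)
    \c carr u.
    by rewrite pt_map_id fm_id /= fcompc1.
  have := local_cell_hom ea; rewrite !fm_id fcomp1c fcompc1 => ->.
  by apply: (local_cell_act (g := g)); rewrite e1 /= fcomp1c.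
(* The extension [xi] might move the base point. Its base components form a 2-cell of the identity
   of BG which is trivial along [b], hence trivial by the uniqueness clause. *)
have dxi U (x : BG U) : dmap (tc xi x) = fid x.
  pose i := id_functor BG.
  pose d1 : two_cell i i := @TwoCell _ _ _ i i (fun U x => fid x)
    (fun U x => fpr_id x) (fun _ _ x y a => etrans (fcomp1c a) (esym (fcompc1 a))).
  pose d2 : two_cell i i := @TwoCell _ _ _ i i (fun U x => dmap (tc xi x))
    (fun U x => tc_pr xi x) (fun _ _ x y a => congr1 (fun d => dmap d) (tc_nat xi a)).
  pose d0 : two_cell (comp_functor i b) (comp_functor i b) :=
    @TwoCell _ _ _ (comp_functor i b) (comp_functor i b) (fun U x => fid _)
    (fun U x => fpr_id _) (fun _ _ x y a => etrans (fcomp1c _) (esym (fcompc1 _))).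
  have [|z [_ uz]] := ffB i i d0.
    by move=> V g y e; rewrite /= !fcomp1c fcompc1.
  have e1 := uz d1 (fun _ _ => erefl) U x.
  have e2 : tc d2 x = tc z x.
    by apply: uz => V [] /=; rewrite (hxi V (pt_ob V)).
  by rewrite -[LHS]/(tc d2 x) e2 -e1.
pose one U (n : N U) : comma c (fo c n) U := CommaOb (fid (fo c n)).
have e_one U (n : N U) : carr (one U n) \c fm c (fid n) = dmap (tc xi (fo c n)) \c
  carr (one U n).
  by rewrite dxi fm_id.
pose z U (n : N U) : fhom (fo k n) (fo k' n) :=
  dcell (tc xi (fo c n)) (u := one U n) (v := one U n) (fid n) (e_one U n).
(* Naturality of [xi] along [s] expresses its cell over any other base point [y] through the value
   [z] at the tautological point; the identity arrow gives naturality of [z], and [theta m] its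
   value on [p m]. *)
have z_cell U (n : N U) V (y : BG V) (s : fhom (fo c n) y) V' (v : comma c y V')
    (m : fhom n (cob v)) (e : carr v \c fm c m = s)
    (e' : carr v \c fm c m = dmap (tc xi y) \c carr (post_ob s (one U n))) :
    dcell (tc xi y) (u := post_ob s (one U n)) m e' = fm k' m \c z U n.
  have nat : dep_comp (tc xi y) (const_arrow c k s)
      = dep_comp (const_arrow c k' s) (tc xi (fo c n)) := tc_nat xi s.
  have e0 : carr (post_ob s (one U n)) \c fm c (fid n) = s \c carr (one U n).
    by rewrite /= fm_id fcompc1.
  have e1 : carr v \c fm c m = dmap (dep_comp (tc xi y) (const_arrow c k s)) \c carr
    (one U n).
    by rewrite /= dxi fcomp1c fcompc1.
  have e2 : carr v \c fm c m
      = dmap (dep_comp (const_arrow c k' s) (tc xi (fo c n))) \c carr (one U n).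
    by rewrite -nat.
  have e3 : carr v \c fm c m = dmap (const_arrow c k' s) \c carr (one U n).
    by rewrite /= fcompc1.
  have c1 := dcell_comp (w := const_ob c k (fo c n)) (w' := const_ob c k y)
    (w'' := const_ob c k' y) (t := tc xi y) (s := const_arrow c k s)
    (u := one U n) (u' := post_ob s (one U n)) (u'' := v) e0 e' e1 (esym (fcompc1 _)).
  have c2 := dcell_comp (w := const_ob c k (fo c n)) (w' := const_ob c k' (fo c n))
    (w'' := const_ob c k' y) (t := const_arrow c k' s) (s := tc xi (fo c n))
    (u := one U n) (u' := one U n) (u'' := v) (e_one U n) e3 e2 (esym (fcompc1 _)).
  have c3 := dcell_eq (w := const_ob c k (fo c n)) (w' := const_ob c k' y)
    (u := one U n) (v := v) e1 e2 nat.
  have c4 := etrans (esym c1) (etrans c3 c2).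
  rewrite -[RHS]c4 -[LHS]fcompc1; congr (_ \c _); symmetry; exact: (fm_id k).
have z_pr U (n : N U) : fpr (z U n) = idc U.
  apply: etrans (dcell_pr (w := const_ob c k (fo c n)) (w' := const_ob c k' (fo c n))
    (u := one U n) (v := one U n) (e_one U n)) _.
  exact: fpr_id.
have z_nat U V (n : N U) (n' : N V) (m : fhom n n') :
    z V n' \c fm k m = fm k' m \c z U n.
  have e : carr (one V n') \c fm c m = fm c m by rewrite fcomp1c.
  have e' : carr (one V n') \c fm c m
      = dmap (tc xi (fo c n')) \c carr (post_ob (fm c m) (one U n)).
    by rewrite dxi /= fcompc1.
  rewrite -(z_cell U n V (fo c n') (fm c m) V (one V n') m e e').
  pose a : @fhom _ (comma c (fo c n')) _ _ (post_ob (fm c m) (one U n)) (one V n') :=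
    @CommaHom _ _ _ _ _ _ _ _ (post_ob (fm c m) (one U n)) (one V n') m
      (etrans e (esym (fcompc1 _))).
  have e1 : carr (one V n') \c fm c (fid n' \c cmap a)
      = dmap (tc xi (fo c n')) \c carr (post_ob (fm c m) (one U n)).
    by rewrite fcomp1c.
  apply: etrans (dcellr (w := const_ob c k (fo c n')) (w' := const_ob c k' (fo c n'))
    (u := post_ob (fm c m) (one U n)) (u1 := one V n') (v := one V n') (e_one V n')
    (a := a) e1) _.
  apply: (dcell_congr (w := const_ob c k (fo c n')) (w' := const_ob c k' (fo c n'))
    (u := post_ob (fm c m) (one U n)) (v := one V n')).
  exact: fcomp1c.
exists (@TwoCell _ _ _ k k' z z_pr z_nat) => U m /=.
have e : carr (triv_ob theta m) \c fm c (fid (fo p m)) = theta m.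
  by rewrite fm_id fcompc1.
have e' : carr (triv_ob theta m) \c fm c (fid (fo p m))
    = dmap (tc xi (base U)) \c carr (post_ob (theta m) (one U (fo p m))).
  by rewrite dxi e /= fcomp1c fcompc1.
have := z_cell U (fo p m) U (base U) (theta m) U (triv_ob theta m) (fid _) e e'.
rewrite fm_id fcomp1c => <-.
have e2 : carr (triv_ob theta m) \c fm c (fid (fo p m))
    = dmap (local_cell_arrow U) \c carr (post_ob (theta m) (one U (fo p m))).
  by rewrite e /= fcomp1c fcompc1.
rewrite (dcell_eq (w := const_ob c k (base U)) (w' := const_ob c k' (base U))
  (u := post_ob (theta m) (one U (fo p m))) (v := triv_ob theta m) e' e2 (hxi U (pt_ob U))).
by rewrite /= fm_id fcompc1 local_cell_triv.
Qed.

End DescentUnique.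

(** * Quotients in two steps *)

Section GroupProduct.
Variables (C : category) (H : group_presheaf C).

(** The condition [gmapE] is the premise of [amap], so an action is literally a functor out of this
    product. *)
Record gprod_hom (Y : prestack C) U V (x : H U * Y U) (y : H V * Y V) := GprodHom {
  gmap : fhom x.2 y.2;
  gmapE : x.1 = gres (fpr gmap) y.1
}.

Lemma gprod_hom_eq (Y : prestack C) U V (x : H U * Y U) (y : H V * Y V)
  (a b : gprod_hom x y) : gmap a = gmap b -> a = b.
Proof.
by case: a b => [a ea] [b eb] /= e; subst; congr GprodHom; apply: Prop_irrelevance.
Qed.

Lemma gprod_id_subproof (Y : prestack C) U (x : H U * Y U) :
  x.1 = gres (fpr (fid x.2)) x.1.
Proof. by rewrite fpr_id gres_id. Qed.

Lemma gprod_comp_subproof (Y : prestack C) U V W (x : H U * Y U) (y : H V * Y V)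
  (z : H W * Y W) (b : gprod_hom y z) (a : gprod_hom x y) :
  x.1 = gres (fpr (gmap b \c gmap a)) z.1.
Proof. by rewrite fpr_comp gres_comp -gmapE -gmapE. Qed.

Program Definition gprod (Y : prestack C) : prestack C :=
  @Prestack C (fun U => (H U * Y U)%type) (fun U V x y => gprod_hom x y)
    (fun _ _ _ _ a => fpr (gmap a)) (fun U x => GprodHom (gprod_id_subproof x))
    (fun _ _ _ _ _ _ b a => GprodHom (gprod_comp_subproof b a)) _ _ _ _ _ _ _.
Next Obligation. by intros; apply: fpr_id. Qed.
Next Obligation. by intros; apply: fpr_comp. Qed.
Next Obligation. by intros; apply: gprod_hom_eq; apply: fcompA. Qed.
Next Obligation. by intros; apply: gprod_hom_eq; apply: fcomp1c. Qed.
Next Obligation. by intros; apply: gprod_hom_eq; apply: fcompc1. Qed.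
Next Obligation.
move=> Y U V f [h y].
have e : gres f h = gres (fpr (pullback_map f y)) h by rewrite pullback_map_pr.
exists (gres f h, pullback f y).
exists (@GprodHom Y U V (gres f h, pullback f y) (h, y) (pullback_map f y) e).
exact: pullback_map_pr.
Qed.
Next Obligation.
move=> Y U V W x y z a b h /= e.
have [d [[dp de] ud]] := fcart e.
have ed : z.1 = gres (fpr d) x.1.
  by rewrite (gmapE a) -gres_comp dp e -gmapE.
exists (GprodHom ed); split; first by split=> //; apply: gprod_hom_eq.
by move=> d' [d'p d'e]; apply: gprod_hom_eq; apply: ud; rewrite -d'e.
Qed.

Program Definition gprod_snd (Y : prestack C) : functor (gprod Y) Y :=
  @Functor C (gprod Y) Y (fun U x => x.2) (fun U V x y a => gmap a) _ _ _.
Solve All Obligations with by [].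

Lemma gprod_functor_subproof (X Y : prestack C) (p : functor X Y) U V
    (x : gprod X U) (y : gprod X V) (a : fhom x y) :
  x.1 = gres (fpr (fm p (gmap a))) y.1.
Proof. by rewrite fm_pr; exact: gmapE. Qed.

Program Definition gprod_functor (X Y : prestack C) (p : functor X Y) :
    functor (gprod X) (gprod Y) :=
  @Functor C (gprod X) (gprod Y) (fun U x => (x.1, fo p x.2))
    (fun U V x y a => @GprodHom Y U V (x.1, fo p x.2) (y.1, fo p y.2)
       (fm p (gmap a)) (gprod_functor_subproof p a)) _ _ _.
Next Obligation. by intros; apply: (fm_pr p). Qed.
Next Obligation. by intros; apply: gprod_hom_eq; apply: fm_id. Qed.
Next Obligation. by intros; apply: gprod_hom_eq; apply: fm_comp. Qed.

Program Definition act_functor (Y : prestack C) (B : action H Y) :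
    functor (gprod Y) Y :=
  @Functor C (gprod Y) Y (fun U x => aob B x.1 x.2)
    (fun U V x y a => amap B (gmap a) (gmapE a)) _ _ _.
Next Obligation. by intros; apply: amap_pr. Qed.
Next Obligation. by intros; apply: amap_id. Qed.
Next Obligation. by intros; apply: amap_comp. Qed.

Definition gprod_vert (Y : prestack C) U (h : H U) (x y : Y U) (a : fhom x y)
    (e : fpr a = idc U) : @fhom _ (gprod Y) U U (h, x) (h, y) :=
  @GprodHom Y U U (h, x) (h, y) a (gres_vert h e).

Variable G : group_presheaf C.

Program Definition gprod_action (M : prestack C) (A : action G M) :
    action G (gprod M) :=
  @Action C G (gprod M) (fun U g x => (x.1, aob A g x.2))
    (fun U V x y g h a e => @GprodHom M U V (x.1, aob A g x.2) (y.1, aob A h y.2)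
       (amap A (gmap a) e) _) _ _ _
    (fun U g h x => gprod_vert x.1 (aassoc_pr A g h x.2)) _ _
    (fun U x => @GprodHom M U U (x.1, aob A 1%g x.2) x (aunit A x.2)
       (gres_vert x.1 (aunit_pr A x.2))) _ _ _ _ _.
Next Obligation.
by move=> M A U V x y g h a e; rewrite /= amap_pr; exact: (gmapE a).
Qed.
Next Obligation. by intros; apply: amap_pr. Qed.
Next Obligation. by intros; apply: gprod_hom_eq; apply: amap_id. Qed.
Next Obligation. by intros; apply: gprod_hom_eq; apply: amap_comp. Qed.
Next Obligation. by intros; apply: aassoc_pr. Qed.
Next Obligation. by intros; apply: gprod_hom_eq; apply: aassoc_nat. Qed.
Next Obligation. by move=> M A U x; exact: (aunit_pr A x.2). Qed.
Next Obligation. by intros; apply: gprod_hom_eq; apply: aunit_nat. Qed.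
Next Obligation. by intros; apply: gprod_hom_eq; apply: apentagon. Qed.
Next Obligation. by intros; apply: gprod_hom_eq; apply: atriangle_l. Qed.
Next Obligation. by intros; apply: gprod_hom_eq; apply: atriangle_r. Qed.

Program Definition gprod_equivariant (M N : prestack C) (A : action G M)
    (p : functor M N) (P : equivariant A (triv G N) p) :
    equivariant (gprod_action A) (triv G (gprod N)) (gprod_functor p) :=
  @Equivariant C G (gprod M) (gprod N) (gprod_action A) (triv G (gprod N))
    (gprod_functor p) (fun U g x => gprod_vert x.1 (eqv_pr P g x.2)) _ _ _ _.
Next Obligation. by intros; apply: (eqv_pr P). Qed.
Next Obligation.
move=> M N A p P U V x y g h a e e'.
by apply: gprod_hom_eq; apply: (@eqv_nat _ _ _ _ _ _ _ P _ _ _ _ _ _ (gmap a) e e').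
Qed.
Next Obligation.
move=> M N A p P U g h x e.
by apply: gprod_hom_eq; apply: (@eqv_assoc _ _ _ _ _ _ _ P _ g h x.2 e).
Qed.
Next Obligation.
by move=> M N A p P U x; apply: gprod_hom_eq; apply: (@eqv_unit _ _ _ _ _ _ _ P).
Qed.

(** The square for H x M -> H x N is the original one pulled back along the projection to [N]: same
    BG, same trivialisations. *)
Lemma gprod_chart (M N : prestack C) (A : action G M) (p : functor M N)
    (P : equivariant A (triv G N) p) (BG : prestack C) (b : functor (pt C) BG)
    (K : equivariant (triv G (pt C)) (triv G BG) b) (c : functor N BG)
    (theta : forall U (m : M U), fhom (fo c (fo p m)) (fo b (pt_ob U))) :
  torsor_chart P K theta ->
  torsor_chart (c := comp_functor c (gprod_snd N)) (gprod_equivariant P) K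
    (fun U x => theta U x.2).
Proof.
move=> chart; split.
- by move=> U x; apply: (chart_pr chart).
- by move=> U V x y a; apply: (chart_nat chart).
- by move=> U g x; apply: (chart_eqv chart).
- move=> U V [h n] a; have [m [e [ep ee]]] := chart_lift chart a.
  exists (h, m), (@gprod_vert N V h _ _ e ep); split=> //.
- move=> U V x y d ed; have [t et] := chart_full chart ed.
  have e : x.1 = gres (fpr t) y.1 by rewrite -(fm_pr p) et; exact: (gmapE d).
  by exists (GprodHom e); apply: gprod_hom_eq.
- move=> U V x y t t' e; apply: gprod_hom_eq; apply: (chart_faithful chart).
  exact: (congr1 (fun d => gmap d) e).
Qed.

End GroupProduct.

(** * Invariant maps and quotients by two groups *)

Section Invariant.
Variables (C : category) (G : group_presheaf C) (M Z : prestack C).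
Variable A : action G M.

Lemma invariant_cellP (f f' : functor M Z) (E : equivariant A (triv G Z) f)
    (E' : equivariant A (triv G Z) f') (eta : two_cell f f') :
  equivariant_cell E E' eta <->
  forall U (g : G U) (x : M U),
    tc eta x \c eqv E g x = eqv E' g x \c tc eta (aob A g x).
Proof.
split=> h U g x; last by move=> e; exact: h.
have e : g = gres (fpr (tc eta x)) g by apply/gres_vert/tc_pr.
exact: (h U g x e).
Qed.

Lemma invariant_eqv_nat (f : functor M Z) (E : equivariant A (triv G Z) f) U V
    (x : M U) (y : M V) (g : G U) (h : G V) (a : fhom x y) (e : g = gres (fpr a) h) :
  eqv E h y \c fm f (amap A a e) = fm f a \c eqv E g x.
Proof.
have e' : g = gres (fpr (fm f a)) h by rewrite fm_pr.
exact: (eqv_nat E e e').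
Qed.

Lemma invariant_eqv_assoc (f : functor M Z) (E : equivariant A (triv G Z) f) U
    (g h : G U) (x : M U) :
  eqv E (g * h)%g x \c fm f (aassoc A g h x) = eqv E h x \c eqv E g (aob A h x).
Proof.
have e : g = gres (fpr (eqv E h x)) g by apply/gres_vert/eqv_pr.
by have := @eqv_assoc _ _ _ _ _ _ _ E U g h x e; rewrite /= fcomp1c.
Qed.

Lemma invariant_eqv_unit (f : functor M Z) (E : equivariant A (triv G Z) f) U
    (x : M U) : eqv E 1%g x = fm f (aunit A x).
Proof. by have := eqv_unit E x; rewrite /= fcomp1c. Qed.

End Invariant.

Section BiInvariant.
Variables (C : site) (G G' : group_presheaf C) (M : prestack C).
Variables (A : action G M) (A' : action G' M).
Variable cm : forall U (g : G U) (g' : G' U) (x : M U),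
  fhom (aob A g (aob A' g' x)) (aob A' g' (aob A g x)).

(** The commutation [cm] is a bare family of arrows rather than a [commuting] structure, so that its
    inverse with the two groups exchanged is again an instance. *)
Definition bi_invariant (Z : prestack C) (f : functor M Z)
    (E : equivariant A (triv G Z) f) (E' : equivariant A' (triv G' Z) f) : Prop :=
  forall U (g : G U) (g' : G' U) (x : M U),
    eqv E' g' x \c eqv E g (aob A' g' x)
      = eqv E g x \c eqv E' g' (aob A g x) \c fm f (cm g g' x).

(* [r] exhibits [Q] as the stacky quotient of [M] by both groups; only the
   existence of 2-cells is recorded, their uniqueness not being needed to
   compare two such quotients. *)
Record is_biquotient (Q : prestack C) (r : functor M Q)
    (R : equivariant A (triv G Q) r) (R' : equivariant A' (triv G' Q) r) : Prop := {
  biquotient_stack : is_stack Q;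
  biquotient_inv : bi_invariant R R';
  biquotient_exists : forall (Z : prestack C) (f : functor M Z)
    (E : equivariant A (triv G Z) f) (E' : equivariant A' (triv G' Z) f),
    is_stack Z -> bi_invariant E E' ->
    exists (k : functor Q Z) (eta : two_cell (comp_functor k r) f),
      equivariant_cell (comp_equivariant (triv_equivariant G k) R) E eta /\
      equivariant_cell (comp_equivariant (triv_equivariant G' k) R') E' eta;
  biquotient_cell : forall (Z : prestack C) (k k' : functor Q Z)
    (eta : two_cell (comp_functor k r) (comp_functor k' r)),
    is_stack Z ->
    equivariant_cell (comp_equivariant (triv_equivariant G k) R)
      (comp_equivariant (triv_equivariant G k') R) eta ->
    equivariant_cell (comp_equivariant (triv_equivariant G' k) R')
      (comp_equivariant (triv_equivariant G' k') R') eta ->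
    inhabited (two_cell k k')
}.

(** The composite of [eps] with the image of [eta] compares [l k r] with [r] compatibly with both
    groups, and the biquotient turns it into a 2-cell from [l k] to the identity. *)
Lemma biquotient_back (Q Q' : prestack C) (r : functor M Q) (r' : functor M Q')
    (R : equivariant A (triv G Q) r) (R' : equivariant A' (triv G' Q) r)
    (k : functor Q Q') (l : functor Q' Q)
    (S : equivariant A (triv G Q') r') (S' : equivariant A' (triv G' Q') r')
    (eta : two_cell (comp_functor k r) r') (eps : two_cell (comp_functor l r') r) :
  is_biquotient R R' ->
  equivariant_cell (comp_equivariant (triv_equivariant G k) R) S eta ->
  equivariant_cell (comp_equivariant (triv_equivariant G' k) R') S' eta ->
  equivariant_cell (comp_equivariant (triv_equivariant G l) S) R eps ->
  equivariant_cell (comp_equivariant (triv_equivariant G' l) S') R' eps ->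
  inhabited (two_cell (comp_functor l k) (id_functor Q)).
Proof.
move=> biQ /invariant_cellP h1 /invariant_cellP h2 /invariant_cellP h3 /invariant_cellP h4.
have tp U (x : M U) : fpr (tc eps x \c fm l (tc eta x)) = idc U.
  by rewrite fpr_comp fm_pr (tc_pr eps) (tc_pr eta) compc1.
have tn U V (x : M U) (y : M V) (a : fhom x y) :
    (tc eps y \c fm l (tc eta y)) \c fm (comp_functor (comp_functor l k) r) a
      = fm (comp_functor (id_functor Q) r) a \c tc eps x \c fm l (tc eta x).
  have e1 : tc eta y \c fm k (fm r a) = fm r' a \c tc eta x := tc_nat eta a.
  have e2 : tc eps y \c fm l (fm r' a) = fm r a \c tc eps x := tc_nat eps a.
  by rewrite -[LHS]fcompA /= -fm_comp e1 fm_comp !fcompA e2.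
apply: (biquotient_cell biQ
  (eta := @TwoCell _ _ _ (comp_functor (comp_functor l k) r)
    (comp_functor (id_functor Q) r) _ tp tn)).
- exact: biquotient_stack biQ.
- apply/invariant_cellP => U g x /=; rewrite !fcomp1c.
  have e1 := h1 U g x; have e3 := h3 U g x; rewrite /= fcomp1c in e1; rewrite /=
    fcomp1c in e3.
  by rewrite -fcompA -fm_comp e1 fm_comp !fcompA e3.
- apply/invariant_cellP => U g x /=; rewrite !fcomp1c.
  have e1 := h2 U g x; have e3 := h4 U g x; rewrite /= fcomp1c in e1; rewrite /=
    fcomp1c in e3.
  by rewrite -fcompA -fm_comp e1 fm_comp !fcompA e3.
Qed.

Lemma biquotient_equivalent (Q Q' : prestack C) (r : functor M Q)
    (r' : functor M Q') (R : equivariant A (triv G Q) r)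
    (R' : equivariant A' (triv G' Q) r) (S : equivariant A (triv G Q') r')
    (S' : equivariant A' (triv G' Q') r') :
  is_biquotient R R' -> is_biquotient S S' -> equivalent Q Q'.
Proof.
move=> biQ biQ'.
have [k [eta [h1 h2]]] :=
  biquotient_exists biQ (biquotient_stack biQ') (biquotient_inv biQ').
have [l [eps [h3 h4]]] :=
  biquotient_exists biQ' (biquotient_stack biQ) (biquotient_inv biQ).
exists k, l; split.
  exact: (biquotient_back biQ h1 h2 h3 h4).
exact: (biquotient_back biQ' h3 h4 h1 h2).
Qed.

End BiInvariant.

(** * The quotient of a torsor's base by the residual action is a biquotient *)

Section TorsorBiquotient.
Variables (C : site) (G G' : group_presheaf C) (M N : prestack C).
Variables (A : action G M) (A' : action G' M).
Variable cm : forall U (g : G U) (g' : G' U) (x : M U),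
  fhom (aob A g (aob A' g' x)) (aob A' g' (aob A g x)).
Hypothesis cm_pr : forall U (g : G U) (g' : G' U) (x : M U),
  fpr (cm g g' x) = idc U.
Variables (p : functor M N) (P : equivariant A (triv G N) p).
Variables (BG : prestack C) (b : functor (pt C) BG).
Variable K : equivariant (triv G (pt C)) (triv G BG) b.
Variable c : functor N BG.
Variable theta : forall U (m : M U), fhom (fo c (fo p m)) (fo b (pt_ob U)).
Hypothesis quotK : is_quotient K.
Hypothesis chart : torsor_chart P K theta.
Variables (B' : action G' N) (P' : equivariant A' B' p).
Hypothesis residual : forall U (g : G U) (g' : G' U) (x : M U)
  (e : g' = gres (fpr (eqv P g x)) g'),
  eqv P' g' x \c eqv P g (aob A' g' x)
    = amap B' (eqv P g x) e \c eqv P' g' (aob A g x) \c fm p (cm g g' x).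
Variables (Q : prestack C) (q : functor N Q) (L : equivariant B' (triv G' Q) q).
Hypothesis quotL : is_quotient L.

Let surj U (n : N U) : locally_in_image p n.
Proof. exact: chart_locally_surjective quotK chart. Qed.

Section Exists.
Variable Z : prestack C.
Hypothesis stackZ : is_stack Z.
Variables (f : functor M Z) (E : equivariant A (triv G Z) f).
Variable E' : equivariant A' (triv G' Z) f.
Hypothesis biE : bi_invariant cm E E'.
Variables (k : functor N Z) (eta : two_cell (comp_functor k p) f).
Hypothesis eta_eqv : forall U (g : G U) (m : M U),
  tc eta m \c fm k (eqv P g m) = eqv E g m \c tc eta (aob A g m).

Let eta_pr U (m : M U) : fpr (tc eta m) = idc U.
Proof. exact: (tc_pr eta). Qed.

Let eta_nat U V (m : M U) (m' : M V) (a : fhom m m') :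
  tc eta m' \c fm k (fm p a) = fm f a \c tc eta m.
Proof. exact: (tc_nat eta a). Qed.

(** The G'-invariance of [f], conjugated by [eta] into one of [k p]. *)
Definition pull_act U (h : G' U) (m : M U) :
    fhom (fo k (fo p (aob A' h m))) (fo k (fo p m)) :=
  vinv (eta_pr m) \c eqv E' h m \c tc eta (aob A' h m).

Lemma pull_actE U (h : G' U) (m : M U) :
  tc eta m \c pull_act h m = eqv E' h m \c tc eta (aob A' h m).
Proof. by rewrite fcompA vinvK fcomp1c. Qed.

Lemma pull_act_pr U (h : G' U) (m : M U) : fpr (pull_act h m) = idc U.
Proof. by rewrite !fpr_comp vinv_pr (eqv_pr E') (eta_pr (aob A' h m)) !compc1. Qed.

Lemma pull_act_nat U V (m : M U) (m' : M V) (h : G' U) (h' : G' V)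
    (a : fhom m m') (e : h = gres (fpr a) h') :
  pull_act h' m' \c fm k (fm p (amap A' a e)) = fm k (fm p a) \c pull_act h m.
Proof.
apply: (fcancel (a := tc eta m')).
  by rewrite [LHS]fpr_comp [RHS]fpr_comp !pull_act_pr !fm_pr amap_pr compc1 comp1c.
rewrite fcompA pull_actE -fcompA eta_nat fcompA invariant_eqv_nat.
by rewrite [RHS]fcompA eta_nat -!fcompA pull_actE.
Qed.

Lemma descend_subproof U (x : gprod G' M U) :
  fpr (fm k (eqv P' x.1 x.2)) = idc U.
Proof. by rewrite fm_pr (eqv_pr P'). Qed.

(** The same datum rewritten, by the equivariance of [p], in terms of the residual action on [N]: a
    2-cell over G' x M between functors that come from G' x N, ready for descent. *)
Definition descend_act U (x : gprod G' M U) :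
    fhom (fo k (aob B' x.1 (fo p x.2))) (fo k (fo p x.2)) :=
  pull_act x.1 x.2 \c vinv (descend_subproof x).

Lemma descend_actE U (h : G' U) (m : M U) :
  descend_act (h, m) \c fm k (eqv P' h m) = pull_act h m.
Proof.
rewrite /descend_act -fcompA.
by rewrite (vinvKl (descend_subproof ((h, m) : gprod G' M U))) fcompc1.
Qed.

Lemma descend_act_pr U (x : gprod G' M U) : fpr (descend_act x) = idc U.
Proof. by rewrite fpr_comp pull_act_pr vinv_pr compc1. Qed.

Lemma descend_act_nat U V (x : gprod G' M U) (y : gprod G' M V) (a : fhom x y) :
  descend_act y \c fm (comp_functor (comp_functor k (act_functor B')) (gprod_functor
    G' p)) a
    = fm (comp_functor (comp_functor k (gprod_snd G' N)) (gprod_functor G' p)) a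
      \c descend_act x.
Proof.
case: x y a => [h m] [h' m'] [a e] /=; rewrite /= in a e *.
apply: (vepi (descend_subproof ((h, m) : gprod G' M U))).
rewrite -[LHS]fcompA -[RHS]fcompA descend_actE /= -fm_comp.
rewrite -(eqv_nat P' e) fm_comp fcompA descend_actE.
exact: pull_act_nat.
Qed.

(** The two coherence conditions meet here: [residual] moves the G-invariance of [p] past the
    G'-action on [N], [biE] does so for [f], and both involve the same [cm], which therefore
    cancels. *)
Lemma descend_act_eqv U (g : G U) (h : G' U) (m : M U)
    (e : h = gres (fpr (eqv P g m)) h) :
  descend_act (h, m) \c fm k (amap B' (eqv P g m) e)
    = fm k (eqv P g m) \c descend_act (h, aob A g m).
Proof.
apply: (vepi (descend_subproof ((h, aob A g m) : gprod G' M U))).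
rewrite -[RHS]fcompA descend_actE.
apply: (@vepi _ _ _ _ _ _ _ (fm k (fm p (cm g h m)))); first by rewrite !fm_pr cm_pr.
rewrite /= -[LHS]fcompA -[LHS]fcompA -!fm_comp -residual fm_comp fcompA descend_actE.
apply: (fcancel (a := tc eta m)).
  rewrite [LHS]fpr_comp [RHS]fpr_comp [X in _ = X \; _]fpr_comp.
  by rewrite !pull_act_pr !fm_pr !(eqv_pr P) cm_pr !comp1c.
have r : tc eta m \c fm k (eqv P g m) \c pull_act h (aob A g m)
    = eqv E g m \c eqv E' h (aob A g m) \c tc eta (aob A' h (aob A g m)).
  by rewrite fcompA eta_eqv -fcompA pull_actE.
rewrite [RHS]fcompA r -[RHS]fcompA -[X in _ = _ \c X]fcompA eta_nat.
rewrite [LHS]fcompA pull_actE -[LHS]fcompA eta_eqv.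
by rewrite [LHS]fcompA biE -!fcompA.
Qed.

Variable lam : two_cell (comp_functor k (act_functor B')) (comp_functor k (gprod_snd G' N)).
Hypothesis lamE : forall U (h : G' U) (m : M U),
  @tc _ _ _ _ _ lam U (h, fo p m) = descend_act (h, m).

Let lm U (h : G' U) (n : N U) : fhom (fo k (aob B' h n)) (fo k n) :=
  @tc _ _ _ _ _ lam U (h, n).

Lemma lam_pr U (h : G' U) (n : N U) : fpr (lm h n) = idc U.
Proof. exact: (@tc_pr _ _ _ _ _ lam U (h, n)). Qed.

Lemma lam_nat U V (n : N U) (n' : N V) (h : G' U) (h' : G' V) (a : fhom n n')
    (e : h = gres (fpr a) h') :
  lm h' n' \c fm k (amap B' a e) = fm k a \c lm h n.
Proof.
exact: (@tc_nat _ _ _ _ _ lam U V (h, n) (h', n') (@GprodHom _ _ _ _ _ (h, n) (h',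
  n') a e)).
Qed.

Lemma lam_actE U (h : G' U) (m : M U) :
  lm h (fo p m) \c fm k (eqv P' h m) = pull_act h m.
Proof. by rewrite /lm lamE descend_actE. Qed.

Let sepZ : separated Z. Proof. by have [] := (stackP Z).1 stackZ. Qed.

(** Both sides are arrows into a separated prestack, so [n] may be replaced locally by some [p m];
    there [lam] is the conjugate of [E'], and the law is that of [E']. *)
Lemma lam_assoc U (g h : G' U) (n : N U) :
  lm (g * h)%g n \c fm k (aassoc B' g h n) = lm h n \c lm g (aob B' h n).
Proof.
have [S cS hS] := surj n; apply: (sepZ cS).
  by rewrite !fpr_comp !lam_pr fm_pr aassoc_pr.
move=> V s Ss; have [m [d dp]] := hS V s Ss.
pose h' := gres (fpr d) h; pose g' := gres (fpr d) g.
have eh : h' = gres (fpr d) h by [].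
have eg : g' = gres (fpr (amap B' d eh)) g by rewrite amap_pr.
have egh : (g' * h')%g = gres (fpr d) (g * h)%g by rewrite gresM.
exists (fo k (aob B' g' (aob B' h' (fo p m)))), (fm k (amap B' (amap B' d eh) eg)).
rewrite fm_pr !amap_pr; split=> //.
rewrite -[LHS]fcompA -fm_comp (aassoc_nat eg egh) fm_comp fcompA lam_nat.
rewrite -[RHS]fcompA lam_nat [RHS]fcompA lam_nat -[LHS]fcompA -[RHS]fcompA.
congr (_ \c _).
have e1 : g' = gres (fpr (eqv P' h' m)) g' by apply/gres_vert/eqv_pr.
apply: (@vepi _ _ _ _ _ _ _ (fm k (amap B' (eqv P' h' m) e1 \c eqv P' g' (aob A' h' m)))).
  by rewrite fm_pr fpr_comp amap_pr !(eqv_pr P') comp1c.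
rewrite -[LHS]fcompA -fm_comp -(@eqv_assoc _ _ _ _ _ _ _ P' _ g' h' m e1).
rewrite fm_comp fcompA lam_actE.
rewrite -[RHS]fcompA fm_comp [X in _ = _ \c X]fcompA lam_nat -[X in _ = _ \c X]fcompA.
rewrite lam_actE [RHS]fcompA lam_actE.
apply: (fcancel (a := tc eta m)).
  by rewrite [LHS]fpr_comp [RHS]fpr_comp !pull_act_pr !fm_pr aassoc_pr.
rewrite [LHS]fcompA pull_actE -[LHS]fcompA eta_nat [LHS]fcompA invariant_eqv_assoc.
by rewrite [RHS]fcompA pull_actE -[RHS]fcompA pull_actE fcompA.
Qed.

Lemma lam_unit U (n : N U) : lm 1%g n = fm k (aunit B' n).
Proof.
have [S cS hS] := surj n; apply: (sepZ cS); first by rewrite lam_pr fm_pr aunit_pr.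
move=> V s Ss; have [m [d dp]] := hS V s Ss.
have e : (1 : G' V)%g = gres (fpr d) 1%g by rewrite gres1.
exists (fo k (aob B' 1%g (fo p m))), (fm k (amap B' d e)).
rewrite fm_pr amap_pr; split=> //.
rewrite lam_nat -fm_comp aunit_nat fm_comp; congr (_ \c _).
apply: (@vepi _ _ _ _ _ _ _ (fm k (eqv P' 1%g m))); first by rewrite fm_pr (eqv_pr P').
rewrite lam_actE -fm_comp (eqv_unit P').
apply: (fcancel (a := tc eta m)); first by rewrite pull_act_pr !fm_pr aunit_pr.
by rewrite pull_actE eta_nat invariant_eqv_unit.
Qed.

Program Definition descended : equivariant B' (triv G' Z) k :=
  @Equivariant C G' N Z B' (triv G' Z) k (fun U h n => lm h n) _ _ _ _.
Next Obligation. by intros; apply: lam_pr. Qed.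
Next Obligation. by intros; apply: lam_nat. Qed.
Next Obligation. by intros; exact: etrans (lam_assoc _ _ _) (esym (fcomp1c _)). Qed.
Next Obligation. by intros; exact: etrans (fcomp1c _) (lam_unit _). Qed.

Lemma biquotient_factor :
  exists (l : functor Q Z) (xi : two_cell (comp_functor l (comp_functor q p)) f),
  equivariant_cell (comp_equivariant (triv_equivariant G l)
    (comp_equivariant (triv_equivariant G q) P)) E xi /\
  equivariant_cell (comp_equivariant (triv_equivariant G' l)
    (comp_equivariant L P')) E' xi.
Proof.
have [_ univ] := quotL; have [es _] := univ Z stackZ.
have [l [eps /invariant_cellP eps_eqv]] := es k descended.
have tp U (m : M U) : fpr (tc eta m \c tc eps (fo p m)) = idc U.
  by rewrite fpr_comp eta_pr (tc_pr eps) compc1.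
have eps_nat U V (n : N U) (n' : N V) (a : fhom n n') :
  tc eps n' \c fm l (fm q a) = fm k a \c tc eps n := tc_nat eps a.
have tn U V (m : M U) (m' : M V) (a : fhom m m') :
    (tc eta m' \c tc eps (fo p m')) \c fm (comp_functor l (comp_functor q p)) a
      = fm f a \c tc eta m \c tc eps (fo p m).
  by rewrite -[LHS]fcompA /= eps_nat [LHS]fcompA eta_nat [RHS]fcompA.
exists l, (@TwoCell _ _ _ (comp_functor l (comp_functor q p)) f _ tp tn).
split; apply/invariant_cellP => U g m /=; rewrite ?fcomp1c.
  by rewrite -[LHS]fcompA eps_nat [LHS]fcompA eta_eqv fcompA.
rewrite fm_comp -[LHS]fcompA [X in _ \c X = _]fcompA.
have := eps_eqv U g (fo p m); rewrite /= fcomp1c => ->.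
rewrite -[X in _ \c X = _]fcompA eps_nat [X in _ \c X = _]fcompA lam_actE.
by rewrite [LHS]fcompA pull_actE fcompA.
Qed.

End Exists.

Lemma biquotient_lift (Z : prestack C) (f : functor M Z)
    (E : equivariant A (triv G Z) f) (E' : equivariant A' (triv G' Z) f) :
  is_stack Z -> bi_invariant cm E E' ->
  exists (l : functor Q Z) (xi : two_cell (comp_functor l (comp_functor q p)) f),
  equivariant_cell (comp_equivariant (triv_equivariant G l)
    (comp_equivariant (triv_equivariant G q) P)) E xi /\
  equivariant_cell (comp_equivariant (triv_equivariant G' l)
    (comp_equivariant L P')) E' xi.
Proof.
move=> stackZ biE.
have [k [eta /invariant_cellP eta_eqv0]] := descent_exists E quotK chart stackZ.
have eta_eqv U (g : G U) (m : M U) :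
    tc eta m \c fm k (eqv P g m) = eqv E g m \c tc eta (aob A g m).
  by have := eta_eqv0 U g m; rewrite /= fcomp1c.
(* The 2-cell over G' x M descends along the torsor G' x M -> G' x N; the resulting [lam] is the
   residual invariance of [k]. *)
pose cell := @TwoCell _ _ _
  (comp_functor (comp_functor k (act_functor B')) (gprod_functor G' p))
  (comp_functor (comp_functor k (gprod_snd G' N)) (gprod_functor G' p))
  (descend_act E' eta) (descend_act_pr E' eta) (@descend_act_nat _ _ E' _ eta).
have [|lam lamE] := descent_cell (eta := cell) quotK (gprod_chart G' chart) stackZ.
  apply/invariant_cellP => U g [h m] /=; rewrite !fcomp1c.
  exact: (descend_act_eqv biE eta_eqv).
exact: (biquotient_factor stackZ eta_eqv (lam := lam) (fun U h m => lamE U (h, m))).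
Qed.

Lemma torsor_biquotient : is_biquotient cm
  (comp_equivariant (triv_equivariant G q) P) (comp_equivariant L P').
Proof.
split.
- by have [] := quotL.
- move=> U g g' x /=; rewrite !fcomp1c.
  have e : g' = gres (fpr (eqv P g x)) g' by apply/gres_vert/eqv_pr.
  rewrite -[LHS]fcompA -fm_comp (residual e) !fm_comp [LHS]fcompA.
  by rewrite invariant_eqv_nat -!fcompA.
- by move=> Z f E E'; apply: biquotient_lift.
move=> Z k k' eta stackZ /invariant_cellP h1 /invariant_cellP h2.
have [sepZ _ _] := (stackP Z).1 stackZ.
pose kq := comp_functor k q; pose kq' := comp_functor k' q.
pose eta0 : two_cell (comp_functor kq p) (comp_functor kq' p) :=
  @TwoCell _ _ _ (comp_functor kq p) (comp_functor kq' p) (fun U m => tc eta m)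
    (fun U m => tc_pr eta m) (fun _ _ _ _ a => tc_nat eta a).
(* Uniqueness in two stages: [eta] descends along [p] by its G-equivariance, then along [q] once its
   G'-equivariance on [N] is known. The latter is checked locally on the image of [p]. *)
have [|zeta zetaE] := descent_cell (eta := eta0) quotK chart stackZ.
  apply/invariant_cellP => U g m /=; rewrite !fcomp1c.
  by have := h1 U g m; rewrite /= !fcomp1c.
have [_ univ] := quotL; have [_ ff] := univ Z stackZ.
have zeta_nat U V (n : N U) (n' : N V) (a : fhom n n') :
  tc zeta n' \c fm k (fm q a) = fm k' (fm q a) \c tc zeta n := tc_nat zeta a.
have [|xi _] := ff k k' zeta; last by exists.
apply/invariant_cellP => U g n /=; rewrite !fcomp1c.
have [S cS hS] := surj n; apply: (sepZ _ _ _ cS).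
  by rewrite !fpr_comp !fm_pr (tc_pr zeta n) (tc_pr zeta (aob B' g n)) comp1c compc1.
move=> V s Ss; have [m [d dp]] := hS V s Ss.
pose g' := gres (fpr d) g.
have e : g' = gres (fpr d) g by [].
exists (fo k (fo q (aob B' g' (fo p m)))), (fm k (fm q (amap B' d e))).
rewrite !fm_pr amap_pr; split=> //.
rewrite -[LHS]fcompA -fm_comp invariant_eqv_nat fm_comp fcompA zeta_nat.
rewrite -[RHS]fcompA zeta_nat [RHS]fcompA -fm_comp invariant_eqv_nat fm_comp.
rewrite -[LHS]fcompA -[RHS]fcompA; congr (_ \c _).
apply: (@vepi _ _ _ _ _ _ _ (fm k (fm q (eqv P' g' m)))); first by rewrite !fm_pr
  (eqv_pr P').
rewrite -[RHS]fcompA zeta_nat !zetaE -[LHS]fcompA -fm_comp [RHS]fcompA -fm_comp.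
by have := h2 V g' m; rewrite /= !fcomp1c.
Qed.

End TorsorBiquotient.

(** * Exchanging the two groups *)

Section Swap.
Variables (C : site) (G G' : group_presheaf C) (M : prestack C).
Variables (A : action G M) (A' : action G' M).
Variable cm : forall U (g : G U) (g' : G' U) (x : M U),
  fhom (aob A g (aob A' g' x)) (aob A' g' (aob A g x)).
Variable cm' : forall U (g' : G' U) (g : G U) (x : M U),
  fhom (aob A' g' (aob A g x)) (aob A g (aob A' g' x)).
Hypothesis cmK : forall U (g : G U) (g' : G' U) (x : M U),
  cm g g' x \c cm' g' g x = fid _.
Hypothesis cmK' : forall U (g : G U) (g' : G' U) (x : M U),
  cm' g' g x \c cm g g' x = fid _.

Lemma bi_invariant_swap (Z : prestack C) (f : functor M Z)
    (E : equivariant A (triv G Z) f) (E' : equivariant A' (triv G' Z) f) :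
  bi_invariant cm E E' <-> bi_invariant cm' E' E.
Proof.
split=> h U g g' x.
  by rewrite [RHS]fcompA h -!fcompA -fm_comp cmK fm_id fcompc1.
by rewrite [RHS]fcompA h -!fcompA -fm_comp cmK' fm_id fcompc1.
Qed.

Lemma biquotient_swap (Q : prestack C) (r : functor M Q)
    (R : equivariant A (triv G Q) r) (R' : equivariant A' (triv G' Q) r) :
  is_biquotient cm' R' R -> is_biquotient cm R R'.
Proof.
case=> stackQ inv ex cell; split=> //.
- exact/bi_invariant_swap.
- move=> Z f E E' stackZ /bi_invariant_swap biE.
  by have [k [eta [h h']]] := ex Z f E' E stackZ biE; exists k, eta.
- by move=> Z k k' eta stackZ h h'; apply: (cell Z k k' eta).
Qed.

End Swap.

Theorem lemma4p1 (C : site) (N N' M : prestack C) (G G' : group_presheaf C)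
  (A : action G M) (A' : action G' M) (c : commuting A A')
  (* the G-torsor M -> N and the residual G'-action on N *)
  (p : functor M N) (P : equivariant A (triv G N) p)
  (torsor_p : is_torsor P)
  (B' : action G' N) (P' : equivariant A' B' p)
  (residual_B' : biequivariant c (commuting_triv_l G B') P P')
  (* the G'-torsor M -> N' and the residual G-action on N' *)
  (p' : functor M N') (R' : equivariant A' (triv G' N') p')
  (torsor_p' : is_torsor R')
  (B : action G N') (R : equivariant A B p')
  (residual_B : biequivariant c (commuting_triv_r G' B) R R')
  (* the quotient stacks N/G' and N'/G *)
  (Q Q' : prestack C)
  (quotient_Q : is_quotient_stack B' Q) (quotient_Q' : is_quotient_stack B Q') :
  equivalent Q Q'.
Proof.
have [BG [b [K [d [theta [quotK chart]]]]]] := is_torsor_chart torsor_p.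
have [BG' [b' [K' [d' [theta' [quotK' chart']]]]]] := is_torsor_chart torsor_p'.
have [q [L quotL]] := quotient_Q; have [q' [L' quotL']] := quotient_Q'.
(* Seen from the second torsor the groups trade places, so the commutation is read backwards,
   through its inverse. *)
pose cv U (g' : G' U) (g : G U) (x : M U) := vinv (cm_pr c g g' x).
have biQ : is_biquotient (fun U g g' x => cm c g g' x)
    (comp_equivariant (triv_equivariant G q) P) (comp_equivariant L P').
  apply: (torsor_biquotient _ quotK chart _ quotL); first exact: (cm_pr c).
  move=> U g g' x e.
  have e' : g = gres (fpr (eqv P' g' x)) g by apply/gres_vert/eqv_pr.
  by have := residual_B' U g g' x e' e; rewrite /= fcomp1c.
have biQ' : is_biquotient cv
    (comp_equivariant (triv_equivariant G' q') R') (comp_equivariant L' R).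
  apply: (torsor_biquotient _ quotK' chart' _ quotL').
    by move=> U g' g x; apply: vinv_pr.
  move=> U g' g x e.
  have e' : g' = gres (fpr (eqv R g x)) g' by apply/gres_vert/eqv_pr.
  have := residual_B U g g' x e e'; rewrite /= fcomp1c => h.
  (* The residual condition on [N'] is stated with the commutation itself; composing it with the
     inverse solves it for the form required with the groups exchanged. *)
  by rewrite [RHS]fcompA h -!fcompA -fm_comp vinvK fm_id fcompc1.
apply: (biquotient_equivalent biQ (biquotient_swap _ _ biQ')).
  by move=> U g g' x; apply: vinvK.
by move=> U g g' x; apply: vinvKl.
Qed.
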